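(* Let $R(t)\equiv R$ be the unique formal power series in $t$ with constant term $0$ satisfying $$t=\sum_{n\ge 0}\frac{1}{n+1}\binom{2n}{n}^2 R^{n+1}.$$ Let $G(t)$ be the generating function of rooted planar Eulerian orientations, counted by edges, and let $Q(t,\gamma)$ be the generating function of quartic rooted planar Eulerian orientations, with a weight $t$ per vertex and an additional weight $\gamma$ per alternating vertex. Then $$G(t)=\frac12\,Q(t,0)=\frac{1}{4t^2}\left(t-2t^2-R(t)\right)=t+5t^2+33t^3+\cdots .$$
   Context: A planar map is a connected graph (loops and multiple edges allowed) embedded in the sphere without edge crossings, considered up to orientation-preserving homeomorphism. It is rooted if one edge (the root edge) is distinguished and given a direction. Only maps with at least one edge are counted. An Eulerian orientation of a planar map is an orientation of all its edges such that every vertex has equal in-degree and out-degree (a loop contributes one to each). A rooted planar Eulerian orientation is a rooted planar map equipped with an Eulerian orientation in which the root edge is oriented canonically, i.e. its orientation in the Eulerian orientation agrees with its root direction. (Equivalently: a planar Eulerian orientation with one marked edge.) $G(t)=\sum_{n\ge1} g_n t^n$, where $g_n$ is the number of rooted planar Eulerian orientations with $n$ edges (no restriction on vertex degrees). A map is quartic if every vertex has degree $4$. In a quartic Eulerian orientation, each vertex is incident to two incoming and two outgoing half-edges; the vertex is alternating if, in cyclic order around it, the half-edges are in, out, in, out (alternately incoming and outgoing). $Q(t,\gamma)$ is the sum over all quartic rooted planar Eulerian orientations of $t^{\#\text{vertices}}\gamma^{\#\text{alternating vertices}}$; it begins $Q(t,\gamma)=(2\gamma+2)t+(9\gamma^2+16\gamma+10)t^2+\cdots$.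 Thus $Q(t,0)$ counts quartic rooted planar Eulerian orientations with no alternating vertex. *)

(* Defs.v *)
(** Uses the MathComp library. *)
From HB Require Import structures.
From mathcomp Require Import all_boot all_order all_algebra all_fingroup.

Set Implicit Arguments.
Unset Strict Implicit.
Unset Printing Implicit Defensive.

Import Order.TTheory GRing.Theory Num.Theory.

Local Open Scope ring_scope.

(** * Rooted planar Eulerian orientations

    Maps on an oriented closed surface, up to orientation-preserving
    homeomorphism, are encoded by rotation systems: [D] is the set of
    half-edges, [vrot] sends a half-edge to the next one in counterclockwise
    order around its vertex, and [flip] exchanges the two halves of each edge.
    Vertices, edges and faces are the cycles of [vrot], [flip] and
    [vrot * flip].  An orientation is given by the set [outs] of half-edges
    that leave their vertex (the tail halves of the oriented edges), and a
    root edge with a direction by the half-edge [root] at its tail. *)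

Record ormap (D : finType) := OrMap {
  vrot : {perm D};
  flip : {perm D};
  outs : {set D};
  root : D
}.

Definition ormap_code (D : finType) (m : ormap D) :=
  (vrot m, flip m, outs m, root m).

Definition ormap_decode (D : finType)
    (c : {perm D} * {perm D} * {set D} * D) : ormap D :=
  let: (s, a, o, r) := c in OrMap s a o r.

Lemma ormap_codeK (D : finType) : cancel (@ormap_code D) (@ormap_decode D).
Proof. by case. Qed.

HB.instance Definition _ (D : finType) :=
  Finite.copy (ormap D) (can_type (@ormap_codeK D)).

Section OrientedMaps.

Variables (D : finType) (m : ormap D).

Definition flip_matching : bool :=
  [forall x, (flip m x != x) && (flip m (flip m x) == x)].

Definition map_connected : bool :=
  [forall x, forall y,
    connect [rel u v | (v == vrot m u) || (v == flip m u)] x y].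

Definition map_vertices : {set {set D}} := porbits (vrot m).
Definition map_edges : {set {set D}} := porbits (flip m).
Definition map_faces : {set {set D}} := porbits (vrot m * flip m)%g.

(** Euler's relation V - E + F = 2, which for a connected map says that the
    surface is the sphere. *)
Definition map_planar : bool :=
  (#|map_vertices| + #|map_faces| == #|map_edges| + 2)%N.

Definition is_orientation : bool :=
  [forall x, (flip m x \in outs m) == (x \notin outs m)].

Definition is_eulerian : bool :=
  [forall v in map_vertices, #|v :&: outs m| == #|v :\: outs m|].

(** The last clause says that the root edge is oriented canonically. *)
Definition rooted_planar_EO : bool :=
  [&& flip_matching, map_connected, map_planar, is_orientation, is_eulerian
    & root m \in outs m].

Definition quartic : bool := [forall v in map_vertices, #|v| == 4].

(** On a vertex of degree 4, outgoing and incoming half-edges alternate. *)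
Definition alternating (v : {set D}) : bool :=
  [forall x in v, (vrot m x \in outs m) == (x \notin outs m)].

Definition alternating_vertices : {set {set D}} :=
  [set v in map_vertices | alternating v].

End OrientedMaps.

Definition ormap_iso (D : finType) (m1 m2 : ormap D) : bool :=
  [exists p : {perm D},
    [&& [forall x, p (vrot m1 x) == vrot m2 (p x)],
        [forall x, p (flip m1 x) == flip m2 (p x)],
        [forall x, (p x \in outs m2) == (x \in outs m1)]
      & p (root m1) == root m2]].

(** Number of isomorphism classes of oriented maps with [n] edges (hence
    [2 * n] half-edges) that satisfy [P].  For [n = 0] there is no root and
    the number is 0. *)
Definition count_classes (n : nat) (P : pred (ormap 'I_(2 * n))) : nat :=
  #|equivalence_partition (@ormap_iso _) [set m | P m]|.

Definition g (n : nat) : nat :=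
  count_classes (fun m : ormap 'I_(2 * n) => rooted_planar_EO m).

(** A quartic map with [v] vertices has [2 * v] edges. *)
Definition q (v k : nat) : nat :=
  count_classes (fun m : ormap 'I_(2 * (2 * v)) =>
    [&& rooted_planar_EO m, quartic m, #|map_vertices m| == v
      & #|alternating_vertices m| == k]).

(** * Formal power series with rational coefficients *)

Definition fps := nat -> rat.

Definition fps_X : fps := fun n => (n == 1%N)%:R.

Definition fps_mul (F H : fps) : fps :=
  fun n => \sum_(i < n.+1) F i * H (n - i)%N.

Definition fps_exp (F : fps) (k : nat) : fps :=
  iter k (fps_mul F) (fun n => (n == 0%N)%:R).

(** Convergence of an infinite sum in the formal topology: every coefficient
    of the partial sums is eventually constant. *)
Definition fps_sums_to (u : nat -> fps) (S : fps) : Prop :=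
  forall m, exists N0, forall N, (N0 <= N)%N -> \sum_(n < N) u n m = S m.

Definition is_R (R : fps) : Prop :=
  R 0%N = 0 /\
  fps_sums_to
    (fun n m => (n.+1%:R)^-1 * ('C(2 * n, n)%:R) ^+ 2 * fps_exp R n.+1 m)
    fps_X.

Definition G : fps := fun n => (g n)%:R.

(** The series Q(t, gamma), as a series in t whose coefficients are
    polynomials in gamma; a map with [v] vertices has at most [v] alternating
    ones. *)
Definition Q : nat -> {poly rat} :=
  fun v => \sum_(k < v.+1) (q v k)%:R *: 'X^k.

Definition Q_at (c : rat) : fps := fun v => (Q v).[c].

(* Main.v *)
(* Maps are counted by peeling the root edge, which gives for each model a
   recursion on words: E(w) counts the planar maps whose root vertex is surrounded
   by the word w of outgoing (+) and incoming (-) half-edges.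

   1. If each - is replaced by [- - t(- - +)], the words of quartic orientations
   without alternating vertex satisfy the recursion of general orientations. Hence
   G(t^2) = E(+ - - +) and Q(t^2, 0) = E(+ + - -) + E(+ - - +) in the quartic model.

   2. Each non-alternating quartic vertex is expanded into an edge joining two
   cubic vertices. The series H(a, b) of the words with a + b half-edges of new
   edges, a of one kind and b of the other, satisfy a closed system. Write
   H_n = sum_b H(n-1, b) x^(b+1); then H_n is the part of positive degree in x of
   theta H_(n-1) for a Laurent series theta determined by H_1, and H(a, b) is
   symmetric. This system has a unique solution.

   3. The solution comes from theta - theta^2 = r x / (1 - 1/x). By Spitzer's
   identity, sum_n z^n H_n is the exponential of the part of positive degree in x
   of sum_n (z theta)^n / n, and Lagrange inversion gives
   [x^m] theta^n / n = sum_N (1/N) C(2N-n-1, N-1) C(2N-m-1, N-1) r^N, which is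
   symmetric in n and m. Then H(0, 0) = sum_n C(2n, n)^2 r^(n+1) / (n+1), so
   r is R, and 2 H(0, 1) = H(0, 0) - r. *)

From HB Require Import structures.
From mathcomp Require Import all_boot all_order all_algebra all_fingroup.
From mathcomp Require Import boolp.
From mathcomp Require Import zify ring.
Require Import Defs.

Set Implicit Arguments.
Unset Strict Implicit.
Unset Printing Implicit Defensive.

(** Deleting the root edge may disconnect the map, so the peeled objects have several root vertices,
    one per component. Planarity is kept as an equality between orbit counts, and Ree's inequality
    then forbids the root edge to join two root vertices. Maps are counted with labelled half-edges:
    a rooted map has no nontrivial automorphism, so (2N)! factors out, and symmetries that the
    recursion hides, such as rotation of the root word, come from bijections of labelled maps. All
    series count edges. A quartic vertex amounts to two edges, or three after expansion; hence the
    substitutions of X^2 and X^3. Multiplied by X^(3 + a + b), the series of a + b new half-edges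
    becomes a series in t = X^3, and the powers of X leave the system. Every unknown vanishes at 0,
    so each use of the system gains one order, and an explicit solution need only be checked. The
    recursion alone leaves H(0, b) undetermined; symmetry closes it, and is evident for the explicit
    solution only on its logarithm. The link with G is H(0, 1) = t^2 (1 + 2 G(t)), the origin of the
    term 2 t^2 in the formula. *)

Local Notation orbit := fingraph.orbit.
Local Notation root := Defs.root.

(** * Cycles and orbits of permutations *)

Section CyclePerm.

Variable D : finType.
Implicit Types (x y z : D) (s r : seq D) (p : {perm D}).

Local Open Scope group_scope.

(** The cyclic permutation of a list, written as a product of transpositions so that the effect of
    one transposition on the number of orbits can be applied letter by letter. Products of
    permutations act from left to right. *)
Fixpoint cyc s : {perm D} :=
  if s is x :: s' then cyc s' * tperm x (head x s') else 1.

Lemma cyc_out s z : z \notin s -> cyc s z = z.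
Proof.
elim: s => [|x s IHs] /=; first by rewrite perm1.
rewrite inE negb_or => /andP[zx zs]; rewrite permM IHs // tpermD // 1?eq_sym //.
by case: s zs {IHs} => [|y s] //=; rewrite inE negb_or => /andP[].
Qed.

Lemma cyc_on s : perm_on [set z in s] (cyc s).
Proof.
apply/subsetP => z; rewrite !inE; apply: contraR => /cyc_out/eqP //.
Qed.

Lemma cyc_commute s p : {in s, forall z, p z = z} -> commute (cyc s) p.
Proof.
move=> ps; apply: (perm_onC (cyc_on s) (S2 := [set z | z \notin s])).
  by apply/subsetP => z; rewrite !inE; apply: contraNN => /ps ->.
by rewrite -setI_eq0; apply/eqP/setP => z; rewrite !inE andbN.
Qed.

Lemma next_at_tperm x y z a s : z != x -> x \notin s -> y \notin s ->
  (z = y -> a = y) -> next_at z x a s = tperm x y (next_at z y a s).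
Proof.
move=> zx; elim: s a => [|b s IHs] a /=.
  move=> _ _ zy; case: eqP => [_|za]; first by rewrite tpermR.
  by rewrite tpermD // 1?eq_sym //; apply/eqP => e; apply: za; rewrite zy.
rewrite !inE !negb_or => /andP[xb xs] /andP[yb ys] zy.
case: eqP => [_|za]; first by rewrite tpermD.
by apply: IHs => // e; case: za; rewrite zy.
Qed.

Lemma cycE s z : uniq s -> cyc s z = next s z.
Proof.
elim: s => [|x s IHs]; first by rewrite perm1.
case: s IHs => [|y s] IHs /=; first by rewrite mul1g tperm1 perm1; case: eqP.
move=> /andP[xs us]; rewrite permM {}IHs //=.
move: xs us; rewrite inE negb_or => /andP[xy xs] /andP[ys us].
have [->|zx] := eqVneq z x; last first.
  by rewrite -next_at_tperm.
have -> : next_at x y y s = x.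
  have : x != y by []. 
  by elim: s {1 3}y xs {ys us} => [|b s IHs] a /=; rewrite ?inE ?negb_or => + /negPf->// => /andP[xb xs]; apply: IHs.
by rewrite tpermL.
Qed.

Lemma cyc_rot n s : uniq s -> cyc (rot n s) = cyc s.
Proof. by move=> us; apply/permP => z; rewrite !cycE ?rot_uniq // next_rot. Qed.

Lemma cyc_catC s r : uniq (s ++ r) -> cyc (s ++ r) = cyc (r ++ s).
Proof. by move=> u; rewrite -(cyc_rot (size s) u) rot_size_cat. Qed.

Lemma cyc_ins x s r : uniq (s ++ x :: r) ->
  cyc (s ++ x :: r) = cyc (s ++ r) * tperm x (head x (r ++ s)).
Proof.
move=> u; rewrite (cyc_catC u) /=; congr (_ * _); apply: cyc_catC.
move: u; rewrite (uniq_catC s) /= => /andP[_].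
by [].
Qed.

(** A transposition cuts a cycle through both of its points in two; read backwards, it joins two
    cycles. This is how the vertices change when an edge is removed. *)
Lemma cyc_cut x y s r : uniq (x :: s ++ y :: r) ->
  tperm x y * cyc (x :: s ++ y :: r) = cyc (y :: s) * cyc (x :: r).
Proof.
elim: s => [|a s IHs].
  rewrite /= mul1g tperm1 mul1g => /andP[]; rewrite inE negb_or => /andP[xy xr] /andP[yr ur].
  have cm : commute (cyc r) (tperm x y).
    apply: cyc_commute => z zr; rewrite tpermD //; apply/eqP => e.
    - by move: xr; rewrite e zr.
    - by move: yr; rewrite e zr.
  rewrite -mulgA !mulgA -cm -!mulgA; congr (_ * _).
  case: r xr yr {ur cm} => [|b r] /=; first by rewrite !tperm1 mul1g tperm2.
  rewrite !inE !negb_or => /andP[xb _] /andP[yb _].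
  apply: (mulgI (tperm x y)); rewrite !mulgA tperm2 mul1g.
  apply/permP => z; rewrite !permM.
  have H : tperm y b = tperm x b ^ tperm x y by rewrite tpermJ tpermL tpermD.
  by rewrite H /conjg tpermV !permM tpermK.
move=> u; have ua : uniq ([:: x] ++ a :: s ++ y :: r) by [].
have /andP[/norP[xa xsr] /andP[aNsr usr]] :
    (~~ ((x == a) || (x \in s ++ y :: r))) && ((a \notin s ++ y :: r) && uniq (s ++ y :: r)).
  by move: u; rewrite /= inE.
have ux : uniq (x :: s ++ y :: r) by rewrite /= xsr.
have uy : uniq ([:: y] ++ a :: s).
  have : uniq (a :: s ++ y :: r) by rewrite /= aNsr.
  rewrite -cat_cons uniq_catC => /subseq_uniq; apply.
  by apply: (@cat_subseq _ [:: y] (a :: s) [:: y]) => //; apply: suffix_subseq.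
have uax : a \notin x :: r.
  by move: aNsr; rewrite mem_cat !inE !negb_or [a == x]eq_sym xa /= => /and3P[].
rewrite [cyc (x :: (a :: s) ++ _)](cyc_ins ua) mulgA [X in X * _](IHs ux) [cyc (y :: a :: s)](cyc_ins uy).
have -> : head a ((s ++ y :: r) ++ [:: x]) = head a (s ++ [:: y]) by case: (s).
have cm : commute (cyc (x :: r)) (tperm a (head a (s ++ [:: y]))).
  apply: cyc_commute => z zr; rewrite tpermD //; apply/eqP => e.
    by move: uax; rewrite e zr.
  have : z \in s ++ [:: y] by rewrite -e; case: (s) => [|b l] /=; rewrite inE eqxx.
  move=> zs; have : uniq (x :: (s ++ [:: y]) ++ r) by rewrite -catA.
  rewrite cons_uniq cat_uniq mem_cat negb_or => /and4P[/andP[xs _] _ /hasPn h _].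
  move: zr; rewrite inE => /orP[/eqP zx|/h]; last by rewrite /= zs.
  by move: xs; rewrite -zx zs.
by move: cm; rewrite /commute -[[:: y] ++ s]/(y :: s); move: (cyc (x :: r)) (cyc (y :: s)) => C1 C2 cm; rewrite -!mulgA cm.
Qed.

Lemma cyc_fcycle (f : D -> D) s : fcycle f s -> uniq s -> {in s, cyc s =1 f}.
Proof. by move=> fs us z zs; rewrite cycE //; apply: nextE. Qed.

Lemma fcycle_cyc s : uniq s -> fcycle (cyc s) s.
Proof.
move=> us; rewrite (eq_cycle (e' := frel (next s))) ?cycle_next //.
by move=> x y /=; rewrite cycE.
Qed.

Lemma porbitsJ p q : #|porbits (p ^ q)| = #|porbits p|.
Proof.
have pE x : porbit (p ^ q) (q x) = q @: porbit p x.
  apply/setP => y; apply/porbitP/imsetP => [[i ->]|[z /porbitP[i ->] ->]].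
    by exists ((p ^+ i) x); rewrite ?mem_porbit // -conjXg permJ.
  by exists i; rewrite -conjXg permJ.
rewrite -(card_imset (porbits p) (imset_inj (@perm_inj _ q))) -imset_comp.
congr #|pred_of_set _|; apply/setP => B; apply/imsetP/imsetP => -[x _ ->].
  by exists (q^-1 x) => //=; rewrite -pE permKV.
by exists (q x) => //=; rewrite -pE.
Qed.

Lemma porbit_fixed p x y : p x = x -> (y \in porbit p x) = (y == x).
Proof.
move=> px; apply/porbitP/eqP => [[i ->]|->]; first exact: permX_fix.
by exists 0%N; rewrite expg0 perm1.
Qed.

Lemma porbits_tpermR p x y :
  #|porbits (p * tperm x y)| + (x \notin porbit p y).*2 = #|porbits p| + (x != y).
Proof.
have := porbits_mul_tperm p^-1 x y.
rewrite /= -[tperm x y * p^-1]invgK invMg invgK tpermV !porbitsV.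
by rewrite porbitV.
Qed.

Lemma porbits_tperm_fixed p x z : p x = x ->
  #|porbits (p * tperm x z)| + (x != z) = #|porbits p|.
Proof.
move=> px; have := porbits_tpermR p x z.
rewrite porbit_sym porbit_fixed // [z == x]eq_sym.
by case: (x == z) => /=; lia.
Qed.

Lemma porbits_cyc p s : uniq s -> {in s, forall z, p z = z} ->
  #|porbits (p * cyc s)| + (size s).-1 = #|porbits p|.
Proof.
elim: s => [|x s IHs]; first by rewrite mulg1 addn0.
move=> /andP[xs us] ps; have {}IHs := IHs us (fun z zs => ps z (mem_behead (s := x :: s) zs)).
have fx : (p * cyc s) x = x by rewrite permM ps ?mem_head // cyc_out.
have := porbits_tperm_fixed (head x s) fx.
rewrite [cyc (x :: s)]/(cyc s * tperm x (head x s)) mulgA.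
set c := #|porbits (p * cyc s * _)|; set c' := #|porbits (p * cyc s)| in IHs *.
move: (c) (c') IHs; case: s xs {us ps fx c c'} => [|y s] /= + c c'; first by rewrite eqxx; lia.
by rewrite inE negb_or => /andP[-> _]; lia.
Qed.

Lemma porbits1 : #|porbits (1 : {perm D})| = #|D|.
Proof.
rewrite card_imset ?cardsT // => x y e; apply/eqP; rewrite -(@porbit_fixed 1 y x) ?perm1 //.
by rewrite -e porbit_id.
Qed.

Definition stable (p : {perm D}) (B : {set D}) := forall x, x \in B -> p x \in B.

Lemma stable_inv p B x : stable p B -> p x \in B -> x \in B.
Proof.
move=> sB pxB; have : stable (p ^+ (#[p]).-1) B.
  by elim: _.-1 => [|n IHn] y yB; rewrite ?expg0 ?perm1 // expgSr permM sB ?IHn.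
move=> /(_ _ pxB); rewrite -permM -expgS prednK ?order_gt0 // expg_order perm1.
by [].
Qed.

Lemma stable_porbit p B x y : stable p B -> x \in B -> y \in porbit p x -> y \in B.
Proof.
move=> sB xB /porbitP[i ->]; elim: i => [|i IHi]; first by rewrite perm1.
by rewrite expgSr permM sB.
Qed.

Lemma stableM p q B : stable p B -> stable q B -> stable (p * q) B.
Proof. by move=> sp sq x xB; rewrite permM sq ?sp. Qed.

Lemma stable_tperm x y (B : {set D}) : (x \in B) = (y \in B) -> stable (tperm x y) B.
Proof. by move=> xy z zB; case: tpermP zB => // -> ; rewrite xy. Qed.

(* The genus of a hypermap is nonnegative (Ree), with the number of orbits
   bounded by the size of any set meeting all of them. *)
Lemma euler_ineq p q (R : {set D}) :
  (forall B, stable p B -> stable q B -> [disjoint R & B] -> B = set0) ->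
  #|porbits p| + #|porbits q| + #|porbits (p * q)| <= #|D| + #|R|.*2.
Proof.
have [n] := ubnP #|[set x | q x != x]|.
elim: n => // n IHn in q R *; rewrite ltnS => le_n hit.
have [|/set0Pn[x]] := eqVneq [set x | q x != x] set0.
  move=> /setP q0; have q1 z : q z = z by have := q0 z; rewrite !inE => /negbFE/eqP.
  have -> : q = 1 by apply/permP => z; rewrite perm1.
  rewrite mulg1 porbits1; suff : #|porbits p| <= #|R| by lia.
  pose f (z : D) := porbit p z; apply: leq_trans (leq_imset_card f R).
  apply/subset_leq_card/subsetP => _ /imsetP[z _ ->].
  have : ~~ [disjoint R & porbit p z].
    apply/negP => Rz; have := porbit_id p z.
    rewrite (hit (porbit p z)) ?inE // => w wz; last by rewrite q1.
    by case/porbitP: wz => i ->; rewrite -permM -expgSr mem_porbit.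
  case/pred0Pn => w /= /andP[wR wz]; apply/imsetP; exists w => //.
  by apply/eqP; rewrite eq_sym eq_porbit_mem.
rewrite inE => qx; set y := q x in qx.
(* Splitting [x] off its cycle gives a [q'] that moves fewer points and has one more orbit than [q];
   the numbers of orbits of [p * q'] and [p * q] differ by one, up or down. *)
pose q' := q * tperm x y.
have q'x : q' x = x by rewrite permM tpermR.
have qE : q = q' * tperm x y by rewrite -mulgA tperm2 mulg1.
have lt_q' : #|[set z | q' z != z]| < n.
  apply: leq_trans le_n; apply: proper_card; apply/properP; split.
    apply/subsetP => z; rewrite !inE permM; apply: contraNN => /eqP qz.
    rewrite qz tpermD //; apply: contraNneq qx => xz; first by rewrite /y xz qz.
    by apply/eqP/(@perm_inj _ q); rewrite xz qz -xz.
  by exists x; rewrite !inE ?q'x ?eqxx.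
have cq : #|porbits q'| = #|porbits q|.+1.
  by have := porbits_tperm_fixed y q'x; rewrite -qE eq_sym qx addn1 => ->.
have cpq : #|porbits (p * q)| + (x \notin porbit (p * q') y).*2 = #|porbits (p * q')| + 1.
  by rewrite {1}qE mulgA porbits_tpermR eq_sym qx.
(* If the roots miss a set [B] stable under [p] and [q'], the transposition links [B] to its
   complement, so [x] and [y] lie on different cycles of [p * q']. The new root in [B] is then paid
   for by one orbit of [q'] and one of [p * q']. *)
have [/existsP[B]|] := boolP [exists B : {set D}, [&& B != set0, [disjoint R & B],
    [forall z in B, p z \in B] & [forall z in B, q' z \in B]]].
  case/and4P => B0 RB /forall_inP pB /forall_inP q'B.
  have xyB : (x \in B) != (y \in B).
    apply: contraNneq B0 => xyB; apply/eqP/hit => //.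
    by rewrite qE; apply: stableM => //; apply: stable_tperm.
  have xNy : x \notin porbit (p * q') y.
    have spq : stable (p * q') B by apply: stableM.
    apply: contraNN xyB => xy; apply/eqP; apply/idP/idP => H.
      by apply: (stable_porbit spq H); rewrite porbit_sym.
    exact: (stable_porbit spq H).
  pose u := if x \in B then x else y; pose v := if x \in B then y else x.
  have hit' C : stable p C -> stable q' C -> [disjoint (u |: R) & C] -> C = set0.
    move=> pC q'C; rewrite -setI_eq0 setIUl setU_eq0 !setI_eq0 disjoints1 => /andP[uC RC].
    have [vC|vC] := boolP (v \in C); last first.
      apply: hit => //; rewrite qE; apply: stableM => //; apply: stable_tperm.
      by move: uC vC; rewrite /u /v; case: ifP => _ /negPf-> /negPf->.
    have : B :|: C = set0.
      apply: hit.
      - by move=> z; rewrite !inE => /orP[/pB->|/pC->]; rewrite ?orbT.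
      - rewrite qE; apply: stableM.
          by move=> z; rewrite !inE => /orP[/q'B->|/q'C->]; rewrite ?orbT.
        apply: stable_tperm; rewrite !inE; move: xyB uC vC; rewrite /u /v.
        by case: (x \in B) => /=; case: (y \in B) => //= _ _ ->; rewrite ?orbT.
      - by rewrite -setI_eq0 setIUr setU_eq0 !setI_eq0 RB.
    by move/setP/(_ v); rewrite !inE vC orbT.
  have := IHn q' (u |: R) lt_q' hit'; rewrite cq.
  have := cardsU1 u R; move: cpq; rewrite xNy.
  by case: (u \notin R); lia.
rewrite negb_exists => /forallP noB.
have hit' C : stable p C -> stable q' C -> [disjoint R & C] -> C = set0.
  move=> pC q'C RC; apply/eqP; apply: contraT => C0; move: (noB C).
  by rewrite C0 RC /=; case/negP; apply/andP; split; apply/forall_inP.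
have := IHn q' R lt_q' hit'; rewrite cq.
by move: cpq; case: (_ \notin _) => /=; lia.
Qed.

End CyclePerm.
Arguments cyc : simpl never.

(** * The Euler relation of a map with several root vertices *)

Lemma euler_split_arith (d1 d2 d3 d4 d5 c1 c2 c3 c4 k n1 n2 a b c : nat) :
  d5 + 1 = d4 -> c2 + n1 + n2 = c4 -> c3 + (a + (b + c)) = d3 + (n1 + (n2 + k)) ->
  c1 + (a + b.+1 + c).+1 = d3 + (1 + k) ->
  (c1 + d5 + c2 == d1 + (d2 + (1 + k)).*2) =
  (c3 + d4 + c4 == d1 + (d2.+2 + (n1 + (n2 + k))).*2).
Proof. by move=> h1 h2 h3 h4; apply/eqP/eqP; lia. Qed.

Lemma euler_merge_arith (d1 d2 d3 d4 d5 e3 c1 c2 c3 c4 k n1 a b c : nat) :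
  d5 + 1 = d4 -> c2 + n1 + true = c4 -> e3 + a = d3 ->
  c3 + (a + (b + c)) = d3 + (n1 + k) -> c1 + (b + c).+1 = e3 + (1 + k) ->
  (c1 + d5 + c2 == d1 + (d2 + (1 + k)).*2) =
  (c3 + d4 + c4 == d1 + (d2.+2 + (n1 + k)).*2).
Proof. by move=> h1 h2 h3 h4 h5; apply/eqP/eqP; lia. Qed.

Section TotalPerm.

Variable D : finType.
Implicit Types (x y z : D) (s r : seq D) (ss : seq (seq D)) (p q a : {perm D}).

Local Open Scope group_scope.

(** The rotation at all vertices: [p] moves only half-edges of ordinary vertices, and the lists of
    [ss] restore the root vertices. *)
Fixpoint tot p ss : {perm D} := if ss is s :: ss' then tot p ss' * cyc s else p.

Definition nn ss := count (fun s => ~~ nilp s) ss.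

Lemma tot_out p ss z : z \notin flatten ss -> p z = z -> tot p ss z = z.
Proof.
elim: ss => //= s ss IHs; rewrite mem_cat negb_or => /andP[zs zss] pz.
by rewrite permM IHs // cyc_out.
Qed.

Lemma tot_notin p ss z : z \notin flatten ss -> p z \notin flatten ss -> tot p ss z = p z.
Proof.
elim: ss => //= s ss IHs; rewrite !mem_cat !negb_or => /andP[zs zss] /andP[pzs pzss].
by rewrite permM IHs // cyc_out.
Qed.

Lemma porbits_tot p ss : uniq (flatten ss) -> {in flatten ss, forall z, p z = z} ->
  #|porbits (tot p ss)| + size (flatten ss) = #|porbits p| + nn ss.
Proof.
elim: ss => //= s ss IHs; rewrite cat_uniq => /and3P[us dis uss] pss.
have ps : {in s, forall z, p z = z} by move=> z zs; rewrite pss // mem_cat zs.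
have psr : {in flatten ss, forall z, p z = z} by move=> z zs; rewrite pss // mem_cat zs orbT.
have {}IHs := IHs uss psr.
have pt : {in s, forall z, tot p ss z = z}.
  move=> z zs; apply: tot_out; last exact: ps.
  by apply: contraNN dis => zss; apply/hasP; exists z.
have := porbits_cyc us pt; rewrite size_cat /nilp.
by case: (s) => [|y t] /=; rewrite /nn in IHs *; lia.
Qed.

Lemma tot_mul p ss q : {in flatten ss, forall z, q z = z} -> tot (p * q) ss = tot p ss * q.
Proof.
elim: ss => //= s ss IHs qss; rewrite IHs; last by move=> z zs; rewrite qss // mem_cat zs orbT.
by rewrite -!mulgA cyc_commute // => z zs; rewrite qss // mem_cat zs.
Qed.

Lemma tperm_commute x y p : p x = x -> p y = y -> commute (tperm x y) p.
Proof.
move=> px py; rewrite /commute (conjgC (tperm x y) p) tpermJ px py.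
by [].
Qed.

(** Conjugation by the transposition of [x] and [y] cancels its two outer occurrences. What remains
    is [p * a] with its fixed points [y] and [x] inserted into other orbits, and each insertion
    loses one orbit unless it is trivial. *)
Lemma faces_step x y z1 z0 p a : x != y -> z1 != x -> 
  p x = x -> p y = y -> a x = x -> a y = y ->
  #|porbits (tperm x y * p * tperm y z1 * tperm x z0 * (a * tperm x y))|
    + (z1 != y) + (z0 != x) = #|porbits (p * a)|.
Proof.
move=> xy z1x px py ax ay.
rewrite -(porbitsJ _ (tperm x y)) /conjg tpermV -!mulgA tpermKg.
rewrite tperm2 mulg1 (conjgC (tperm x z0)) tpermJ ax !mulgA.
rewrite -[_ * _ * a]mulgA (conjgC (tperm y z1)) tpermJ ay !mulgA.
have e1 : (y != a z1) = (z1 != y) by rewrite -{1}ay (inj_eq perm_inj) eq_sym.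
have e0 : (x != a z0) = (z0 != x) by rewrite -{1}ax (inj_eq perm_inj) eq_sym.
have f1 : (p * a) y = y by rewrite permM py.
have f0 : (p * a * tperm y (a z1)) x = x.
  rewrite permM permM px ax tpermD //; first by rewrite eq_sym.
  by apply: contraNneq z1x => az; apply/eqP/(@perm_inj _ a); rewrite az ax.
by rewrite -(porbits_tperm_fixed (a z1) f1) -(porbits_tperm_fixed (a z0) f0) e1 e0 addnAC.
Qed.

(** A half-edge outside [A] is fixed by everything: it is one vertex, one edge and one face, which
    [#|~: A|] balances. A spherical component with h half-edges has V + E + F = h + 2, and [nn ss]
    is the number of components when each has exactly one nonempty root vertex; empty lists are
    invisible to permutations. *)
Definition euler (A : {set D}) p a ss :=
  #|porbits (tot p ss)| + #|porbits a| + #|porbits (tot p ss * a)|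
    == #|D| + (#|~: A| + nn ss).*2.

Lemma uniq_insert2 x y s r ss : uniq (flatten ((x :: s ++ y :: r) :: ss)) =
  [&& x != y, x \notin flatten [:: s, r & ss], y \notin flatten [:: s, r & ss]
    & uniq (flatten [:: s, r & ss])].
Proof.
have -> : uniq (flatten ((x :: s ++ y :: r) :: ss)) = uniq (x :: y :: flatten [:: s, r & ss]).
  apply: perm_uniq; rewrite /= -!catA /= perm_cons.
  exact/permPl/(perm_catCA s [:: y]).
by rewrite /= inE negb_or -!andbA.
Qed.

Lemma card_setC_D2 (A : {set D}) x y : x \in A -> y \in A -> x != y ->
  #|~: (A :\: [set x; y])| = #|~: A|.+2.
Proof.
move=> xA yA xy; have -> : ~: (A :\: [set x; y]) = x |: (y |: ~: A).
  by apply/setP => z; rewrite !inE negb_and negbK -orbA.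
by rewrite !cardsU1 !inE negb_or xy xA yA.
Qed.

(** The vertices are compared by [cyc_cut] and the faces by [faces_step]. An empty part [s] or [r]
    is a trivial insertion in [faces_step], which matches the way [nn] ignores empty lists. *)
Lemma euler_split (A : {set D}) x y p a s r ss : x \in A -> y \in A ->
  uniq (flatten ((x :: s ++ y :: r) :: ss)) ->
  {in flatten ((x :: s ++ y :: r) :: ss), forall z, p z = z} -> a x = x -> a y = y ->
  euler A p (a * tperm x y) ((x :: s ++ y :: r) :: ss) =
  euler (A :\: [set x; y]) p a [:: s, r & ss].
Proof.
move=> xA yA U pF ax ay; have := U; rewrite uniq_insert2 => /and4P[xy xF yF U'].
have pF' : {in flatten [:: s, r & ss], forall z, p z = z}.
  by move=> z zF; apply: pF; move: zF; rewrite /= !(mem_cat, inE) => /or3P[]->; rewrite ?orbT.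
have px : p x = x by apply: pF; rewrite /= inE eqxx.
have py : p y = y by apply: pF; rewrite /= !(mem_cat, inE) eqxx !orbT.
have := porbits_tot U pF; have := porbits_tot U' pF'.
have ca : #|porbits (a * tperm x y)| + 1 = #|porbits a|.
  by have := porbits_tperm_fixed y ax; rewrite xy.
rewrite /euler /=; set P := tot p ss.
move: xF yF; rewrite /= !mem_cat !negb_or => /and3P[xs xr xss] /and3P[ys yr yss].
have Px : P x = x by apply: tot_out.
have Py : P y = y by apply: tot_out.
have cs : commute (cyc r) (cyc s).
  apply: cyc_commute => z zr; apply: cyc_out; apply: contraTN U' => zs.
  by rewrite /= cat_uniq; apply/nandP; right; apply/nandP; left; rewrite negbK; apply/hasP; exists z; rewrite // mem_cat zr.
have cy : commute (cyc r) (tperm y (head y s)).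
  apply: cyc_commute => z zr; apply: tpermD; apply: contraTneq zr => <- //.
  case: (s) U' => //= b t /andP[]; rewrite !mem_cat !negb_or.
  by case/and3P.
have T : P * cyc (x :: s ++ y :: r) =
    tperm x y * (P * cyc r * cyc s) * tperm y (head y s) * tperm x (head x r).
  rewrite -[cyc (x :: _)](tpermKg x y) cyc_cut; last first.
    by have : uniq ((x :: s ++ y :: r) ++ flatten ss) := U; rewrite cat_uniq => /and3P[].
  rewrite [cyc (y :: s)]/(cyc s * _) [cyc (x :: r)]/(cyc r * _).
  rewrite !mulgA -(tperm_commute Px Py) -!mulgA; congr (_ * (_ * _)).
  by rewrite !mulgA cs -!mulgA; congr (_ * _); rewrite !mulgA cy.
have z1x : head y s != x.
  by case: (s) xs => [|b t] /=; rewrite 1?eq_sym // inE negb_or => /andP[].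
have Qx : (P * cyc r * cyc s) x = x by rewrite !permM Px !cyc_out.
have Qy : (P * cyc r * cyc s) y = y by rewrite !permM Py !cyc_out.
have := faces_step (head x r) xy z1x Qx Qy ax ay; rewrite -T.
have hy : (head y s != y) = ~~ nilp s.
  by case: (s) ys => [|b t] /=; rewrite ?eqxx // inE negb_or eq_sym => /andP[].
have hx : (head x r != x) = ~~ nilp r.
  by case: (r) xr => [|b t] /=; rewrite ?eqxx // inE negb_or eq_sym => /andP[].
rewrite hy hx card_setC_D2 // !size_cat /= ?size_cat /= /nn /=.
set c1 := #|porbits (_ * cyc (x :: _))|; set c2 := #|porbits (_ * cyc (x :: _) * _)|.
set c3 := #|porbits (P * cyc r * cyc s)|; set c4 := #|porbits (P * cyc r * cyc s * _)|.
by move=> h2 h3 h4; have := euler_split_arith _ _ ca h2 h3 h4; apply.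
Qed.

Lemma uniq_merge x y s r ss : uniq (y :: r) -> uniq (flatten ((x :: s) :: ss)) ->
  {in y :: r, forall z, z \notin flatten ((x :: s) :: ss)} ->
  [/\ x != y, x \notin flatten ((r ++ s) :: ss), y \notin flatten ((r ++ s) :: ss)
    & uniq (flatten ((r ++ s) :: ss))].
Proof.
move=> Ur Us dis.
have : uniq ((y :: r) ++ flatten ((x :: s) :: ss)).
  by rewrite cat_uniq Ur Us andbT; apply/hasPn => z zs; apply/negP => /dis; rewrite zs.
have -> : uniq ((y :: r) ++ flatten ((x :: s) :: ss)) =
    uniq (x :: y :: flatten ((r ++ s) :: ss)).
  apply: perm_uniq; rewrite /= -catA; exact/permPl/(perm_catCA (y :: r) [:: x]).
by rewrite /= inE negb_or -!andbA => /and4P[].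
Qed.

(** Same computation with [cyc_cut] read backwards: contracting the edge joins the ordinary vertex
    of [y] to the root vertex of [x]. *)
Lemma euler_merge (A : {set D}) x y p a s r ss : x \in A -> y \in A ->
  uniq (y :: r) -> uniq (flatten ((x :: s) :: ss)) ->
  {in y :: r, forall z, z \notin flatten ((x :: s) :: ss)} ->
  {in y :: r, forall z, p z = z} ->
  {in flatten ((x :: s) :: ss), forall z, p z = z} -> a x = x -> a y = y ->
  euler A (p * cyc (y :: r)) (a * tperm x y) ((x :: s) :: ss) =
  euler (A :\: [set x; y]) p a ((r ++ s) :: ss).
Proof.
move=> xA yA Ur Us dis pr pF ax ay.
have [xy xF yF U'] := uniq_merge Ur Us dis.
have px : p x = x by apply: pF; rewrite mem_head.
have py : p y = y by apply: pr; rewrite mem_head.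
have pF' : {in flatten ((r ++ s) :: ss), forall z, p z = z}.
  move=> z; rewrite /= -catA mem_cat => /orP[zr|zs]; first by rewrite pr // inE zr orbT.
  by rewrite pF //= inE zs orbT.
have pcF : {in flatten ((x :: s) :: ss), forall z, (p * cyc (y :: r)) z = z}.
  move=> z zF; rewrite permM pF // cyc_out //.
  by apply/negP => /dis; rewrite zF.
have := porbits_tot Us pcF; have := porbits_tot U' pF'; have := porbits_cyc Ur pr.
have ca : #|porbits (a * tperm x y)| + 1 = #|porbits a|.
  by have := porbits_tperm_fixed y ax; rewrite xy.
rewrite /euler /= tot_mul; last first.
  move=> z zss; rewrite cyc_out //; apply/negP => /dis; rewrite /= inE mem_cat zss.
  by rewrite !orbT.
set P := tot p ss.
move: xF yF; rewrite /= -catA !mem_cat !negb_or => /and3P[xr xs xss] /and3P[yr ys yss].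
have Px : P x = x by apply: tot_out.
have Py : P y = y by apply: tot_out.
have Uc : uniq (x :: r ++ y :: s).
  rewrite cons_uniq mem_cat inE !negb_or xr xy xs uniq_catC cat_cons cons_uniq mem_cat.
  rewrite !negb_or ys yr uniq_catC /=.
  by move: U'; rewrite /= cat_uniq => /and3P[].
have T : P * cyc (y :: r) * cyc (x :: s) =
    tperm x y * (P * cyc (r ++ s)) * tperm y (head y (s ++ r)) * tperm x (head x (r ++ y :: s)).
  rewrite -mulgA -cyc_cut // mulgA -(tperm_commute Px Py) -!mulgA; congr (_ * (_ * _)).
  rewrite [cyc (x :: _)]/(cyc _ * _) cyc_ins; last by case/andP: Uc.
  by rewrite mulgA.
have z1x : head y (s ++ r) != x.
  case E: (s ++ r) => [|b t] /=; first by rewrite eq_sym.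
  have : b \in s ++ r by rewrite E mem_head.
  by apply: contraTneq => ->; rewrite mem_cat negb_or xs xr.
have Qx : (P * cyc (r ++ s)) x = x by rewrite permM Px cyc_out // mem_cat negb_or xs xr.
have Qy : (P * cyc (r ++ s)) y = y by rewrite permM Py cyc_out // mem_cat negb_or ys yr.
have := faces_step (head x (r ++ y :: s)) xy z1x Qx Qy ax ay; rewrite -T.
have hy : (head y (s ++ r) != y) = ~~ nilp (r ++ s).
  rewrite /nilp size_cat addnC -size_cat -/(nilp _).
  case E: (s ++ r) => [|b t] /=; first by rewrite eqxx.
  have : b \in s ++ r by rewrite E mem_head.
  by apply: contraTneq => ->; rewrite mem_cat negb_or ys yr.
have hx : (head x (r ++ y :: s) != x) = true.
  case: (r) xr => [|b t] /=; first by rewrite eq_sym.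
  by rewrite inE negb_or eq_sym => /andP[].
rewrite hy hx card_setC_D2 // !size_cat /= ?size_cat /= /nn /=.
move=> h2 h3 h4 h5; have := euler_merge_arith _ _ ca h2 h3 h4 h5; apply.
Qed.

End TotalPerm.

(** * Orbits as lists *)

Section OrbitLemmas.

Variable D : finType.
Implicit Types (x y z : D) (s r : seq D) (f g : D -> D) (p q : {perm D}).

Lemma orbit_cycle_head f x s : fcycle f (x :: s) -> uniq (x :: s) -> orbit f x = x :: s.
Proof.
by move=> fs us; rewrite (fingraph.orbitE fs us) ?mem_head //= eqxx rot0.
Qed.

Lemma eq_in_orbit f g z : injective f -> {in orbit f z, g =1 f} -> orbit g z = orbit f z.
Proof.
move=> finj fg; have := cycle_orbit finj z; have := orbit_uniq f z.
case E: (orbit f z) => [|w s] us fs; first by have := in_orbit f z; rewrite E.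
have wz : w = z by move: E; rewrite /orbit -orderSpred /= => -[].
rewrite -wz; apply: orbit_cycle_head; rewrite // -E.
rewrite (@eq_in_cycle _ (mem (orbit f z)) (frel g) (frel f)) ?E //; last exact/allP.
by move=> u v uz _ /=; rewrite fg // E.
Qed.

Lemma orbitP_head f x : orbit f x = x :: behead (orbit f x).
Proof. by rewrite /orbit -orderSpred. Qed.

Lemma stable_cycle p (B : {set D}) s z w :
  stable p B -> fcycle p s -> z \in s -> w \in s -> z \in B -> w \in B.
Proof.
move=> sB fs zs ws; have : fconnect p z w by rewrite (fconnect_cycle fs zs).
case/connectP => t pt ->{w ws}; elim: t z {zs} pt => //= v t IHt z /andP[/eqP <- pt] zB.
by apply: IHt => //; apply: sB.
Qed.

Lemma fixed_orbit p x z : p x = x -> x \in orbit p z -> z = x.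
Proof.
move=> px; rewrite -fconnect_orbit fconnect_sym; last exact: perm_inj.
case/connectP => t; elim: t x px => [|w t IHt] x px //= /andP[/eqP <-]; rewrite px.
by move=> /IHt; apply.
Qed.

Lemma mulT_out x y p z : p x = x -> p y = y -> z != x -> z != y ->
  (p * tperm x y)%g z = p z.
Proof.
move=> px py zx zy; rewrite permM tpermD //.
  by apply: contraNneq zx => e; apply/eqP/(@perm_inj _ p); rewrite -e px.
by apply: contraNneq zy => e; apply/eqP/(@perm_inj _ p); rewrite -e py.
Qed.

Lemma mul_cyc_out p s z : {in s, forall w, p w = w} -> z \notin s -> (p * cyc s)%g z = p z.
Proof.
move=> ps zs; rewrite permM cyc_out //.
by apply: contraNN zs => pzs; rewrite -(perm_inj (ps _ pzs)).
Qed.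

Lemma fcycle_mul_cyc p s : uniq s -> {in s, forall z, p z = z} -> fcycle (p * cyc s)%g s.
Proof.
move=> us ps; rewrite (@eq_in_cycle _ (mem s) (frel _) (frel (cyc s))).
- exact: fcycle_cyc.
- by move=> z w zs _ /=; rewrite permM ps.
- exact/allP.
Qed.

Lemma orbit_mul_cyc p y s : uniq (y :: s) -> {in y :: s, forall z, p z = z} ->
  orbit (p * cyc (y :: s))%g y = y :: s.
Proof. by move=> us ps; apply: orbit_cycle_head => //; apply: fcycle_mul_cyc. Qed.

End OrbitLemmas.

(** * Peeling rooted planar maps *)

Section Model.

Variables (D : finType) (L : eqType) (bar : L -> L) (V : pred (seq L)) (c0 : L).
Hypothesis barK : involutive bar.
Hypothesis V_rot : forall n w, V (rot n w) = V w.

Implicit Types (A : {set D}) (x y z : D) (s r : seq D) (ss : seq (seq D)).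
Implicit Types (p a : {perm D}) (lab : {ffun D -> L}) (u v : seq L) (us : seq (seq L)).

Local Open Scope group_scope.

Definition relab lab x c y d : {ffun D -> L} :=
  [ffun z => if z == x then c else if z == y then d else lab z].

(* [p] is the rotation at the ordinary vertices of a planar map with half-edges
   [A], [a] exchanges the two halves of each edge, and the half-edges carry
   labels whose cyclic words at ordinary vertices satisfy [V].  The root vertices
   are listed, from their root corners, in [ss]; [p] fixes their half-edges.
   [v_reach] says that every component has a root vertex, and [v_euler] that
   every component is a sphere. *)
Record valid A us p a lab ss : Prop := ValidMap {
  v_uniq : uniq (flatten ss);
  v_sub : {subset flatten ss <= A};
  v_fix : forall z, z \notin A -> p z = z;
  v_fixr : {in flatten ss, forall z, p z = z};
  v_out : forall z, z \notin A -> a z = z;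
  v_neq : forall z, z \in A -> a z != z;
  v_inv : involutive a;
  v_lab0 : forall z, z \notin A -> lab z = c0;
  v_lab : forall z, z \in A -> lab (a z) = bar (lab z);
  v_us : map (map lab) ss = us;
  v_vert : forall z, z \in A -> z \notin flatten ss -> V (map lab (orbit p z));
  v_reach : forall B : {set D}, B \subset A -> stable p B -> stable a B ->
    {in flatten ss, forall z, z \notin B} -> B = set0;
  v_euler : euler A p a ss
}.

Lemma map_relab lab x c y d s : x \notin s -> y \notin s ->
  map (relab lab x c y d) s = map lab s.
Proof.
move=> xs ys; apply/eq_in_map => z zs; rewrite ffunE.
by case: eqP => [e|_]; [rewrite -e zs in xs|case: eqP => [e|//]; rewrite -e zs in ys].
Qed.

Lemma map_map_relab lab x c y d ss : x \notin flatten ss -> y \notin flatten ss ->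
  map (map (relab lab x c y d)) ss = map (map lab) ss.
Proof.
elim: ss => //= s ss IHs; rewrite !mem_cat !negb_or => /andP[xs xss] /andP[ys yss].
by rewrite map_relab // IHs.
Qed.

Section Edge.

Variables (A : {set D}) (x y : D) (a : {perm D}) (lab : {ffun D -> L}) (c : L).
Hypotheses (xA : x \in A) (yA : y \in A) (xy : x != y) (ax : a x = x) (ay : a y = y).
Hypotheses (labx : lab x = c0) (laby : lab y = c0).

Let A' := A :\: [set x; y].
Let a' := a * tperm x y.
Let lab' := relab lab x c y (bar c).

Lemma inA' z : (z \in A') = [&& z != x, z != y & z \in A].
Proof. by rewrite !inE negb_or andbA. Qed.

(** This and the next lemmas transfer, by equivalences, the fields of [valid] about edges and
    labels, so that adding and removing the edge need no separate arguments. *)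
Lemma edge_out : (forall z, z \notin A' -> a z = z) <-> (forall z, z \notin A -> a' z = z).
Proof.
split=> h z zA.
  rewrite mulT_out //; try by apply: contraNneq zA => ->.
  by apply: h; rewrite inA' (negPf zA) !andbF.
move: zA; rewrite inA' !negb_and !negbK => /or3P[/eqP->|/eqP->|zA] //.
by rewrite -{2}(h z zA) mulT_out //; apply: contraNneq zA => ->.
Qed.

Lemma edge_neq : (forall z, z \in A' -> a z != z) <-> (forall z, z \in A -> a' z != z).
Proof.
split=> h z zA.
  have [->|zx] := eqVneq z x; first by rewrite permM ax tpermL eq_sym.
  have [->|zy] := eqVneq z y; first by rewrite permM ay tpermR.
  by rewrite mulT_out // h // inA' zx zy.
move: zA; rewrite inA' => /and3P[zx zy /h].
by rewrite mulT_out.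
Qed.

Lemma edge_inv : involutive a <-> involutive a'.
Proof.
have cm : commute (tperm x y) a by apply: tperm_commute.
split=> h z.
  by rewrite -permM /a' mulgA -[a * _ * a]mulgA cm mulgA -mulgA tperm2 mulg1 permM h.
have -> : a = a' * tperm x y by rewrite -mulgA tperm2 mulg1.
have cm' : commute (tperm x y) a' by rewrite /commute /a' mulgA cm.
by rewrite -permM mulgA -[a' * _ * a']mulgA cm' mulgA -mulgA tperm2 mulg1 permM h.
Qed.

Lemma edge_lab0 : (forall z, z \notin A' -> lab z = c0) <-> (forall z, z \notin A -> lab' z = c0).
Proof.
split=> h z zA.
  rewrite ffunE; case: eqP => [e|_]; first by rewrite e xA in zA.
  case: eqP => [e|_]; first by rewrite e yA in zA.
  by apply: h; rewrite inA' (negPf zA) !andbF.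
move: zA; rewrite inA' !negb_and !negbK => /or3P[/eqP->|/eqP->|zA] //.
have := h z zA; rewrite ffunE.
by case: eqP => [->|_]; [rewrite labx|case: eqP => [->|]].
Qed.

Lemma edge_az z : z != x -> z != y -> (a z != x) /\ (a z != y).
Proof.
move=> zx zy; split.
  by apply: contraNneq zx => e; apply/eqP/(@perm_inj _ a); rewrite e ax.
by apply: contraNneq zy => e; apply/eqP/(@perm_inj _ a); rewrite e ay.
Qed.

Lemma edge_lab : (forall z, z \in A' -> lab (a z) = bar (lab z)) <->
  (forall z, z \in A -> lab' (a' z) = bar (lab' z)).
Proof.
split=> h z zA.
  have [->|zx] := eqVneq z x.
    by rewrite permM ax tpermL !ffunE eqxx eq_sym (negPf xy) eqxx.
  have [->|zy] := eqVneq z y.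
    by rewrite permM ay tpermR !ffunE eqxx eq_sym (negPf xy) eqxx barK.
  have [azx azy] := edge_az zx zy.
  by rewrite mulT_out // !ffunE (negPf zx) (negPf zy) (negPf azx) (negPf azy) h // inA' zx zy.
move: zA; rewrite inA' => /and3P[zx zy /h].
have [azx azy] := edge_az zx zy.
by rewrite mulT_out // !ffunE (negPf zx) (negPf zy) (negPf azx) (negPf azy).
Qed.

Lemma edge_stable (B : {set D}) : x \notin B -> y \notin B -> stable a B <-> stable a' B.
Proof.
move=> xB yB; split=> h z zB; have := h z zB; rewrite mulT_out //.
all: by apply: contraTneq zB => ->.
Qed.

Lemma valid_split p s1 s2 ss u1 u2 us : size u1 = size s1 ->
  valid A' [:: u1, u2 & us] p a lab [:: s1, s2 & ss] <->
  valid A ((c :: u1 ++ bar c :: u2) :: us) p a' lab' ((x :: s1 ++ y :: s2) :: ss).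
Proof.
move=> su.
pose F := flatten [:: s1, s2 & ss]; pose F' := flatten ((x :: s1 ++ y :: s2) :: ss).
have FE z : (z \in F') = [|| z == x, z == y | z \in F].
  by rewrite /F' /F /= !(inE, mem_cat); do ?case: (_ \in _); do ?case: (_ == _).
split=> [] [H1 H2 H3 H4 H5 H6 H7 H8 H9 H10 H11 H12 H13].
  have xF : x \notin F by apply: contraNN (_ : x \notin A') => [/H2//|]; rewrite inA' eqxx.
  have yF : y \notin F by apply: contraNN (_ : y \notin A') => [/H2//|]; rewrite inA' eqxx andbF.
  have px : p x = x by apply: H3; rewrite inA' eqxx.
  have py : p y = y by apply: H3; rewrite inA' eqxx andbF.
  have U : uniq F' by rewrite /F' uniq_insert2 xy xF yF.
  split=> //.
  - by move=> z; rewrite -/F' FE => /or3P[/eqP->|/eqP->|/H2] //; rewrite inA' => /and3P[].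
  - by move=> z zA; apply: H3; rewrite inA' (negPf zA) !andbF.
  - by move=> z; rewrite -/F' FE => /or3P[/eqP->|/eqP->|/H4].
  - exact/edge_out.
  - exact/edge_neq.
  - exact/edge_inv.
  - exact/edge_lab0.
  - exact/edge_lab.
  - move: xF yF; rewrite /F /= !mem_cat !negb_or => /and3P[? ? ?] /and3P[? ? ?].
    case: H10 => <- <- <-; rewrite map_cat /= !map_relab // map_map_relab // !ffunE !eqxx.
    by rewrite eq_sym (negPf xy).
  - move=> z zA; rewrite -/F' FE !negb_or => /and3P[zx zy zF].
    rewrite map_relab ?H11 ?inA' ?zx ?zy //.
      by apply: contraNN zx => /(fixed_orbit px) ->.
    by apply: contraNN zy => /(fixed_orbit py) ->.
  - move=> B BA pB aB FB; have xB : x \notin B by apply: FB; rewrite -/F' FE eqxx.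
    have yB : y \notin B by apply: FB; rewrite -/F' FE eqxx orbT.
    apply: H12 => //; last by move=> z zF; apply: FB; rewrite -/F' FE zF !orbT.
      by apply/subsetP => z zB; rewrite inA' (subsetP BA) // andbT; apply/andP; split; apply: contraTneq zB => ->.
    exact/edge_stable.
  - rewrite euler_split //.
    by move=> z; rewrite -/F' FE => /or3P[/eqP->|/eqP->|/H4].
have := H1; rewrite uniq_insert2 => /and4P[_ xF yF U].
have px : p x = x by apply: H4; rewrite -/F' FE eqxx.
have py : p y = y by apply: H4; rewrite -/F' FE eqxx orbT.
split=> //.
- move=> z zF; rewrite inA' H2; last by rewrite -/F' FE zF !orbT.
  by rewrite andbT; apply/andP; split; apply: contraTneq zF => ->.
- by move=> z; rewrite inA' !negb_and !negbK => /or3P[/eqP->|/eqP->|/H3].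
- by move=> z zF; apply: H4; rewrite -/F' FE zF !orbT.
- exact/edge_out.
- exact/edge_neq.
- exact/edge_inv.
- exact/edge_lab0.
- exact/edge_lab.
- move: xF yF; rewrite /F /= !mem_cat !negb_or => /and3P[? ? ?] /and3P[? ? ?].
  move: H10; rewrite /= map_cat /= !map_relab // map_map_relab // => -[_ /eqP].
  by rewrite eqseq_cat ?size_map // => /andP[/eqP-> /eqP[_ ->]] ->.
- move=> z; rewrite inA' => /and3P[zx zy zA] zF; have := H11 z zA.
  rewrite -/F' FE (negPf zx) (negPf zy) zF => /(_ isT); rewrite map_relab //.
    by apply: contraNN zx => /(fixed_orbit px) ->.
  by apply: contraNN zy => /(fixed_orbit py) ->.
- move=> B BA pB aB FB.
  have xB : x \notin B by apply/negP => /(subsetP BA); rewrite inA' eqxx.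
  have yB : y \notin B by apply/negP => /(subsetP BA); rewrite inA' eqxx andbF.
  apply: H12 => //; first exact: subset_trans BA (subsetDl _ _).
    exact/edge_stable.
  by move=> z; rewrite -/F' FE => /or3P[/eqP->|/eqP->|/FB].
- by move: H13; rewrite euler_split.
Qed.

(** The ordinary vertex of [y], read from [y], is [y :: r], and [V (bar c :: v)] is its vertex
    condition; invariance of [V] under rotation lets it be tested at any of its half-edges. A stable
    set that avoids the root vertex also avoids this one, since [y] is matched with [x]. *)
Lemma valid_merge p r s ss v u us : size v = size r ->
  [/\ valid A' ((v ++ u) :: us) p a lab ((r ++ s) :: ss) & V (bar c :: v)] <->
  [/\ valid A ((c :: u) :: us) (p * cyc (y :: r)) a' lab' ((x :: s) :: ss),
      uniq (y :: r), {in y :: r, forall z, z \in A /\ z \notin flatten ((x :: s) :: ss)},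
      {in y :: r, forall z, p z = z} & v = map lab r].
Proof.
move=> sv; set q := p * cyc (y :: r).
pose F := flatten ((r ++ s) :: ss); pose F' := flatten ((x :: s) :: ss).
have FE z : (z \in F) = (z \in r) || (z \in behead F') by rewrite /F /= -catA mem_cat.
have F'E z : (z \in F') = (z == x) || (z \in behead F') by rewrite /F' /= inE.
have rE z : (z \in y :: r) = (z == y) || (z \in r) by rewrite inE.
have qout z : {in y :: r, forall z, p z = z} -> z \notin y :: r -> q z = p z.
  by move=> pr; apply: mul_cyc_out.
have fq : uniq (y :: r) -> {in y :: r, forall z, p z = z} -> fcycle q (y :: r).
  exact: fcycle_mul_cyc.
have orb z : {in y :: r, forall z, p z = z} -> z \notin y :: r -> orbit q z = orbit p z.
  move=> pr zr; apply: eq_in_orbit; first exact: perm_inj.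
  move=> w wz; apply: qout => //; apply: contraNN zr => wr.
  by rewrite (fixed_orbit (pr _ wr) wz).
split.
  case=> -[H1 H2 H3 H4 H5 H6 H7 H8 H9 H10 H11 H12 H13] HV.
  have xF : x \notin F by apply: contraNN (_ : x \notin A') => [/H2//|]; rewrite inA' eqxx.
  have yF : y \notin F by apply: contraNN (_ : y \notin A') => [/H2//|]; rewrite inA' eqxx andbF.
  have px : p x = x by apply: H3; rewrite inA' eqxx.
  have py : p y = y by apply: H3; rewrite inA' eqxx andbF.
  have rA z : z \in y :: r -> z \in A.
    rewrite inE => /orP[/eqP->//|zr]; have : z \in A' by apply: H2; rewrite -/F FE zr.
    by rewrite inA' => /and3P[].
  have Ur : uniq (y :: r).
    move: H1 yF; rewrite /F /= -catA cat_uniq mem_cat negb_or => /andP[-> _] /andP[-> _] //.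
  have pr : {in y :: r, forall z, p z = z}.
    by move=> z; rewrite inE => /orP[/eqP->//|zr]; apply: H4; rewrite -/F FE zr.
  have dis : {in y :: r, forall z, z \notin F'}.
    move=> z; rewrite inE F'E => /orP[/eqP->|zr].
      by rewrite eq_sym (negPf xy) /=; apply: contraNN yF; rewrite FE => ->; rewrite orbT.
    apply/norP; split; first by apply: contraNneq xF => <-; rewrite FE zr.
    move: H1; rewrite /F /= -catA cat_uniq => /and3P[_ /hasPn h _].
    by apply/negP => /h; rewrite /= zr.
  have U : uniq F'.
    move: H1 xF; rewrite FE negb_or /F /F' /= -catA cat_uniq => /and3P[_ _ ->] /andP[_ ->].
    by [].
  have F'r z : z \in F' -> z \notin y :: r by move=> zF; apply/negP => /dis; rewrite zF.
  case: H10 => mv mus; have vr : v = map lab r.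
    by apply/eqP; move/eqP: mv; rewrite map_cat eqseq_cat ?size_map // eq_sym => /andP[].
  have xr : x \notin y :: r by apply: F'r; rewrite F'E eqxx.
  split=> //; last by move=> z zr; split; [exact: rA|exact: dis].
  split=> //.
  - move=> z; rewrite -/F' F'E => /orP[/eqP->//|zF].
    have : z \in A' by apply: H2; rewrite -/F FE zF orbT.
    by rewrite inA' => /and3P[].
  - move=> z zA; rewrite qout //; last by apply: contraNN zA => /rA.
    by apply: H3; rewrite inA' (negPf zA) !andbF.
  - move=> z zF; rewrite qout ?F'r //; move: zF; rewrite -/F' F'E => /orP[/eqP->//|zF].
    by apply: H4; rewrite -/F FE zF orbT.
  - exact/edge_out.
  - exact/edge_neq.
  - exact/edge_inv.
  - exact/edge_lab0.
  - exact/edge_lab.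
  - move: xF yF; rewrite !FE !negb_or /= !mem_cat !negb_or => /and3P[? ? ?] /and3P[? ? ?].
    rewrite /= !ffunE eqxx map_relab // map_map_relab // mus; congr ((_ :: _) :: _).
    by apply/eqP; move/eqP: mv; rewrite map_cat eqseq_cat ?size_map // => /andP[].
  - move=> z zA zF; have [zr|zr] := boolP (z \in y :: r).
      have [i ->] := orbit_rot_cycle (fq Ur pr) Ur zr.
      rewrite map_rot V_rot /= ffunE eq_sym (negPf xy) eqxx map_relab -?vr //.
        by move: xr; rewrite inE negb_or => /andP[].
      by case/andP: Ur.
    have zx : z != x by apply: contraNneq zF => ->; rewrite -/F' F'E eqxx.
    have zy : z != y by apply: contraNneq zr => ->; rewrite mem_head.
    rewrite orb // map_relab ?H11 //.
    + by rewrite inA' zx zy.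
    + move: zF zr; rewrite -/F -/F' FE F'E rE !negb_or => /andP[_ ->] /andP[_ ->] //.
    + by apply: contraNN zx => /(fixed_orbit px) ->.
    + by apply: contraNN zy => /(fixed_orbit py) ->.
  - move=> B BA qB aB FB; have xB : x \notin B by apply: FB; rewrite -/F' F'E eqxx.
    have yB : y \notin B.
      by apply: contraNN xB => /aB; rewrite permM ay tpermR.
    have rB : {in y :: r, forall z, z \notin B}.
      move=> z zr; apply: contraNN yB => zB.
      by apply: (stable_cycle qB (fq Ur pr) zr _ zB); rewrite mem_head.
    apply: H12.
    + by apply/subsetP => z zB; rewrite inA' (subsetP BA) // andbT; apply/andP; split; apply: contraTneq zB => ->.
    + by move=> z zB; rewrite -qout ?qB //; apply: contraTN zB; exact: rB.
    + exact/edge_stable.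
    + move=> z; rewrite -/F FE => /orP[zr|zF]; first by apply: rB; rewrite rE zr orbT.
      by apply: FB; rewrite -/F' F'E zF orbT.
  - rewrite euler_merge // => z; rewrite -/F' F'E => /orP[/eqP->//|zF].
    by apply: H4; rewrite -/F FE zF orbT.
case=> -[H1 H2 H3 H4 H5 H6 H7 H8 H9 H10 H11 H12 H13] Ur rAF pr vr.
have dis : {in y :: r, forall z, z \notin F'} by move=> z /rAF[].
have rA : {in y :: r, forall z, z \in A} by move=> z /rAF[].
have F'r z : z \in F' -> z \notin y :: r by move=> zF; apply/negP => /dis; rewrite zF.
have [_ xF yF U] := uniq_merge Ur H1 dis.
have xr : x \notin y :: r by apply: F'r; rewrite F'E eqxx.
have px : p x = x by rewrite -(qout _ pr xr) H4 // -/F' F'E eqxx.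
have py : p y = y by apply: pr; rewrite mem_head.
have xr' : x \notin r by move: xr; rewrite rE negb_or => /andP[].
have yr' : y \notin r by case/andP: Ur.
split; last first.
  have := H11 y yA (dis y (mem_head _ _)); rewrite (orbit_cycle_head (fq Ur pr) Ur) /=.
  by rewrite ffunE eq_sym (negPf xy) eqxx map_relab // vr.
split=> //.
- move=> z zF; rewrite inA'; apply/and3P; split.
  + by apply: contraTneq zF => ->.
  + by apply: contraTneq zF => ->.
  + move: zF; rewrite -/F FE => /orP[zr|zF]; first by apply: rA; rewrite rE zr orbT.
    by apply: H2; rewrite -/F' F'E zF orbT.
- move=> z; rewrite inA' !negb_and !negbK => /or3P[/eqP->//|/eqP->//|zA].
  by rewrite -{2}(H3 z zA) qout //; apply: contraNN zA => /rA.
- move=> z; rewrite -/F FE => /orP[zr|zF]; first by rewrite pr // rE zr orbT.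
  have zF' : z \in F' by rewrite F'E zF orbT.
  by rewrite -{2}(H4 z zF') qout // F'r.
- exact/edge_out.
- exact/edge_neq.
- exact/edge_inv.
- exact/edge_lab0.
- exact/edge_lab.
- move: xF yF; rewrite /= !mem_cat !negb_or => /andP[/andP[? ?] ?] /andP[/andP[? ?] ?].
  by move: H10; rewrite /= map_cat !map_relab // map_map_relab // vr => -[_ -> ->].
- move=> z; rewrite inA' => /and3P[zx zy zA]; rewrite -/F FE negb_or => /andP[zr zF].
  have zr' : z \notin y :: r by rewrite rE negb_or zy.
  have := H11 z zA; rewrite -/F' F'E (negPf zx) (negPf zF) => /(_ isT).
  rewrite orb // map_relab //.
    by apply: contraNN zx => /(fixed_orbit px) ->.
  by apply: contraNN zy => /(fixed_orbit py) ->.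
- move=> B BA pB aB FB.
  have xB : x \notin B by apply/negP => /(subsetP BA); rewrite inA' eqxx.
  have yB : y \notin B by apply/negP => /(subsetP BA); rewrite inA' eqxx andbF.
  apply: H12 => //; first exact: subset_trans BA (subsetDl _ _).
  + move=> z zB; rewrite qout ?pB //; apply: contraTN zB.
    by rewrite rE => /orP[/eqP->//|zr]; apply: FB; rewrite -/F FE zr.
  + exact/edge_stable.
  + move=> z; rewrite -/F' F'E => /orP[/eqP->//|zF].
    by apply: FB; rewrite -/F FE zF orbT.
- move: H13; rewrite euler_merge // => z zF.
  by rewrite -{2}(H4 z zF) qout // F'r.
Qed.

End Edge.
End Model.

(** * Counting by explicit enumerations *)

Section Enumerated.

(** Validity of a state is a proposition rather than a boolean, so cardinals are replaced by sizes
    of duplicate-free lists; [enumerated_inj] makes them well defined. *)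
Definition enumerated (T : eqType) (P : T -> Prop) (k : nat) :=
  exists l : seq T, [/\ uniq l, forall t, t \in l <-> P t & size l = k].

Lemma enumerated_inj (T : eqType) (P : T -> Prop) k k' :
  enumerated P k -> enumerated P k' -> k = k'.
Proof.
move=> [l [ul lP <-]] [l' [ul' lP' <-]]; apply/perm_size/uniq_perm => // t.
by apply/idP/idP => [/lP/lP'|/lP'/lP].
Qed.

Lemma enumerated_ext (T : eqType) (P Q : T -> Prop) k :
  (forall t, P t <-> Q t) -> enumerated P k -> enumerated Q k.
Proof. by move=> PQ [l [ul lP sl]]; exists l; split=> // t; rewrite -PQ. Qed.

Lemma enumerated_bij (T T' : eqType) (P : T -> Prop) (Q : T' -> Prop) (f : T -> T') g k :
  (forall t, P t -> Q (f t)) -> (forall t, Q t -> P (g t)) ->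
  (forall t, P t -> g (f t) = t) -> (forall t, Q t -> f (g t) = t) ->
  enumerated P k -> enumerated Q k.
Proof.
move=> fQ gP fK gK [l [ul lP sl]]; exists (map f l); split.
- rewrite map_inj_in_uniq // => t t' /lP Pt /lP Pt' e.
  by rewrite -(fK _ Pt) e fK.
- move=> t; split=> [/mapP[t' /lP Pt' ->]|Qt]; first exact: fQ.
  by apply/mapP; exists (g t); rewrite ?gK //; apply/lP/gP.
- by rewrite size_map.
Qed.

Lemma enumerated_empty (T : eqType) (P : T -> Prop) :
  (forall t, ~ P t) -> enumerated P 0.
Proof. by move=> nP; exists [::]; split=> // t; split=> // /nP. Qed.

Lemma enumerated_sum (T I : eqType) (idx : T -> I) (J : seq I) (k : I -> nat) (P : T -> Prop) :
  uniq J -> (forall t, P t -> idx t \in J) ->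
  (forall i, i \in J -> enumerated (fun t => P t /\ idx t = i) (k i)) ->
  enumerated P (\sum_(i <- J) k i).
Proof.
elim: J P => [|i J IHJ] P /=; first by rewrite big_nil => _ h _; apply: enumerated_empty => t /h.
move=> /andP[iJ uJ] PJ Pk; rewrite big_cons.
have [t [Pt ti]|j jJ|l' [ul' lP' sl']] := IHJ (fun t => P t /\ idx t != i) uJ.
- by have := PJ t Pt; rewrite inE (negPf ti).
- apply: enumerated_ext (Pk j _); last by rewrite inE jJ orbT.
  move=> t /=; split=> [[Pt tj]|[[Pt _] tj]]; split=> //; split=> //.
  by apply: contraNneq iJ => <-; rewrite tj.
- have [l [ul lP sl]] := Pk i (mem_head _ _).
  exists (l ++ l'); split; last by rewrite size_cat sl sl'.
    rewrite cat_uniq ul ul' andbT; apply/hasPn => t /lP' [_ ti].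
    by apply/negP => /lP [_ /eqP]; rewrite (negPf ti).
  move=> t; rewrite mem_cat; split.
    by move=> /orP[/lP[]|/lP'[]].
  move=> Pt; have [ti|ti] := eqVneq (idx t) i.
    by apply/orP; left; apply/lP.
  by apply/orP; right; apply/lP'.
Qed.

End Enumerated.

Section Splits.

Variables (L : eqType).
Implicit Types (u v : seq L) (d : L).

Fixpoint wsplits d u : seq (seq L * seq L) :=
  if u is b :: u' then
    (if b == d then [:: ([::], u')] else [::]) ++ [seq (b :: w.1, w.2) | w <- wsplits d u']
  else [::].

Lemma wsplitsP d u w : reflect (u = w.1 ++ d :: w.2) (w \in wsplits d u).
Proof.
elim: u w => [|b u IHu] [w1 w2] /=; first by right; case: w1.
rewrite mem_cat; apply: (iffP orP) => [[]|].
- by case: eqP => [->|//]; rewrite inE => /eqP[-> ->].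
- by case/mapP => -[v1 v2] /IHu /= -> [-> ->].
- case: w1 => [|b' w1] /= [-> uE]; first by rewrite eqxx uE mem_head; left.
  by right; apply/mapP; exists (w1, w2) => //; apply/IHu.
Qed.

Lemma wsplits_uniq d u : uniq (wsplits d u).
Proof.
elim: u => //= b u IHu; rewrite cat_uniq map_inj_in_uniq ?IHu; last first.
  by move=> [? ?] [? ?] _ _ /= [-> ->].
by rewrite andbT; case: ifP => _ /=; apply/hasPn => _ /mapP[[? ?] _ ->].
Qed.

End Splits.

(** * The peeling recursion counts maps *)

Section Count.

Variables (D : finType) (L : eqType) (bar : L -> L) (V : pred (seq L)) (c0 : L).
(** [vs n c] lists words that complete [bar c] to an ordinary vertex. Length at most 2n is enough: n
    edges remain after the removal of the root edge. *)
Variable vs : nat -> L -> seq (seq L).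
Hypothesis barK : involutive bar.
Hypothesis V_rot : forall n w, V (rot n w) = V w.
Hypothesis vs_uniq : forall n c, uniq (vs n c).
Hypothesis vs_V : forall n c v, v \in vs n c -> V (bar c :: v).
Hypothesis V_vs : forall n c v, size v <= n.*2 -> V (bar c :: v) -> v \in vs n c.

Implicit Types (A : {set D}) (x y z : D) (s r : seq D) (ss : seq (seq D)).
Implicit Types (p a : {perm D}) (lab : {ffun D -> L}) (u v : seq L) (us : seq (seq L)).

(* Deleting the first half-edge of the first root vertex and its other half [e]:
   if [e] belongs to the root vertex, planarity splits the map in two; otherwise
   the ordinary vertex of [e] is merged into the root vertex. *)
Fixpoint peelsum (f : seq (seq L) -> nat) n us :=
  match us with
  | [::] => 0
  | [::] :: us' => peelsum f n us'
  | (c :: u) :: us' =>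
      \sum_(w <- wsplits (bar c) u) f [:: w.1, w.2 & us']
      + \sum_(v <- vs n c) f ((v ++ u) :: us')
  end.

(* Number of unlabelled maps with [N] edges and root vertices labelled [us]. *)
Fixpoint M N : seq (seq L) -> nat :=
  if N is n.+1 then peelsum (M n) n else fun us => all (@nilp _) us.

Definition state : eqType := ({perm D} * {perm D} * {ffun D -> L} * seq (seq D))%type.

Definition valid_state A us (st : state) :=
  let: (p, a, lab, ss) := st in @valid D L bar V c0 A us p a lab ss.

Lemma valid_nil A us p a lab ss :
  valid bar V c0 A us p a lab ss <-> valid bar V c0 A ([::] :: us) p a lab ([::] :: ss).
Proof.
have E : euler A p a ([::] :: ss) = euler A p a ss by rewrite /euler /= mulg1.
split=> -[H1 H2 H3 H4 H5 H6 H7 H8 H9 H10 H11 H12 H13]; split; rewrite ?E //.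
- by rewrite /= H10.
- by case: H10.
- by rewrite -E.
Qed.

Lemma fcycle_tot p ss t : uniq (flatten ss) -> {in flatten ss, forall z, p z = z} ->
  t \in ss -> fcycle (tot p ss) t.
Proof.
elim: ss => //= s ss IHs; rewrite cat_uniq => /and3P[us /hasPn dis uss] pss.
have pss' : {in flatten ss, forall z, p z = z} by move=> z zs; apply: pss; rewrite mem_cat zs orbT.
rewrite inE => /orP[/eqP->|tss].
  rewrite (@eq_in_cycle _ (mem s) (frel _) (frel (cyc s))); [exact: fcycle_cyc| |exact/allP].
  move=> z w zs _ /=; rewrite permM tot_out ?pss ?mem_cat ?zs //.
  by apply/negP => /dis; rewrite /= zs.
rewrite (@eq_in_cycle _ (mem t) (frel _) (frel (tot p ss))); [exact: IHs| |exact/allP].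
move=> z w zt _ /=; rewrite permM cyc_out //.
apply/negP => zs; have : tot p ss z \in flatten ss.
  apply/flattenP; exists t => //; have /eqP -> := next_cycle (IHs uss pss' tss) zt.
  by rewrite mem_next.
by move=> /dis; rewrite /= zs.
Qed.

Lemma valid_alone A us p a lab x s ss :
  valid bar V c0 A us p a lab ((x :: s) :: ss) -> a x \notin flatten ss.
Proof.
move=> H; apply/negP => axs; have [U sub _ fixr _ _ _ _ _ _ _ reach /eqP eul] := H.
pose hs := [seq head x t | t <- ss & ~~ nilp t].
pose R := ~: A :|: [set z in hs].
have cR : #|R| <= #|~: A| + nn ss.
  apply: leq_trans (leq_card_setU _ _) _; rewrite leq_add2l cardsE.
  by apply: leq_trans (card_size _) _; rewrite size_map size_filter.
have fc t : t \in (x :: s) :: ss -> fcycle (tot p ((x :: s) :: ss)) t by apply: fcycle_tot.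
have := euler_ineq (p := tot p ((x :: s) :: ss)) (q := a) (R := R).
rewrite eul /nn /=; move=> h; have {h} : _ := h _.
suff hit : forall B : {set D}, stable (tot p ((x :: s) :: ss)) B -> stable a B ->
    [disjoint R & B] -> B = set0.
  move=> /(_ hit); move: cR; rewrite /nn; move: #|R| #|D| #|~: A| (count _ ss) => *; lia.
move=> B tB aB; rewrite -setI_eq0 setIUl setU_eq0 => /andP[/eqP AB /eqP hB].
have BA : B \subset A by rewrite -[A]setCK -disjoints_subset -setI_eq0 setIC AB.
have ssB : {in flatten ss, forall z, z \notin B}.
  move=> z /flattenP[t tss zt]; apply/negP => zB.
  have : head x t \in B.
    apply: (stable_cycle tB (fc t _) zt _ zB); first by rewrite inE tss orbT.
    by case: (t) zt => // b t' _; rewrite mem_head.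
  move=> htB; have : head x t \in [set z in hs] :&: B.
    rewrite !inE htB andbT; apply/mapP; exists t => //; rewrite mem_filter tss.
    by case: (t) zt.
  by rewrite hB inE.
have xsB : {in x :: s, forall z, z \notin B}.
  move=> z zs; apply/negP => zB; have /aB : x \in B.
    by apply: (stable_cycle tB (fc (x :: s) _) zs _ zB); rewrite mem_head.
  by move=> axB; have := ssB _ axs; rewrite axB.
have sB : {in flatten ((x :: s) :: ss), forall z, z \notin B}.
  by move=> z; rewrite /= -cat_cons mem_cat => /orP[/xsB|/ssB].
apply: reach => // z zB.
have zs : z \notin flatten ((x :: s) :: ss) by apply: contraTN zB; exact: sB.
rewrite -(tot_notin (ss := (x :: s) :: ss)) ?tB //.
by apply: contraNN zs => pzs; rewrite -(perm_inj (fixr _ pzs)).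
Qed.

Definition kind : eqType := (seq L * seq L + seq L)%type.

(** The data by which states are sorted: the two halves of the root edge, the case of the peeling,
    and the label words that it exposes. Once they are fixed, the smaller state determines the
    larger one. *)
Definition peel_idx (st : state) : option (D * D * kind) :=
  let: (p, a, lab, ss) := st in
  if ss is (x :: s) :: _ then
    let y := a x in
    Some (x, y,
      if y \in s then inl (map lab (take (index y s) s), map lab (drop (index y s).+1 s))
      else inr (map lab (behead (orbit p y))))
  else None.

Definition split_up c x y (st : state) : state :=
  let: (p, a, lab, ss) := st in
  (p, a * tperm x y, relab lab x c y (bar c),
   if ss is s1 :: s2 :: ss' then (x :: s1 ++ y :: s2) :: ss' else ss)%g.

Definition split_down x y (st : state) : state :=
  let: (p, a, lab, ss) := st in
  (p, a * tperm x y, relab lab x c0 y c0,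
   if ss is (_ :: s) :: ss' then [:: take (index y s) s, drop (index y s).+1 s & ss']
   else ss)%g.

Definition merge_up c x y n (st : state) : state :=
  let: (p, a, lab, ss) := st in
  (p * cyc (y :: take n (head [::] ss)), a * tperm x y, relab lab x c y (bar c),
   (x :: drop n (head [::] ss)) :: behead ss)%g.

Definition merge_down x y (st : state) : state :=
  let: (p, a, lab, ss) := st in
  (p * (cyc (orbit p y))^-1, a * tperm x y, relab lab x c0 y c0,
   (behead (orbit p y) ++ behead (head [::] ss)) :: behead ss)%g.

Lemma relabK lab x y c d c' d' : lab x = c' -> lab y = d' ->
  relab (relab lab x c y d) x c' y d' = lab.
Proof.
move=> lx ly; apply/ffunP => z; rewrite !ffunE.
by case: eqP => [->|_]; [rewrite lx | case: eqP => [->|]; rewrite ?ly].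
Qed.

Lemma mul_tpermK p x y : (p * tperm x y * tperm x y = p)%g.
Proof. by rewrite -mulgA tperm2 mulg1. Qed.

Section Pair.

Variables (A : {set D}) (x y : D) (c : L).
Hypotheses (xA : x \in A) (yA : y \in A) (xy : x != y).
Let A' := A :\: [set x; y].

Let xA' : x \notin A'. Proof. by rewrite !inE eqxx. Qed.
Let yA' : y \notin A'. Proof. by rewrite !inE eqxx orbT. Qed.

Lemma enum_split u1 u2 us k :
  enumerated (valid_state A' [:: u1, u2 & us]) k ->
  enumerated (fun st => valid_state A ((c :: u1 ++ bar c :: u2) :: us) st /\
    peel_idx st = Some (x, y, inl (u1, u2))) k.
Proof.
apply: (enumerated_bij (f := split_up c x y) (g := split_down x y)) => -[[[p a] lab] ss] /=.
- move=> H; have [ax ay] : a x = x /\ a y = y by split; apply: (v_out H).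
  have [lx ly] : lab x = c0 /\ lab y = c0 by split; apply: (v_lab0 H).
  case: ss H => [|s1 [|s2 ss]] H; try by have := v_us H.
  have [su1 su2] : u1 = map lab s1 /\ u2 = map lab s2 by case: (v_us H).
  split.
    by apply/(@valid_split _ _ _ V _ barK _ _ _ _ _ c xA yA xy ax ay lx ly p) => //; rewrite su1 size_map.
  have : uniq (flatten [:: s1, s2 & ss]) by exact: v_uniq H.
  have sub := v_sub H.
  have xF : x \notin flatten [:: s1, s2 & ss] by apply: contraNN xA' => /sub.
  have yF : y \notin flatten [:: s1, s2 & ss] by apply: contraNN yA' => /sub.
  move: xF yF; rewrite /= !mem_cat !negb_or => /and3P[xs1 xs2 _] /and3P[ys1 ys2 _] _.
  rewrite permM ax tpermL inE eqxx orbT index_cat (negPf ys1) /= eqxx addn0.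
  rewrite take_size_cat // drop_cat ltnNge leqnSn /= subSnn /= drop0.
  by rewrite !map_relab // su1 su2.
- move=> [H]; case: ss H => [|[|x' s] ss] // H [xx].
  move: H; rewrite {}xx => H yE; rewrite yE; case: ifP => // ys [e1 e2].
  set s1 := take _ s in e1 *; set s2 := drop _ s in e2 *.
  have sE : s = s1 ++ y :: s2 by rewrite /s1 /s2 -{1}(cat_take_drop (index y s) s) (drop_index ys).
  have ayx : a y = x by rewrite -yE (v_inv H).
  have lx : lab x = c by case: (v_us H).
  have ly : lab y = bar c by rewrite -yE (v_lab H) // lx.
  have := H; rewrite sE -{1}(mul_tpermK a x y) -{1}(relabK c0 c0 lx ly).
  move/(@valid_split _ _ _ V c0 barK _ _ _ _ _ c xA yA xy) => h; apply: h; rewrite ?ffunE ?eqxx //.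
  + by rewrite permM yE tpermR.
  + by rewrite permM ayx tpermL.
  + by case: ifP.
  + by rewrite -e1 size_map.
- move=> H; have [lx ly] : lab x = c0 /\ lab y = c0 by split; apply: (v_lab0 H).
  rewrite mul_tpermK relabK //; case: ss H => [|s1 [|s2 ss]] H; try by have := v_us H.
  have sub := v_sub H.
  have : y \notin flatten [:: s1, s2 & ss] by apply: contraNN yA' => /sub.
  rewrite /= !mem_cat !negb_or => /and3P[ys1 ys2 _].
  rewrite index_cat (negPf ys1) /= eqxx addn0.
  by rewrite take_size_cat // drop_cat ltnNge leqnSn /= subSnn /= drop0.
- move=> [H]; case: ss H => [|[|x' s] ss] // H [xx].
  move: H; rewrite {}xx => H yE; rewrite yE; case: ifP => // ys [e1 e2].
  have lx : lab x = c by case: (v_us H).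
  have ly : lab y = bar c by rewrite -yE (v_lab H) // lx.
  by rewrite mul_tpermK relabK // -(drop_index ys) cat_take_drop.
Qed.

Lemma enum_merge u v us k : V (bar c :: v) ->
  enumerated (valid_state A' ((v ++ u) :: us)) k ->
  enumerated (fun st => valid_state A ((c :: u) :: us) st /\
    peel_idx st = Some (x, y, inr v)) k.
Proof.
move=> Vv.
apply: (enumerated_bij (f := merge_up c x y (size v)) (g := merge_down x y)) => -[[[p a] lab] ss] /=.
- move=> H; have [ax ay] : a x = x /\ a y = y by split; apply: (v_out H).
  have [lx ly] : lab x = c0 /\ lab y = c0 by split; apply: (v_lab0 H).
  case: ss H => [|t ss] H; first by have := v_us H.
  set r := take _ _; set s := drop _ _.
  have tE : t = r ++ s by rewrite cat_take_drop.
  have sv : size v = size r.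
    have /(f_equal size) : map lab t = v ++ u by case: (v_us H).
    by rewrite size_map size_cat /r size_take => ->; case: ltnP => //; lia.
  have H' : valid bar V c0 A' ((v ++ u) :: us) p a lab ((r ++ s) :: ss) by rewrite -tE.
  have [] := (@valid_merge _ _ _ V c0 barK V_rot _ _ _ _ _ c xA yA xy ax ay lx ly p r s ss v u us sv).1 (conj H' Vv).
  move=> HA Ur rA pr vr; split=> //.
  rewrite permM ax tpermL.
  have ys : y \notin s.
    have := (rA y (mem_head _ _)).2; apply: contraNN => ys.
    by rewrite /= inE mem_cat ys orbT.
  rewrite (negPf ys).
  rewrite (orbit_mul_cyc Ur pr) /= vr map_relab //.
    apply/negP => xr; have := (rA x); rewrite inE xr orbT => /(_ isT)[_].
    by rewrite /= inE eqxx.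
  by case/andP: Ur.
- move=> [H]; case: ss H => [|[|x' s] ss] // H [xx].
  move: H; rewrite {}xx => H yE; rewrite yE; case: ifP => // ys [vE].
  set r := behead (orbit p y) in vE *; have rE : orbit p y = y :: r by rewrite orbitP_head.
  have ayx : a y = x by rewrite -yE (v_inv H).
  have lx : lab x = c by case: (v_us H).
  have ly : lab y = bar c by rewrite -yE (v_lab H) // lx.
  have yF : y \notin flatten ((x :: s) :: ss).
    have := valid_alone H; rewrite yE /= inE mem_cat ys => /negPf->.
    by rewrite eq_sym (negPf xy).
  have fp : fcycle p (y :: r) by rewrite -rE cycle_orbit //; exact: perm_inj.
  have Ur : uniq (y :: r) by rewrite -rE orbit_uniq.
  have nF : {in y :: r, forall z, z \notin flatten ((x :: s) :: ss)}.
    move=> z; rewrite -rE => zr; apply: contraNN yF => zF.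
    by rewrite (fixed_orbit (v_fixr H zF) zr).
  have rA : {in y :: r, forall z, z \in A}.
    move=> z; rewrite -rE => zr; apply: contraLR yA => zA.
    by rewrite (fixed_orbit (v_fix H zA) zr).
  have pr : {in y :: r, forall z, (p * (cyc (y :: r))^-1)%g z = z}.
    by move=> z zr; rewrite permM -(cyc_fcycle fp Ur zr) permK.
  have := H; rewrite -{1}(mul_tpermK a x y) -{1}(relabK c0 c0 lx ly).
  rewrite -{1}(mulgKV (cyc (y :: r)) p) => h.
  have [||||||h' _] := (@valid_merge _ _ _ V c0 barK V_rot _ _ _ (a * tperm x y)%g (relab lab x c0 y c0)
    c xA yA xy _ _ _ _ (p * (cyc (y :: r))^-1)%g r s ss v u us _).2.
  + by rewrite permM yE tpermR.
  + by rewrite permM ayx tpermL.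
  + by rewrite ffunE eqxx.
  + by rewrite ffunE eqxx; case: ifP.
  + by rewrite -vE size_map.
  + split=> //; first by move=> z zr; split; [exact: rA|exact: nF].
    rewrite map_relab ?vE //; last by case/andP: Ur.
    apply/negP => xr; have := nF x; rewrite inE xr orbT => /(_ isT).
    by rewrite /= inE eqxx.
  by rewrite rE.
- move=> H; have [lx ly] : lab x = c0 /\ lab y = c0 by split; apply: (v_lab0 H).
  rewrite mul_tpermK relabK //; case: ss H => [|t ss] H; first by have := v_us H.
  have [ax ay] : a x = x /\ a y = y by split; apply: (v_out H).
  rewrite /=; set r := take _ _; set s := drop _ _.
  have tE : t = r ++ s by rewrite cat_take_drop.
  have sv : size v = size r.
    have /(f_equal size) : map lab t = v ++ u by case: (v_us H).
    by rewrite size_map size_cat /r size_take => ->; case: ltnP => //; lia.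
  have H' : valid bar V c0 A' ((v ++ u) :: us) p a lab ((r ++ s) :: ss) by rewrite -tE.
  have [] := (@valid_merge _ _ _ V c0 barK V_rot _ _ _ _ _ c xA yA xy ax ay lx ly p r s ss v u us sv).1 (conj H' Vv).
  move=> HA Ur rA pr vr.
  by rewrite (orbit_mul_cyc Ur pr) mulgK tE.
- move=> [H]; case: ss H => [|[|x' s] ss] // H [xx].
  move: H; rewrite {}xx => H yE; rewrite yE; case: ifP => // ys [vE].
  have lx : lab x = c by case: (v_us H).
  have ly : lab y = bar c by rewrite -yE (v_lab H) // lx.
  rewrite mul_tpermK relabK //= -vE size_map take_size_cat // drop_size_cat //.
  by rewrite -orbitP_head mulgKV.
Qed.

End Pair.
(** The possible pairs of halves of the root edge. With n + 1 edges there are (2n + 2)(2n + 1) of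
    them, the factor by which the factorial grows in [count_valid]. *)
Definition dpairs A := enum [set w : D * D | [&& w.1 \in A, w.2 \in A & w.1 != w.2]].

Lemma size_dpairs A : size (dpairs A) = #|A| * #|A|.-1.
Proof.
rewrite -cardE; have -> : [set w : D * D | [&& w.1 \in A, w.2 \in A & w.1 != w.2]]
    = setX A A :\: [set (x, x) | x in A].
  apply/setP => -[x y]; rewrite !inE /=.
  have [xA|xA] := boolP (x \in A); last by rewrite andbF.
  have [yA|yA] := boolP (y \in A); last by rewrite ?andbF.
  rewrite !andbT; congr (~~ _); apply/eqP/imsetP => [<-|[z _ [-> ->]]] //.
  by exists x.
rewrite cardsD (setIidPr _); last first.
  by apply/subsetP => _ /imsetP[x xA ->]; rewrite inE xA.
rewrite cardsX card_imset; last by move=> x y [].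
by case: #|A| => // n; rewrite /= mulnS addKn.
Qed.

Definition kinds n c u : seq kind := map inl (wsplits (bar c) u) ++ map inr (vs n c).

Lemma kinds_uniq n c u : uniq (kinds n c u).
Proof.
rewrite cat_uniq !map_inj_uniq ?wsplits_uniq ?vs_uniq; try by move=> ? ? [].
by rewrite andbT; apply/hasPn => _ /mapP[v _ ->]; apply/negP => /mapP[].
Qed.

Lemma peel_idx_in n A c u us st : #|A| = n.+1.*2 -> valid_state A ((c :: u) :: us) st ->
  peel_idx st \in [seq Some (w.1, w.2, k) | w <- dpairs A, k <- kinds n c u].
Proof.
move: st => [[[p a] lab] ss] cA H; have us_eq := v_us H.
case: ss us_eq H => [|[|x s] ss] //= [lx lu _] H.
have xF : x \in flatten ((x :: s) :: ss) by rewrite mem_head.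
have xA : x \in A := v_sub H xF.
have axA : a x \in A.
  by apply: contraT => /(v_out H) /perm_inj ax; have := v_neq H xA; rewrite ax eqxx.
have xax : x != a x by rewrite eq_sym (v_neq H).
have wA : (x, a x) \in dpairs A by rewrite mem_enum inE /= xA axA xax.
apply/allpairsP; exists ((x, a x), if a x \in s
  then inl (map lab (take (index (a x) s) s), map lab (drop (index (a x) s).+1 s))
  else inr (map lab (behead (orbit p (a x))))).
split => //=; rewrite mem_cat; case: ifP => axs; apply/orP.
  left; apply/mapP; eexists; last reflexivity; apply/wsplitsP => /=.
  by rewrite -lu -{1}(cat_take_drop (index (a x) s) s) (drop_index axs) map_cat /= -lx (v_lab H).
have axF : a x \notin flatten ((x :: s) :: ss).
  have := valid_alone H; rewrite /= inE mem_cat axs => /negPf->.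
  by rewrite eq_sym (negPf xax).
right; apply/mapP; eexists; last reflexivity.
apply: V_vs.
  (* Of the 2n + 2 half-edges, [x] is fixed by [p] and so outside the orbit of [a x]; at most 2n
     remain besides [a x]. *)
  rewrite size_map size_behead; have : uniq (x :: orbit p (a x)).
    rewrite cons_uniq orbit_uniq andbT; apply/negP => /(fixed_orbit (v_fixr H xF)) /eqP.
    by rewrite eq_sym (negPf xax).
  move=> /card_uniqP /= e; have : #|x :: orbit p (a x)| <= #|A|.
    apply: subset_leq_card; apply/subsetP => z; rewrite inE => /orP[/eqP->//|zo].
    by apply: contraLR axA => zA; rewrite (fixed_orbit (v_fix H zA) zo).
  by rewrite e cA doubleS; lia.
by have := v_vert H axA axF; rewrite orbitP_head /= (v_lab H) // lx.
Qed.

Lemma valid0 us : enumerated (valid_state set0 us) (all (@nilp _) us).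
Proof.
have [un|un] := boolP (all (@nilp _) us); last first.
  apply: enumerated_empty => -[[[p a] lab] ss] H; case/negP: un.
  rewrite -(v_us H) all_map; apply/allP => s sss /=.
  case: s sss => // z s sss; have : z \in flatten ss by apply/flattenP; exists (z :: s); rewrite ?mem_head.
  by move/(v_sub H); rewrite inE.
pose ss0 : seq (seq D) := map (fun=> [::]) us.
have fl0 : flatten ss0 = [::] by rewrite /ss0; elim: (us).
have E1 : tot (1%g : {perm D}) ss0 = 1%g.
  by rewrite /ss0; elim: (us) => //= ? ? ->; rewrite mulg1.
have E2 : nn ss0 = 0 by rewrite /nn /ss0 count_map /=; elim: (us).
exists [:: (1%g, 1%g, [ffun=> c0], ss0)]; split=> // -[[[p a] lab] ss].
rewrite inE; split=> [/eqP[-> -> -> ->]|H].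
  split; rewrite ?fl0 //; try by move=> z; rewrite ?inE ?perm1.
  - by move=> z _; rewrite ffunE.
  - rewrite /ss0; elim: us un {ss0 fl0 E1 E2} => //= u us IHus /andP[/nilP-> un].
    by rewrite IHus.
  - by move=> B; rewrite subset0 => /eqP.
  - by rewrite /euler E1 E2 mulg1 porbits1 setC0 cardsT addn0 -addnn addnA.
have -> : p = 1%g by apply/permP => z; rewrite perm1 (v_fix H) ?inE.
have -> : a = 1%g by apply/permP => z; rewrite perm1 (v_out H) ?inE.
have -> : lab = [ffun=> c0] by apply/ffunP => z; rewrite ffunE (v_lab0 H) ?inE.
suff -> : ss = ss0 by rewrite eqxx.
rewrite /ss0 -(v_us H) -map_comp; have := v_sub H; elim: (ss) => //= s ss' IHs sub.
rewrite -IHs; last by move=> z zs; apply: sub; rewrite mem_cat zs orbT.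
by case: s sub => // z s /(_ z); rewrite /= !inE eqxx => /(_ isT).
Qed.

Lemma M_cons n c u us : M n.+1 ((c :: u) :: us) =
  \sum_(w <- wsplits (bar c) u) M n [:: w.1, w.2 & us] + \sum_(v <- vs n c) M n ((v ++ u) :: us).
Proof. by []. Qed.

(** For each ordered pair of half-edges that serves as root edge, the states are counted by the
    smaller states listed in [peelsum], and this number does not depend on the pair. *)
Theorem count_valid N A us : #|A| = N.*2 -> enumerated (valid_state A us) ((N.*2)`! * M N us).
Proof.
elim: N A us => [|n IHn] A us cA.
  by move/eqP: cA; rewrite cards_eq0 => /eqP->; rewrite mul1n; exact: valid0.
elim: us => [|[|c u] us IHus].
(* Without root vertices, reachability forces [A] to be empty. *)
- rewrite /= muln0; apply: enumerated_empty => -[[[p a] lab] ss] H.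
  have sE : ss = [::] by have := v_us H; case: (ss).
  have := v_reach H (subxx A); rewrite sE.
  have pA (q : {perm D}) : (forall z, z \notin A -> q z = z) -> stable q A.
    by move=> qA z zA; apply: contraT => qzA; have e := perm_inj (qA _ qzA); rewrite e zA in qzA.
  have n0 : {in flatten [::], forall z : D, z \notin A} by [].
  by move=> /(_ (pA _ (v_fix H)) (pA _ (v_out H)) n0) A0; rewrite A0 cards0 in cA.
- rewrite [M _ _]/(M n.+1 us).
  apply: (enumerated_bij (f := fun st : state => let: (p, a, lab, ss) := st in (p, a, lab, [::] :: ss) : state)
    (g := fun st : state => let: (p, a, lab, ss) := st in (p, a, lab, behead ss) : state) _ _ _ _ IHus) => -[[[p a] lab] ss] //=.
  + by rewrite -valid_nil.
  + by case: ss => [|[|z s] ss] H; try (by have := v_us H); rewrite -valid_nil in H.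
  + by case: ss => [|[|z s] ss] H; try by have := v_us H.
pose K (i : option (D * D * kind)) := (n.*2)`! * match i with
  | Some (_, inl w) => M n [:: w.1, w.2 & us]
  | Some (_, inr v) => M n ((v ++ u) :: us)
  | None => 0 end.
have -> : (n.+1.*2)`! * M n.+1 ((c :: u) :: us) =
    \sum_(i <- [seq Some (w.1, w.2, k) | w <- dpairs A, k <- kinds n c u]) K i.
  have EK (w : D * D) : \sum_(k <- kinds n c u) K (Some (w.1, w.2, k)) =
      (n.*2)`! * M n.+1 ((c :: u) :: us).
    by rewrite M_cons mulnDr !big_distrr big_cat !big_map.
  rewrite big_allpairs_dep (eq_bigr _ (fun w _ => EK w)).
  rewrite big_const_seq count_predT iter_addn_0 size_dpairs cA doubleS !factS.
  by rewrite [in LHS]mulnA -mulnA mulnC.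
apply: (enumerated_sum (idx := peel_idx)).
- apply: allpairs_uniq; [exact: enum_uniq|exact: kinds_uniq|].
  by move=> [[x y] k] [[x' y'] k'] _ _ /= [-> -> ->].
- by move=> st; exact: peel_idx_in.
move=> _ /allpairsP[[[x y] k] /= [+ kk ->]].
rewrite mem_enum inE => /and3P[xA yA xy].
have cA' : #|A :\: [set x; y]| = n.*2.
  have := cardsC (A :\: [set x; y]); rewrite card_setC_D2 // => e.
  by apply/eqP; rewrite -(eqn_add2r #|~: A|.+2) e -(cardsC A) cA doubleS !addnS.
move: kk; rewrite mem_cat => /orP[/mapP[[u1 u2] /wsplitsP /= uE ->]|/mapP[v vv ->]] /=.
  by rewrite uE; apply: enum_split => //; exact: IHn.
by apply: enum_merge => //; [exact: vs_V vv|exact: IHn].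
Qed.

End Count.

Import GRing.Theory.
Local Open Scope ring_scope.

(** * Formal power series *)

(** A wrapper around functions, to which a ring structure can be attached; functional extensionality
    makes equality of series coefficientwise. *)
Record fser (A : Type) := Fser { coefs : nat -> A }.

HB.instance Definition _ (A : Type) := gen_eqMixin (fser A).
HB.instance Definition _ (A : Type) := gen_choiceMixin (fser A).

Lemma fserP (A : Type) (F H : fser A) : (forall n, coefs F n = coefs H n) -> F = H.
Proof. by case: F H => f [h] /= fh; congr Fser; apply/funext. Qed.

Section FserRing.

Variable A : comNzRingType.
Implicit Types (F G H : fser A) (n m : nat).

Definition fser_add F G := Fser (fun n => coefs F n + coefs G n).
Definition fser_opp F := Fser (fun n => - coefs F n).
Definition fser_zero : fser A := Fser (fun=> 0).
Definition fser_one : fser A := Fser (fun n => (n == 0%N)%:R).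
Definition fser_mul F G := Fser (fun n => \sum_(i < n.+1) coefs F i * coefs G (n - i)).

Lemma fser_addA : associative fser_add.
Proof. by move=> F G H; apply: fserP => n; apply: addrA. Qed.
Lemma fser_addC : commutative fser_add.
Proof. by move=> F G; apply: fserP => n; apply: addrC. Qed.
Lemma fser_add0 : left_id fser_zero fser_add.
Proof. by move=> F; apply: fserP => n; apply: add0r. Qed.
Lemma fser_addN : left_inverse fser_zero fser_opp fser_add.
Proof. by move=> F; apply: fserP => n; apply: addNr. Qed.

HB.instance Definition _ :=
  GRing.isZmodule.Build (fser A) fser_addA fser_addC fser_add0 fser_addN.

Definition trunc n F : {poly A} := \poly_(i < n) coefs F i.

Lemma coef_trunc n F m : (m < n)%N -> (trunc n F)`_m = coefs F m.
Proof. by move=> mn; rewrite coef_poly mn. Qed.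

Lemma fser_mul_trunc n F G m : (m < n)%N ->
  coefs (fser_mul F G) m = (trunc n F * trunc n G)`_m.
Proof.
move=> mn; rewrite coefM; apply: eq_bigr => i _.
by rewrite !coef_trunc //; have := ltn_ord i; lia.
Qed.

(** Inherited from polynomials, because a coefficient of a product depends only on truncations of
    the factors. *)
Lemma fser_mulA : associative fser_mul.
Proof.
move=> F G H; apply: fserP => n.
have E : (trunc n.+1 F * (trunc n.+1 G * trunc n.+1 H))`_n = coefs (fser_mul F (fser_mul G H)) n.
  rewrite coefM; apply: eq_bigr => i _.
  by rewrite -fser_mul_trunc ?coef_trunc //; have := ltn_ord i; lia.
rewrite -E mulrA coefM; apply: eq_bigr => i _.
by rewrite -fser_mul_trunc ?coef_trunc //; have := ltn_ord i; lia.
Qed.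

Lemma fser_mulC : commutative fser_mul.
Proof.
by move=> F G; apply: fserP => n; rewrite !(@fser_mul_trunc n.+1) // mulrC.
Qed.

Lemma fser_mul1 : left_id fser_one fser_mul.
Proof.
move=> F; apply: fserP => n /=; rewrite big_ord_recl /= mul1r subn0 big1 ?addr0 // => i _.
by rewrite mul0r.
Qed.

Lemma fser_mulDl : left_distributive fser_mul fser_add.
Proof.
move=> F G H; apply: fserP => n /=; rewrite -big_split /=.
by apply: eq_bigr => i _; rewrite mulrDl.
Qed.

Lemma fser_one_neq0 : fser_one != fser_zero.
Proof. by apply/eqP => /(congr1 (fun F => coefs F 0%N)) /= /eqP; rewrite oner_eq0. Qed.

HB.instance Definition _ := GRing.Zmodule_isComNzRing.Build (fser A)
  fser_mulA fser_mulC fser_mul1 fser_mulDl fser_one_neq0.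

Lemma cf0 n : coefs (0 : fser A) n = 0. Proof. by []. Qed.
Lemma cf1 n : coefs (1 : fser A) n = (n == 0%N)%:R. Proof. by []. Qed.
Lemma cfD F G n : coefs (F + G) n = coefs F n + coefs G n. Proof. by []. Qed.
Lemma cfN F n : coefs (- F) n = - coefs F n. Proof. by []. Qed.
Lemma cfB F G n : coefs (F - G) n = coefs F n - coefs G n. Proof. by []. Qed.
Lemma cfM F G n : coefs (F * G) n = \sum_(i < n.+1) coefs F i * coefs G (n - i).
Proof. by []. Qed.
Lemma cf_sum (I : Type) (r : seq I) (P : pred I) (F : I -> fser A) n :
  coefs (\sum_(i <- r | P i) F i) n = \sum_(i <- r | P i) coefs (F i) n.
Proof. by elim/big_rec2: _ => // i y1 y2 _ <-. Qed.
Lemma cfMn F k n : coefs (F *+ k) n = coefs F n *+ k.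
Proof. by elim: k => // k IHk; rewrite !mulrS cfD IHk. Qed.

Definition X : fser A := Fser (fun n => (n == 1%N)%:R).

Lemma cfXM F n : coefs (X * F) n = if n is m.+1 then coefs F m else 0.
Proof.
rewrite cfM; case: n => [|n]; first by rewrite big_ord1 mul0r.
rewrite big_ord_recl /= mul0r add0r big_ord_recl /= mul1r subn1 big1 ?addr0 // => i _.
by rewrite mul0r.
Qed.

Lemma cfXnM k F n : coefs (X ^+ k * F) n = if (n < k)%N then 0 else coefs F (n - k).
Proof.
elim: k n => [|k IHk] n; first by rewrite mul1r subn0.
by rewrite exprS -mulrA cfXM; case: n => // n; rewrite IHk ltnS subSS.
Qed.

Lemma cfXn k n : coefs (X ^+ k) n = (n == k)%:R.
Proof.
rewrite -[X ^+ k]mulr1 cfXnM; case: ltngtP => [nk|kn|->]; rewrite ?subnn //= subn_eq0.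
by rewrite leqNgt kn.
Qed.

Lemma mulXI F G : X * F = X * G -> F = G.
Proof. by move=> e; apply: fserP => n; have := congr1 (fun H => coefs H n.+1) e; rewrite !cfXM. Qed.

Definition eqs n F G := forall m, (m < n)%N -> coefs F m = coefs G m.

Lemma eqs_refl n F : eqs n F F. Proof. by []. Qed.
Lemma eqs_sym n F G : eqs n F G -> eqs n G F. Proof. by move=> e m mn; rewrite e. Qed.
Lemma eqs_trans n F G H : eqs n F G -> eqs n G H -> eqs n F H.
Proof. by move=> e1 e2 m mn; rewrite e1 ?e2. Qed.
Lemma eqs_le n m F G : (m <= n)%N -> eqs n F G -> eqs m F G.
Proof. by move=> mn e k km; apply: e; apply: leq_trans mn. Qed.
Lemma eqs_eq F G : (forall n, eqs n F G) -> F = G.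
Proof. by move=> e; apply: fserP => n; apply: (e n.+1). Qed.
Lemma eqsD n F F' G G' : eqs n F F' -> eqs n G G' -> eqs n (F + G) (F' + G').
Proof. by move=> e1 e2 m mn; rewrite !cfD e1 ?e2. Qed.
Lemma eqsN n F F' : eqs n F F' -> eqs n (- F) (- F').
Proof. by move=> e1 m mn; rewrite !cfN e1. Qed.
Lemma eqsB n F F' G G' : eqs n F F' -> eqs n G G' -> eqs n (F - G) (F' - G').
Proof. by move=> e1 e2; apply: eqsD => //; apply: eqsN. Qed.
Lemma eqsM n F F' G G' : eqs n F F' -> eqs n G G' -> eqs n (F * G) (F' * G').
Proof.
move=> e1 e2 m mn; rewrite !cfM; apply: eq_bigr => i _.
by rewrite e1 ?e2 //; have := ltn_ord i; lia.
Qed.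
Lemma eqs_sum n (I : eqType) (r : seq I) (F G : I -> fser A) :
  (forall i, i \in r -> eqs n (F i) (G i)) ->
  eqs n (\sum_(i <- r) F i) (\sum_(i <- r) G i).
Proof.
by move=> e m mn; rewrite !cf_sum; apply: eq_big_seq => i ir; apply: e.
Qed.
Lemma eqsX n F G : eqs n F G -> eqs n.+1 (X * F) (X * G).
Proof. by move=> e [|m] mn; rewrite !cfXM // e. Qed.
Lemma eqsXn k n F G : eqs n F G -> eqs (k + n) (X ^+ k * F) (X ^+ k * G).
Proof.
move=> e; elim: k => [|k IHk]; first by rewrite !mul1r.
by rewrite !exprS -!mulrA; apply: eqsX.
Qed.
Lemma eqsXn0 k F : eqs k (X ^+ k * F) 0.
Proof. by move=> m mk; rewrite cfXnM mk. Qed.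

(* [eqs a F 0] says that the valuation of F is at least a. *)
Lemma eqsM0 a b F G : eqs a F 0 -> eqs b G 0 -> eqs (a + b) (F * G) 0.
Proof.
move=> eF eG m mab; rewrite cfM big1 // => i _.
have [ia|ai] := ltnP i a; first by rewrite eF // mul0r.
by rewrite eG ?mulr0 //; have := ltn_ord i; lia.
Qed.

(** The difference is (F - F') G + F' (G - G'), where an error of order n is multiplied by a factor
    of order a. This gain is what makes the recursive systems contract. *)
Lemma eqsM_gain n a F F' G G' : eqs n F F' -> eqs n G G' -> eqs a F' 0 -> eqs a G 0 ->
  eqs (a + n) (F * G) (F' * G').
Proof.
move=> eF eG vF vG.
have -> : F * G = F' * G' + ((F - F') * G + F' * (G - G')) by ring.
have e1 : eqs (n + a) ((F - F') * G) 0 by apply: eqsM0 => // m mn; rewrite cfB eF ?subrr.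
have e2 : eqs (a + n) (F' * (G - G')) 0 by apply: eqsM0 => // m mn; rewrite cfB eG ?subrr.
by move=> m mn; rewrite !cfD e1 ?e2 ?cf0 ?addr0 // addnC.
Qed.

End FserRing.

Arguments X {A}.

Local Close Scope ring_scope.

(** * Symmetries and product formula of the peeling series *)

Section ValidInvariance.

Variables (D : finType) (L : eqType) (bar : L -> L) (V : pred (seq L)) (c0 : L).
Implicit Types (A : {set D}) (s : seq D) (ss : seq (seq D)).
Implicit Types (p a : {perm D}) (lab : {ffun D -> L}) (u : seq L) (us : seq (seq L)).

Lemma valid_rot A k u us p a lab s ss :
  valid bar V c0 A (u :: us) p a lab (s :: ss) ->
  valid bar V c0 A (rot k u :: us) p a lab (rot k s :: ss).
Proof.
have P : perm_eq (flatten (rot k s :: ss)) (flatten (s :: ss)).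
  by rewrite [perm_eq _ _]perm_cat2r perm_rot.
have E : flatten (rot k s :: ss) =i flatten (s :: ss).
  exact: perm_mem P.
have Et : uniq (flatten (s :: ss)) -> tot p (rot k s :: ss) = tot p (s :: ss).
  by rewrite /= cat_uniq => /andP[us' _]; rewrite cyc_rot.
have En : nn (rot k s :: ss) = nn (s :: ss) by rewrite /nn /= /nilp size_rot.
move=> [H1 H2 H3 H4 H5 H6 H7 H8 H9 H10 H11 H12 H13]; split=> //.
- by rewrite (perm_uniq P).
- by move=> z; rewrite E => /H2.
- by move=> z; rewrite E => /H4.
- by move: H10; rewrite /= map_rot => -[-> ->].
- by move=> z zA; rewrite E; apply: H11.
- by move=> B BA pB aB FB; apply: H12 => // z zF; apply: FB; rewrite E.
- by rewrite /euler Et // En.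
Qed.

Lemma valid_morph (h : L -> L) A us p a lab ss : (forall c, h (bar c) = bar (h c)) ->
  (forall u, V (map h u) = V u) ->
  valid bar V c0 A us p a lab ss ->
  valid bar V (h c0) A (map (map h) us) p a [ffun z => h (lab z)] ss.
Proof.
move=> hbar hV [H1 H2 H3 H4 H5 H6 H7 H8 H9 H10 H11 H12 H13]; split=> //.
- by move=> z /H8 zA; rewrite ffunE zA.
- by move=> z /H9 zA; rewrite !ffunE zA hbar.
- rewrite -H10 -map_comp; apply: eq_map => s /=; rewrite -map_comp.
  by apply: eq_map => z /=; rewrite ffunE.
- move=> z zA zF; have := H11 z zA zF; rewrite -hV -map_comp.
  by congr (is_true (V _)); apply: eq_map => w /=; rewrite ffunE.
Qed.

End ValidInvariance.

Section MTheory.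

Variables (L : eqType) (bar : L -> L) (V : pred (seq L)).
Variable vs : nat -> L -> seq (seq L).
Hypothesis barK : involutive bar.
Hypothesis V_rot : forall n w, V (rot n w) = V w.
Hypothesis vs_uniq : forall n c, uniq (vs n c).
Hypothesis vs_V : forall n c v, v \in vs n c -> V (bar c :: v).
Hypothesis V_vs : forall n c v, size v <= n.*2 -> V (bar c :: v) -> v \in vs n c.

Implicit Types (u v : seq L) (us : seq (seq L)).

Notation M := (M bar vs).

Lemma M_states c0 N us :
  enumerated (@valid_state 'I_(N.*2) L bar V c0 [set: 'I_(N.*2)] us) ((N.*2)`! * M N us).
Proof. by apply: count_valid => //; rewrite cardsT card_ord. Qed.

Lemma M_nil N us : M N ([::] :: us) = M N us.
Proof. by case: N. Qed.

(** The recursion distinguishes the first half-edge, so the symmetry is not visible on [M]; it is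
    read off from the states that [M] counts, where rotating the first root list is a bijection. *)
Lemma M_rot N k u us : M N (rot k u :: us) = M N (u :: us).
Proof.
case: u => [|c u]; first by [].
apply/eqP; rewrite -(eqn_pmul2l (fact_gt0 N.*2)); apply/eqP.
apply: enumerated_inj (M_states c N _) _; move: (c :: u) => {}u.
pose f (r : seq 'I_(N.*2) -> seq 'I_(N.*2)) (st : state 'I_(N.*2) L) : state 'I_(N.*2) L :=
  let: (p, a, lab, ss) := st in (p, a, lab, r (head [::] ss) :: behead ss).
apply: (enumerated_bij (f := f (rot k)) (g := f (rotr k)) _ _ _ _ (M_states c N (u :: us))) => -[[[p a] lab] ss] /=.
- by case: ss => [|s ss] H; [have := v_us H|apply: valid_rot].
- case: ss => [|s ss] H; first by have := v_us H.
  have e : size s = size (rot k u) by case: (v_us H) => <- _; rewrite size_map.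
  by rewrite -[u](rotK k) /rotr -e; apply: valid_rot.
- by case: ss => [|s ss] H /=; [have := v_us H|rewrite rotK].
- by case: ss => [|s ss] H /=; [have := v_us H|rewrite rotrK].
Qed.

Lemma M_morph (h : L -> L) N us : involutive h -> (forall c, h (bar c) = bar (h c)) ->
  (forall u, V (map h u) = V u) -> M N (map (map h) us) = M N us.
Proof.
move=> hK hbar hV; case E: (flatten us) => [|c u0].
  congr (M N _); elim: us E => // -[|c u] us IHus //= E; by rewrite IHus.
apply/eqP; rewrite -(eqn_pmul2l (fact_gt0 N.*2)); apply/eqP.
apply: enumerated_inj (M_states (h c) N _) _.
pose f (st : state 'I_(N.*2) L) : state 'I_(N.*2) L :=
  let: (p, a, lab, ss) := st in (p, a, [ffun z => h (lab z)], ss).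
have fK st : f (f st) = st.
  move: st => [[[p a] lab] ss] /=; congr (_, _, _, _).
  by apply/ffunP => z; rewrite !ffunE hK.
apply: (enumerated_bij (f := f) (g := f) _ _ _ _ (M_states c N us)) => // -[[[p a] lab] ss] /=.
  exact: valid_morph.
move=> H; rewrite -[c]hK -[us](_ : map (map h) (map (map h) us) = us); last first.
  rewrite -map_comp -[RHS]map_id; apply: eq_map => u /=.
  by rewrite -map_comp -[RHS]map_id; apply: eq_map => d /=; rewrite hK.
exact: valid_morph.
Qed.

Lemma M_long N us : N.*2 < size (flatten us) -> M N us = 0.
Proof.
move=> lt; have [c _] : exists c : L, True.
  by case: (flatten us) lt => // c; exists c.
apply/eqP; rewrite -(eqn_pmul2l (fact_gt0 N.*2)) muln0; apply/eqP.
apply: enumerated_inj (M_states c N us) (enumerated_empty _) => -[[[p a] lab] ss] H.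
have : size (flatten us) = size (flatten ss).
  by rewrite -(v_us H) !size_flatten /shape -map_comp; congr sumn; apply: eq_map => s /=; rewrite size_map.
move=> e; move: lt; rewrite e -(card_uniqP (v_uniq H)) ltnNge.
by rewrite (leq_trans (max_card _)) // card_ord.
Qed.

(** The two halves of an edge have opposite charges and an ordinary vertex has charge zero, so a
    peeling step preserves the charge of the root it treats, or cuts off parts that must be neutral
    themselves. *)
Lemma M_charge (ch : seq L -> int) N us : (forall u v, ch (u ++ v) = ch u + ch v)%R ->
  (forall c, ch [:: bar c] = - ch [:: c])%R -> (forall v, V v -> ch v = 0) ->
  M N us != 0 -> {in us, forall u, ch u = 0}.
Proof.
move=> chD chbar chV.
have ch0 : ch [::] = 0 by have := chD [::] [::]; rewrite cats0; lia.
elim: N us => [|n IHn] us.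
  by rewrite /=; case: allP => // h _ u /h /nilP->.
elim: us => [|[|c u] us IHus] //.
  by rewrite M_nil => /IHus h w; rewrite inE => /orP[/eqP->|/h].
rewrite M_cons addn_eq0 negb_and => /orP[].
  rewrite sum_nat_seq_neq0 => /hasP[[u1 u2] /wsplitsP /= uE /IHn h] w.
  rewrite inE => /orP[/eqP->|wus]; last by apply: h; rewrite !inE wus !orbT.
  have -> : c :: u = [:: c] ++ u1 ++ [:: bar c] ++ u2 by rewrite uE.
  have h1 : ch u1 = 0 by apply: h; rewrite inE eqxx.
  have h2 : ch u2 = 0 by apply: h; rewrite !inE eqxx orbT.
  by rewrite !chD chbar h1 h2; lia.
rewrite sum_nat_seq_neq0 => /hasP[v /vs_V Vv /IHn h] w.
rewrite inE => /orP[/eqP->|wus]; last by apply: h; rewrite inE wus orbT.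
have := chV _ Vv; have := h (v ++ u) (mem_head _ _).
have -> : bar c :: v = [:: bar c] ++ v by [].
have -> : c :: u = [:: c] ++ u by [].
by rewrite !chD chbar; lia.
Qed.

Local Open Scope ring_scope.

Definition mser us : fser rat := Fser (fun N => (M N us)%:R).

Lemma mser_nil us : mser ([::] :: us) = mser us.
Proof. by apply: fserP => N /=; rewrite M_nil. Qed.

Lemma mser0 : mser [::] = 1.
Proof. by apply: fserP => -[|N]. Qed.

Lemma mser_long k us : (k.*2 <= (size (flatten us)).+1)%N -> eqs k (mser us) 0.
Proof. by move=> h m mk /=; rewrite M_long //; lia. Qed.

(** The cutoff in [vs] is immaterial once it admits all words on which [F] does not vanish. *)
Lemma mser_vs n m c (F : seq L -> rat) : (n <= m)%N ->
  (forall v, (n.*2 < size v)%N -> F v = 0) ->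
  \sum_(v <- vs m c) F v = \sum_(v <- vs n c) F v.
Proof.
move=> nm F0.
have red k : \sum_(v <- vs k c) F v = \sum_(v <- [seq v <- vs k c | size v <= n.*2]%N) F v.
  rewrite big_filter [RHS]big_mkcond; apply: eq_bigr => v _.
  by case: leqP => // /F0.
rewrite (red m) (red n); apply: perm_big; apply: uniq_perm; rewrite ?filter_uniq // => v.
rewrite !mem_filter; case: leqP => //= sv; apply/idP/idP => /vs_V; apply: V_vs => //.
by apply: leq_trans sv _; rewrite leq_double.
Qed.

(** The sum over all vertex words may be infinite; each coefficient uses the finite list that
    suffices for it. *)
Definition mser_vert c u us : fser rat :=
  Fser (fun N => \sum_(v <- vs N c) coefs (mser ((v ++ u) :: us)) N).

Lemma mser_cons c u us : mser ((c :: u) :: us) =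
  X * (\sum_(w <- wsplits (bar c) u) mser [:: w.1, w.2 & us] + mser_vert c u us).
Proof.
apply: fserP => -[|N]; rewrite cfXM //.
by rewrite cfD cf_sum /mser [LHS]/= -/M natrD !natr_sum.
Qed.

(** Root vertices belong to different components, and peeling the first one leaves the others
    untouched, so only the total number of edges links them: a Cauchy product. *)
Lemma mser_prod u us : mser (u :: us) = mser [:: u] * mser us.
Proof.
apply: eqs_eq => n; elim: n u us => [|n IHn] u us; first by [].
case: u => [|c u]; first by rewrite !mser_nil mser0 mul1r.
rewrite !mser_cons -mulrA; apply: eqsX; rewrite mulrDl mulr_suml; apply: eqsD.
  apply: eqs_sum => -[u1 u2] _ /=.
  apply: eqs_trans (IHn _ _) _.
  apply: eqs_trans (_ : eqs n (mser [:: u1] * (mser [:: u2] * mser us)) _).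
    by apply: eqsM => //; apply: IHn.
  by rewrite mulrA; apply: eqsM => //; apply: eqs_sym.
move=> m mn; rewrite cfM /=.
transitivity (\sum_(v <- vs m c) \sum_(i < m.+1) coefs (mser [:: v ++ u]) i * coefs (mser us) (m - i)).
  by apply: eq_bigr => v _; rewrite -cfM; apply: IHn.
rewrite exchange_big /=; apply: eq_bigr => i _; rewrite -mulr_suml; congr (_ * _).
apply: mser_vs => [|v sv]; first by have := ltn_ord i; lia.
by rewrite M_long //= cats0 size_cat; lia.
Qed.

Definition wser u := mser [:: u].

Lemma wser0 : wser [::] = 1.
Proof. by rewrite /wser mser_nil mser0. Qed.

Lemma wser_cons c u : wser (c :: u) =
  X * (\sum_(w <- wsplits (bar c) u) wser w.1 * wser w.2 + mser_vert c u [::]).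
Proof.
by rewrite /wser mser_cons; under eq_bigr => w _ do rewrite mser_prod.
Qed.

Lemma wser_rot k u : wser (rot k u) = wser u.
Proof. by apply: fserP => N /=; rewrite M_rot. Qed.

Lemma wser_catC u v : wser (u ++ v) = wser (v ++ u).
Proof. by rewrite -(wser_rot (size u)) rot_size_cat. Qed.

Lemma wser_long k u : (k.*2 <= (size u).+1)%N -> eqs k (wser u) 0.
Proof. by move=> ku; apply: mser_long; rewrite /= cats0. Qed.

Lemma wser_morph (h : L -> L) u : involutive h -> (forall c, h (bar c) = bar (h c)) ->
  (forall u, V (map h u) = V u) -> wser (map h u) = wser u.
Proof. by move=> hK hb hV; apply: fserP => N /=; rewrite -(M_morph N [:: u] hK). Qed.

Lemma wser_charge (ch : seq L -> int) u : (forall u v, ch (u ++ v) = ch u + ch v) ->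
  (forall c, ch [:: bar c] = - ch [:: c]) -> (forall v, V v -> ch v = 0) ->
  ch u != 0 -> wser u = 0.
Proof.
move=> h1 h2 h3 chu; apply: fserP => N /=; apply/eqP; rewrite Num.Theory.pnatr_eq0.
by apply: contraNT chu => /(M_charge h1 h2 h3) ->; rewrite ?mem_head.
Qed.

Lemma mser_vert_const c u us l : (forall n, vs n c = l) ->
  mser_vert c u us = \sum_(v <- l) mser ((v ++ u) :: us).
Proof. by move=> e; apply: fserP => N; rewrite /= e cf_sum. Qed.

End MTheory.

(** * Isomorphism classes of rooted orientations *)

Section Porbits.

Variable D : finType.
Implicit Types (s : {perm D}).
Local Open Scope group_scope.

Lemma mem_orbit_porbit s x y : (y \in orbit s x) = (y \in porbit s x).
Proof.
rewrite -fconnect_orbit; apply/connectP/porbitP => [[t]|[i ->]].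
  elim: t x => [|z t IHt] x /=; first by move=> _ ->; exists 0%N; rewrite expg0 perm1.
  by case/andP => /eqP <- /IHt h /h[i ->]; exists i.+1; rewrite expgS permM.
elim: i => [|i [t pt e]]; first by exists [::]; rewrite ?expg0 ?perm1.
exists (rcons t ((s ^+ i.+1) x)); last by rewrite last_rcons.
by rewrite rcons_path pt -e /= expgSr permM eqxx.
Qed.

Lemma card_porbits_uniform s k : (forall x, #|porbit s x| = k) -> #|D| = (#|porbits s| * k)%N.
Proof.
move=> sk; rewrite -cardsT; have -> : porbits s = equivalence_partition (fun x y => y \in porbit s x) [set: D].
  by apply/setP => B; apply/imsetP/imsetP => -[x _ ->]; exists x => //; apply/setP => y; rewrite !inE.
apply: card_uniform_partition; last first.
  apply: equivalence_partitionP => x y z _ _ _; split; first exact: porbit_id.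
  by move=> xy; rewrite -!eq_porbit_mem ![porbit s z == _]eq_sym; move: xy; rewrite -eq_porbit_mem => /eqP->.
move=> _ /imsetP[x _ ->]; rewrite -(sk x); apply: eq_card => y.
by rewrite !inE.
Qed.

Lemma card_porbits_matching s : (forall x, s x != x) -> involutive s ->
  #|D| = (#|porbits s| * 2)%N.
Proof.
move=> sx ss; apply: card_porbits_uniform => x.
have -> : porbit s x = [set x; s x].
  apply/setP => y; rewrite !inE; apply/porbitP/orP => [[i ->]|[/eqP->|/eqP->]].
  - elim: i => [|i [/eqP e|/eqP e]]; first by left; rewrite expg0 perm1.
      by right; rewrite expgSr permM e.
    by left; rewrite expgSr permM e ss.
  - by exists 0%N; rewrite expg0 perm1.
  - by exists 1%N; rewrite expg1.
by rewrite cards2 eq_sym sx.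
Qed.

End Porbits.

Section Relabelling.

Variable D : finType.
Implicit Types (m : ormap D) (p : {perm D}).
Local Open Scope group_scope.

Definition base m :=
  [&& flip_matching m, map_connected m, map_planar m & is_orientation m].

Definition word m x := map (mem (outs m)) (orbit (vrot m) x).

Definition act m p := OrMap (vrot m ^ p) (flip m ^ p) (p @: outs m) (p (root m)).

Lemma act_iso m m' : ormap_iso m m' <-> exists p, m' = act m p.
Proof.
split.
  case/existsP => p /and4P[/forallP h1 /forallP h2 /forallP h3 /eqP h4]; exists p.
  case: m' h1 h2 h3 h4 => s' a' o' r' /= h1 h2 h3 h4; rewrite /act -h4.
  congr OrMap.
  - by apply/permP => x; rewrite -[x](permKV p) permJ; apply/esym/eqP.
  - by apply/permP => x; rewrite -[x](permKV p) permJ; apply/esym/eqP.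
  - apply/setP => x; rewrite -[x](permKV p) (mem_imset _ _ perm_inj).
    by apply/eqP.
case=> p ->; apply/existsP; exists p; apply/and4P; split => /=.
- by apply/forallP => x; rewrite permJ.
- by apply/forallP => x; rewrite permJ.
- by apply/forallP => x; rewrite (mem_imset _ _ perm_inj).
- by [].
Qed.

Lemma orbit_act (s p : {perm D}) x : orbit (s ^ p) (p x) = map p (orbit s x).
Proof.
rewrite [orbit s x]orbitP_head /=; apply: orbit_cycle_head.
  rewrite -[_ :: _]/(map p (x :: behead (orbit s x))) -orbitP_head cycle_map.
  rewrite (eq_cycle (e' := frel s)); first exact: cycle_orbit (@perm_inj _ s) _.
  by move=> u v /=; rewrite permJ (inj_eq perm_inj).
rewrite -[_ :: _]/(map p (x :: behead (orbit s x))) -orbitP_head.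
by rewrite (map_inj_uniq perm_inj) orbit_uniq.
Qed.

Lemma word_act m p x : word (act m p) (p x) = word m x.
Proof.
rewrite /word orbit_act -map_comp; apply: eq_map => y /=.
by rewrite (mem_imset _ _ perm_inj).
Qed.

Lemma base_act m p : base (act m p) = base m.
Proof.
congr [&& _, _, _ & _].
- apply/forallP/forallP => h x.
    have := h (p x); rewrite /= !permJ !(inj_eq perm_inj) //.
  by rewrite -[x](permKV p) /= !permJ !(inj_eq perm_inj).
- have E x y : connect [rel u v | (v == vrot (act m p) u) || (v == flip (act m p) u)] (p x) (p y)
      = connect [rel u v | (v == vrot m u) || (v == flip m u)] x y.
    apply/connectP/connectP => -[t].
      move=> pt e; exists (map (p^-1) t); last first.
        by apply: (@perm_inj _ p); rewrite e -(last_map p) -map_comp map_id_in // => z _; rewrite /= permKV.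
      rewrite -[x](permK p) path_map; apply: sub_path pt => u v /=.
      by rewrite -{1 2}[u](permKV p) !permJ => /orP[/eqP->|/eqP->]; rewrite permK eqxx ?orbT.
    move=> pt e; exists (map p t); last by rewrite last_map -e.
    by rewrite path_map; apply: sub_path pt => u v /=; rewrite !permJ !(inj_eq perm_inj).
  apply/forallP/forallP => h x; apply/forallP => y.
    by rewrite -E; have /forallP := h (p x); apply.
  by rewrite -[x](permKV p) -[y](permKV p) E; have /forallP := h (p^-1 x); apply.
- by rewrite /map_planar /map_vertices /map_faces /map_edges /= -conjMg !porbitsJ.
- apply/forallP/forallP => h x.
    by have := h (p x); rewrite /= !permJ !(mem_imset _ _ perm_inj).
  by rewrite -[x](permKV p) /= !permJ !(mem_imset _ _ perm_inj).
Qed.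

(** Connectedness propagates the image of the root to all half-edges: a rooted map has no nontrivial
    automorphism. *)
Lemma act_inj m p q : map_connected m -> act m p = act m q -> p = q.
Proof.
move=> /forallP conn [e1 e2 _ e4]; apply/permP => x.
have /forallP/(_ x)/connectP[t pt ->] := conn (root m).
elim: t (root m) e4 pt => //= z t IHt y e4 /andP[yz pt]; apply: IHt => //.
case/orP: yz => /eqP ->; first by rewrite -[p _]permJ -[q _]permJ e1 e4.
by rewrite -[p _]permJ -[q _]permJ e2 e4.
Qed.

(** By [act_inj] every isomorphism class is a free orbit of the symmetric group. *)
Lemma card_classes (P : pred (ormap D)) :
  (forall m, P m -> map_connected m) -> (forall m p, P (act m p) = P m) ->
  #|[set m | P m]| = (#|equivalence_partition (@ormap_iso D) [set m | P m]| * #|D|`!)%N.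
Proof.
move=> Pc Pact; apply: card_uniform_partition; last first.
  apply: equivalence_partitionP => m1 m2 m3 _ _ _; split.
    by apply/act_iso; exists 1; case: (m3) => s a o r; rewrite /act /= !conjg1 perm1 imset_perm1.
  case/act_iso => p ->; apply/idP/idP => /act_iso[q e]; apply/act_iso.
    exists (p^-1 * q); rewrite e /act /=; congr OrMap.
    - by rewrite -conjgM mulgA mulgV mul1g.
    - by rewrite -conjgM mulgA mulgV mul1g.
    - rewrite -imset_comp; apply: eq_imset => x /=; rewrite permM permK //.
    - by rewrite permM permK.
  exists (p * q); rewrite e /act /=; congr OrMap; rewrite ?conjgM ?permM //.
  by rewrite -imset_comp; apply: eq_imset => x /=; rewrite permM.
move=> B; case/imsetP => m; rewrite inE => Pm -> {B}.
have -> : [set m' in [set m' | P m'] | ormap_iso m m'] = [set act m p | p : {perm D}].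
  apply/setP => m'; rewrite !inE; apply/andP/imsetP => [[_ /act_iso[p ->]]|[p _ ->]].
    by exists p.
  by rewrite Pact Pm; split=> //; apply/act_iso; exists p.
rewrite card_imset; last by move=> p q; apply/act_inj/Pc.
have := card_perm [set: D]; rewrite cardsT => <-; apply: eq_card => p.
by rewrite !inE; apply/esym/subsetP => x; rewrite inE.
Qed.

End Relabelling.

Section Link.

Variables (D : finType) (V : pred (seq bool)).
Implicit Types (m : ormap D).
Local Open Scope group_scope.

(** Multiplying by the inverse of the root cycle leaves the rotation at ordinary vertices only, with
    the root half-edges fixed, as [valid] demands. *)
Definition to_state m : state D bool :=
  (vrot m * (cyc (orbit (vrot m) (root m)))^-1, flip m, [ffun z => z \in outs m],
   [:: orbit (vrot m) (root m)]).

Definition of_state x0 (st : state D bool) : ormap D :=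
  let: (p, a, lab, ss) := st in
  OrMap (p * cyc (head [::] ss)) a [set z | lab z] (head x0 (head [::] ss)).

Definition words_ok u m :=
  [/\ base m, forall x, x \notin orbit (vrot m) (root m) -> V (word m x)
    & word m (root m) = u].

Lemma of_stateK x0 : cancel to_state (of_state x0).
Proof.
case=> s a o r; rewrite /to_state /of_state /=; congr OrMap.
- by rewrite mulgKV.
- by apply/setP => z; rewrite inE ffunE.
- by rewrite orbitP_head.
Qed.

Lemma to_stateK x0 u st : u != [::] -> valid_state negb V false setT [:: u] st ->
  to_state (of_state x0 st) = st.
Proof.
case: st => [[[p a] lab] ss] u0 H; have := v_us H.
case: ss H => [|[|x s] []] //= H [uE]; first by rewrite -uE in u0.
have Us : uniq (x :: s) by have := v_uniq H; rewrite /= cats0.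
have ps : {in x :: s, forall z, p z = z} by move=> z zs; apply: (v_fixr H); rewrite /= cats0.
rewrite /to_state /= (orbit_mul_cyc Us ps) mulgK; congr (_, _, _, _).
by apply/ffunP => z; rewrite ffunE inE.
Qed.

Lemma reach_connected m (s := orbit (vrot m) (root m)) (p := vrot m * (cyc s)^-1) :
  (forall B : {set D}, B \subset setT -> stable p B -> stable (flip m) B ->
    {in flatten [:: s], forall z, z \notin B} -> B = set0) <-> map_connected m.
Proof.
have Us : uniq s := orbit_uniq _ _.
have fs : fcycle (vrot m) s by apply: cycle_orbit; exact: perm_inj.
have ps : {in s, forall z, p z = z}.
  by move=> z zs; rewrite permM -(cyc_fcycle fs Us zs) permK.
have TE : vrot m = p * cyc s by rewrite mulgKV.
have pT z : z \notin s -> vrot m z = p z by move=> zs; rewrite {1}TE mul_cyc_out.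
have rs : root m \in s := in_orbit _ _.
set e := [rel u v | (v == vrot m u) || (v == flip m u)].
have stabT (B : {set D}) : {in s, forall z, z \notin B} -> stable (vrot m) B -> stable p B.
  move=> sB TB z zB; rewrite -pT ?TB //; apply: contraTN zB; exact: sB.
have f0 : flatten [:: s] = s by rewrite /= cats0.
rewrite f0; split=> [reach|/forallP conn B _ pB aB sB].
  (* The relation [e] is directed, so two sets have to be empty: the half-edges that do not lead to
     the root and those to which the root does not lead. *)
  have B1 : [set z | ~~ connect e z (root m)] = set0.
    have TB : stable (vrot m) [set z | ~~ connect e z (root m)].
      move=> z; rewrite !inE; apply: contraNN; apply: connect_trans.
      by apply: connect1; rewrite /= eqxx.
    have sB : {in s, forall z, z \notin [set z | ~~ connect e z (root m)]}.
      move=> z zs; rewrite inE negbK.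
      have : fconnect (vrot m) z (root m).
        by rewrite fconnect_sym ?fconnect_orbit //; exact: perm_inj.
      by apply: connect_sub => u v /= /eqP <-; apply: connect1; rewrite /= eqxx.
    apply: reach; rewrite ?subsetT //; first exact: stabT.
    move=> z; rewrite !inE; apply: contraNN; apply: connect_trans.
    by apply: connect1; rewrite /= eqxx orbT.
  have B2 : [set z | ~~ connect e (root m) z] = set0.
    have sC (q : {perm D}) : (forall z, e z (q z)) -> stable q [set z | ~~ connect e (root m) z].
      move=> qe z; rewrite !inE; apply: contraNN => h.
      have sq : stable q [set z | connect e (root m) z].
        move=> w; rewrite !inE => rw; apply: (connect_trans rw). by apply: connect1; apply: qe.
      by have := @stable_inv _ q _ z sq; rewrite !inE => ->.
    have sB : {in s, forall z, z \notin [set z | ~~ connect e (root m) z]}.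
      move=> z; rewrite -fconnect_orbit inE negbK.
      by apply: connect_sub => u v /= /eqP <-; apply: connect1; rewrite /= eqxx.
    apply: reach; rewrite ?subsetT //.
      by apply: stabT => //; apply: sC => z; rewrite /= eqxx.
    by apply: sC => z; rewrite /= eqxx orbT.
  apply/forallP => x; apply/forallP => y.
  move/setP/(_ x): B1; move/setP/(_ y): B2; rewrite !inE => /negbFE h1 /negbFE h2.
  exact: connect_trans h2 h1.
apply/eqP; apply: contraT => /set0Pn[z zB].
have /forallP/(_ (root m))/connectP[t pt rE] := conn z.
have : root m \in B.
  elim: t z zB pt rE => [|w t IHt] z zB /=; first by move=> _ ->.
  case/andP => zw; apply: IHt; case/orP: zw => /eqP ->; last exact: aB.
  by rewrite pT ?pB //; apply: contraTN zB; exact: sB.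
by rewrite (negPf (sB _ rs)).
Qed.

Lemma words_okP u m : words_ok u m <-> valid_state negb V false setT [:: u] (to_state m).
Proof.
rewrite /to_state; set s := orbit _ _; set p := _ * _.
have Us : uniq s := orbit_uniq _ _.
have fs : fcycle (vrot m) s by apply: cycle_orbit; exact: perm_inj.
have ps : {in s, forall z, p z = z}.
  by move=> z zs; rewrite permM -(cyc_fcycle fs Us zs) permK.
have TE : vrot m = p * cyc s by rewrite mulgKV.
have pT z : z \notin s -> orbit p z = orbit (vrot m) z.
  move=> zs; apply/esym/eq_in_orbit; first exact: perm_inj.
  move=> w wz; rewrite {1}TE mul_cyc_out //; apply: contraNN zs => ws.
  by rewrite (fixed_orbit (ps _ ws) wz).
have lE x : map [ffun z => z \in outs m] (orbit (vrot m) x) = word m x.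
  by apply: eq_map => z; rewrite ffunE.
have f0 : flatten [:: s] = s by rewrite /= cats0.
have eulE : (forall x, flip m x != x) -> involutive (flip m) ->
    euler setT p (flip m) [:: s] = map_planar m.
  move=> h1 h2; rewrite /euler /= -TE /nn /= setCT cards0 /nilp -lt0n.
  have -> : (0 < size s)%N = true by rewrite /s orbitP_head.
  rewrite (card_porbits_matching h1 h2) /map_planar /map_vertices /map_faces /map_edges.
  move: #|_| #|_| #|_| => x y z; apply/eqP/eqP; rewrite !add0n addn0; lia.
have nT z : z \notin [set: D] -> False by rewrite inE.
split.
  case=> /and4P[/forallP fm conn plan /forallP ori] HV wu.
  have fm1 x : flip m x != x by case/andP: (fm x).
  have fm2 : involutive (flip m) by move=> x; case/andP: (fm x) => _ /eqP.
  split; rewrite ?f0 //; try by move=> z /nT.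
  - by move=> z _; rewrite inE.
  - by move=> z _; rewrite !ffunE; apply/eqP.
  - by rewrite /= lE wu.
  - by move=> z _ zs; rewrite pT // lE HV.
  - by move=> B BT pB aB sB; apply: ((reach_connected m).2 conn) => //; rewrite f0.
  - by rewrite eulE.
move=> H; have fm1 x : flip m x != x by apply: (v_neq H).
have fm2 := v_inv H.
split.
- apply/and4P; split.
  + by apply/forallP => x; rewrite fm1 fm2 eqxx.
  + by apply/reach_connected => B BT pB aB sB; apply: (v_reach H) => //.
  + by have := v_euler H; rewrite eulE.
  + by apply/forallP => x; have := v_lab H (in_setT x); rewrite !ffunE => ->.
- by move=> x xs; have := v_vert H (in_setT x); rewrite f0 => /(_ xs); rewrite pT // lE.
- by have := v_us H; rewrite /= lE => -[].
Qed.

End Link.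

Section Classes.

Variables (n : nat) (V : pred (seq bool)) (vs : nat -> bool -> seq (seq bool)).
Hypothesis V_rot : forall k w, V (rot k w) = V w.
Hypothesis vs_uniq : forall k c, uniq (vs k c).
Hypothesis vs_V : forall k c v, v \in vs k c -> V (~~ c :: v).
Hypothesis V_vs : forall k c v, size v <= k.*2 -> V (~~ c :: v) -> v \in vs k c.

Lemma enum_words u : u != [::] ->
  enumerated (@words_ok 'I_(2 * n) V u) ((n.*2)`! * M negb vs n [:: u]).
Proof.
move=> u0; have cT : #|[set: 'I_(2 * n)]| = n.*2 by rewrite cardsT card_ord mul2n.
have H := @count_valid _ _ negb V false vs negbK V_rot vs_uniq vs_V V_vs n _ [:: u] cT.
case: (posnP n) => [n0|n0].
  have nx (x : 'I_(2 * n)) : False by case: x; rewrite n0.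
  have -> : M negb vs n [:: u] = 0.
    by apply: (@M_long _ negb V vs negbK V_rot vs_uniq vs_V V_vs); rewrite n0 /= cats0; case: (u) u0.
  by rewrite muln0; apply: enumerated_empty => m _; apply: (nx (root m)).
have x0 : 'I_(2 * n) by exists 0; lia.
apply: (enumerated_bij (f := of_state x0) (g := @to_state _) _ _ _ _ H).
- by move=> st Hst; apply/words_okP; rewrite (to_stateK x0 u0 Hst).
- by move=> m /words_okP.
- by move=> st Hst; apply: to_stateK Hst.
- by move=> m _; apply: of_stateK.
Qed.

(** After multiplication by (2n)! both sides count labelled maps: as free orbits on the left, sorted
    by the word around the root vertex on the right. *)
Theorem count_classes_words (U : seq (seq bool)) (P : pred (ormap 'I_(2 * n))) :
  uniq U -> [::] \notin U ->
  (forall m, P m <-> [/\ base m, forall x, x \notin orbit (vrot m) (root m) -> V (word m x)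
    & word m (root m) \in U]) ->
  count_classes P = \sum_(u <- U) M negb vs n [:: u].
Proof.
move=> uU U0 PE.
have Pc m : P m -> map_connected m by case/PE => /and4P[].
have imp m p : P m -> P (act m p).
  case/PE => h1 h2 h3; apply/PE; split; rewrite ?base_act //; last by rewrite /= word_act.
  move=> x; rewrite -[x](permKV p) word_act /= orbit_act (mem_map perm_inj).
  exact: h2.
have Pact m p : P (act m p) = P m.
  apply/idP/idP; last exact: imp.
  move=> /(imp _ (p^-1)%g); congr (is_true (P _)).
  case: (m) => s a o r; rewrite /act /=; congr OrMap; rewrite -?conjgM ?mulgV ?conjg1 ?permK //.
  by rewrite -imset_comp (eq_imset (g := id)) ?imset_id // => x /=; rewrite permK.
have cD : #|'I_(2 * n)| = n.*2 by rewrite card_ord mul2n.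
have := card_classes Pc Pact; rewrite cD -/(count_classes P) => h.
apply/eqP; rewrite -(eqn_pmul2r (fact_gt0 n.*2)); apply/eqP.
rewrite -{}h big_distrl /=.
have enumS : enumerated (fun m => P m) #|[set m | P m]|.
  exists (enum [set m | P m]); split; rewrite ?enum_uniq // -?cardE //.
  by move=> m; rewrite mem_enum inE.
apply: enumerated_inj enumS _.
apply: (enumerated_sum (idx := fun m => word m (root m))) => // [m /PE[] //|u uU'].
rewrite [(M _ _ _ _ * _)%N]mulnC; have u0 : u != [::] by apply: contraNneq U0 => <-.
apply: enumerated_ext (enum_words u0) => m; split.
  by case=> h1 h2 h3; split=> //; apply/PE; split; rewrite ?h3.
by case=> /PE[h1 h2 h3 h4].
Qed.

End Classes.

(** * Vertex words of general and quartic orientations *)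

Section BoolWords.

Implicit Types (u v w : seq bool).

Definition balanced w := count id w == count negb w.

Lemma balanced_rot k w : balanced (rot k w) = balanced w.
Proof.
have /seq.permP pe : perm_eq (rot k w) w by rewrite perm_rot.
by rewrite /balanced !pe.
Qed.

Fixpoint words n : seq (seq bool) :=
  if n is m.+1 then map (cons true) (words m) ++ map (cons false) (words m) else [:: [::]].

Lemma mem_words n w : (w \in words n) = (size w == n).
Proof.
elim: n w => [|n IHn] [|b w] //=.
  by rewrite mem_cat; apply/orP => -[] /mapP[].
rewrite mem_cat eqSS -IHn; apply/orP/idP.
  by case=> /mapP[v vn [_ ->]].
by move=> wn; case: b; [left|right]; apply/mapP; exists w.
Qed.

Lemma words_uniq n : uniq (words n).
Proof.
elim: n => //= n IHn; rewrite cat_uniq !map_inj_uniq ?IHn ?andbT /=; try by move=> ? ? [].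
by apply/hasPn => _ /mapP[v _ ->]; apply/mapP => -[].
Qed.

Definition vs_bal n (c : bool) : seq (seq bool) :=
  flatten [seq [seq v <- words l | balanced (~~ c :: v)] | l <- iota 0 n.*2.+1].

Lemma mem_vs_bal n c v : (v \in vs_bal n c) = (size v <= n.*2) && balanced (~~ c :: v).
Proof.
apply/flatten_mapP/andP => [[l]|[vn bv]].
  by rewrite mem_iota mem_filter mem_words => /andP[_ ln] /andP[bv /eqP ->].
by exists (size v); rewrite ?mem_iota // mem_filter bv mem_words eqxx.
Qed.

Lemma vs_bal_uniq n c : uniq (vs_bal n c).
Proof.
rewrite /vs_bal; elim: (n.*2.+1) 0 => //= k IHk i.
rewrite cat_uniq filter_uniq ?words_uniq // IHk andbT /=.
apply/hasPn => v /flatten_mapP[l]; rewrite mem_iota !mem_filter !mem_words.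
by move=> /andP[il _] /andP[_ /eqP ->]; rewrite negb_and orbC; lia.
Qed.

(** The balanced words of length 4 that do not alternate; [true] stands for an outgoing
    half-edge. *)
Definition qwords : seq (seq bool) :=
  [:: [:: true; true; false; false]; [:: true; false; false; true];
      [:: false; false; true; true]; [:: false; true; true; false]].

Definition vs_q (n : nat) (c : bool) : seq (seq bool) :=
  [seq behead w | w <- qwords & head c w == ~~ c].

Lemma qwords_rot k w : (rot k w \in qwords) = (w \in qwords).
Proof.
have imp i v : v \in qwords -> rot i v \in qwords.
  by rewrite !inE => /or4P[] /eqP ->; move: i => [|[|[|[|i]]]].
by apply/idP/idP; [rewrite -{2}(rotK k w) /rotr|]; apply: imp.
Qed.

Lemma vs_q_uniq n c : uniq (vs_q n c). Proof. by case: c. Qed.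

Lemma vs_q_V n c v : v \in vs_q n c -> ~~ c :: v \in qwords.
Proof. by case: c; rewrite !inE => /orP[] /eqP ->. Qed.

Lemma V_vs_q n c v : size v <= n.*2 -> ~~ c :: v \in qwords -> v \in vs_q n c.
Proof. by move=> _; case: c; rewrite !inE => /or4P[] // /eqP[->]. Qed.

End BoolWords.

Section Eulerian.

Variable D : finType.
Implicit Types (m : ormap D).

Lemma size_word m x : size (word m x) <= #|D|.
Proof. by rewrite size_map -(card_uniqP (orbit_uniq (vrot m) x)) max_card. Qed.

Lemma word_head m x : word m x = (x \in outs m) :: behead (word m x).
Proof. by rewrite /word orbitP_head. Qed.

Lemma card_porbit_setI (s : {perm D}) (P : pred D) x (B : {set D}) : (forall z, (z \in B) = (z \in porbit s x) && P z) ->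
  #|B| = count P (orbit s x).
Proof.
move=> BE; rewrite -size_filter -(card_uniqP (filter_uniq P (orbit_uniq s x))).
by apply: eq_card => z; rewrite BE mem_filter mem_orbit_porbit andbC.
Qed.

Lemma is_eulerianP m : is_eulerian m <-> forall x, balanced (word m x).
Proof.
have E x : balanced (word m x) =
    (#|porbit (vrot m) x :&: outs m| == #|porbit (vrot m) x :\: outs m|).
  rewrite /balanced !count_map.
  rewrite (@card_porbit_setI (vrot m) (mem (outs m)) x); last by move=> z; rewrite inE.
  rewrite (@card_porbit_setI (vrot m) (predC (mem (outs m))) x) //.
  by move=> z; rewrite inE andbC.
split=> [/forall_inP h x|h]; first by rewrite E h // imset_f.
by apply/forall_inP => _ /imsetP[x _ ->]; rewrite -E.
Qed.

Lemma word_orbit m x y : y \in orbit (vrot m) x -> exists k, word m y = rot k (word m x).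
Proof.
move=> yx; have fs : fcycle (vrot m) (orbit (vrot m) x) by apply: cycle_orbit; exact: perm_inj.
have [k e] := orbit_rot_cycle fs (orbit_uniq _ _) yx.
by exists k; rewrite /word e map_rot.
Qed.

Lemma rooted_planar_EO_wordsP m : rooted_planar_EO m <->
  [/\ base m, forall x, x \notin orbit (vrot m) (root m) -> balanced (word m x)
    & balanced (word m (root m)) && head false (word m (root m))].
Proof.
split.
  case/and5P => h1 h2 h3 h4 /andP[/is_eulerianP h5 h6].
  by split; [apply/and4P|move=> x _; apply: h5|rewrite h5 word_head].
case=> /and4P[h1 h2 h3 h4] h5 /andP[h6 h7]; apply/and5P; split=> //; apply/andP; split.
  apply/is_eulerianP => x; have [xr|] := boolP (x \in orbit (vrot m) (root m)); last exact: h5.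
  by have [k ->] := word_orbit xr; rewrite balanced_rot.
by move: h7; rewrite word_head.
Qed.

Lemma word4 m x : size (word m x) = 4 ->
  orbit (vrot m) x = [:: x; vrot m x; vrot m (vrot m x); vrot m (vrot m (vrot m x))].
Proof. by rewrite size_map size_orbit /orbit => ->. Qed.

Lemma alternating4 m x : size (word m x) = 4 ->
  alternating m (porbit (vrot m) x) =
  (word m x \in [:: [:: true; false; true; false]; [:: false; true; false; true]]).
Proof.
move=> s4; have o4 := word4 s4.
have T4 : vrot m (vrot m (vrot m (vrot m x))) = x.
  by have := iter_order (@perm_inj _ (vrot m)) x; rewrite -size_orbit -(size_map (mem (outs m))) s4.
have wE : word m x = [:: x \in outs m; vrot m x \in outs m; vrot m (vrot m x) \in outs m;
    vrot m (vrot m (vrot m x)) \in outs m] by rewrite /word o4.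
rewrite wE; apply/forall_inP/idP => [h|].
  have := h x (porbit_id _ _).
  have := h (vrot m x); rewrite -mem_orbit_porbit o4 !inE eqxx orbT => /(_ isT).
  have := h (vrot m (vrot m x)); rewrite -mem_orbit_porbit o4 !inE eqxx !orbT => /(_ isT).
  by move=> /eqP -> /eqP -> /eqP ->; case: (x \in outs m).
move=> hw y; rewrite -mem_orbit_porbit o4 !inE => /or4P[] /eqP ->; move: hw; rewrite ?T4 !inE;
  by case/orP => /eqP[e0 e1 e2 e3]; rewrite ?e0 ?e1 ?e2 ?e3.
Qed.

End Eulerian.

Lemma g_M n : g n = \sum_(v <- vs_bal n false) M negb vs_bal n [:: true :: v].
Proof.
rewrite /g (@count_classes_words n balanced vs_bal balanced_rot vs_bal_uniq _ _
  [seq true :: v | v <- vs_bal n false]).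
- by rewrite big_map.
- by move=> k c v; rewrite mem_vs_bal => /andP[].
- by move=> k c v sv bv; rewrite mem_vs_bal sv bv.
- by rewrite map_inj_uniq ?vs_bal_uniq // => ? ? [].
- by apply/mapP => -[].
move=> m; rewrite rooted_planar_EO_wordsP; split=> -[h1 h2 h3]; split=> //.
  case/andP: h3 => bw; rewrite word_head => hw; have hw' : root m \in outs m by [].
  apply/mapP; exists (behead (word m (root m))); last by rewrite hw'.
  rewrite mem_vs_bal /= -[true]hw' -word_head bw andbT size_behead.
  by have := size_word m (root m); rewrite card_ord; lia.
by case/mapP: h3 => v; rewrite mem_vs_bal => /andP[_ bv] ->; rewrite bv.
Qed.

(** The root half-edge is outgoing, which leaves two of the four words of [qwords] for the root
    vertex. *)
Lemma q_M v : q v 0 = M negb vs_q (2 * v) [:: [:: true; true; false; false]]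
   + M negb vs_q (2 * v) [:: [:: true; false; false; true]].
Proof.
rewrite /q (@count_classes_words (2 * v) (mem qwords) vs_q qwords_rot vs_q_uniq vs_q_V V_vs_q
  [:: [:: true; true; false; false]; [:: true; false; false; true]]) //.
  by rewrite !big_cons big_nil addn0.
move=> m; split.
  case/and4P => /[dup] EO /rooted_planar_EO_wordsP[h1 h2 /andP[h3 h4]] /forall_inP q4 _ /eqP/cards0_eq alt0.
  have s4 x : size (word m x) = 4.
    rewrite size_map; have /eqP e4 := q4 (porbit (vrot m) x) (imset_f _ isT).
    rewrite (_ : 4 = 4%R) // -e4.
    by rewrite -(card_uniqP (orbit_uniq _ _)); apply: eq_card => y; rewrite mem_orbit_porbit.
  have na x : ~~ alternating m (porbit (vrot m) x).
    by move/setP/(_ (porbit (vrot m) x)): alt0; rewrite !inE imset_f //= => ->.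
  have bal x : balanced (word m x).
    by move: EO => /and5P[_ _ _ _ /andP[/is_eulerianP h _]].
  have wq x : word m x \in qwords.
    have := na x; rewrite alternating4 //; have := bal x; move: (word m x) (s4 x).
    by move=> [|[] [|[] [|[] [|[] []]]]].
  split=> [//|x _|]; first exact: wq.
  have := wq (root m); move: h4; move: (word m (root m)).
  by move=> w; rewrite !inE => hw /or4P[] /eqP e; move: hw; rewrite e ?eqxx ?orbT.
case=> h1 h2 h3; have wq x : word m x \in qwords.
  have [xr|] := boolP (x \in orbit (vrot m) (root m)); last exact: h2.
  have [k ->] := word_orbit xr; rewrite qwords_rot.
  by move: h3; rewrite !inE => /orP[] ->; rewrite ?orbT.
have s4 x : size (word m x) = 4 by have := wq x; rewrite !inE => /or4P[] /eqP ->.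
have p4 x : #|porbit (vrot m) x| = 4.
  rewrite -(s4 x) size_map -(card_uniqP (orbit_uniq _ _)); apply: eq_card => y.
  by rewrite mem_orbit_porbit.
apply/and4P; split.
- apply/rooted_planar_EO_wordsP; split=> //.
    by move=> x _; have := wq x; rewrite !inE => /or4P[] /eqP ->.
  by move: h3; rewrite !inE => /orP[] /eqP ->.
- by apply/forall_inP => _ /imsetP[x _ ->]; rewrite p4.
- have := card_porbits_uniform p4; have -> : #|'I_(2 * (2 * v))| = 2 * (2 * v) by rewrite card_ord.
  by rewrite /map_vertices; move: #|_| => k e; apply/eqP; lia.
- rewrite cards_eq0; apply/eqP/setP => B; rewrite !inE; apply/negP => /andP[/imsetP[x _ ->]].
  by rewrite alternating4 //; have := wq x; rewrite !inE => /or4P[] /eqP ->.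
Qed.

Local Open Scope ring_scope.

(** * Composition of series *)

Section Composition.

Variable A : comNzRingType.
Implicit Types (F H R : fser A) (n m : nat).

Definition fconst (c : A) : fser A := Fser (fun n => if n == 0%N then c else 0).

Lemma cf_constM c F n : coefs (fconst c * F) n = c * coefs F n.
Proof.
rewrite cfM big_ord_recl /= subn0 big1 ?addr0 // => i _.
by rewrite mul0r.
Qed.

Lemma fconstD : {morph fconst : c d / c + d}.
Proof. by move=> c d; apply: fserP => -[|n] //; rewrite cfD; apply/esym/addr0. Qed.

Lemma fconst_is_zmod_morphism : zmod_morphism fconst.
Proof. by move=> c d; apply: fserP => -[|n] //; rewrite cfB; apply/esym/subr0. Qed.

Lemma fconst_is_monoid_morphism : monoid_morphism fconst.
Proof.
split; first by apply: fserP => -[|n].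
by move=> c d; apply: fserP => n; rewrite cf_constM /=; case: eqP => // _; rewrite mulr0.
Qed.

HB.instance Definition _ := GRing.isZmodMorphism.Build A (fser A) fconst fconst_is_zmod_morphism.
HB.instance Definition _ := GRing.isMonoidMorphism.Build A (fser A) fconst fconst_is_monoid_morphism.

(* Composition is meaningful when the constant coefficient of [R] is 0; the
   partial sum below is then long enough. *)
Definition comp F R : fser A :=
  Fser (fun m => coefs (\sum_(i < m.+1) fconst (coefs F i) * R ^+ i) m).

Lemma cf_comp F R m :
  coefs (comp F R) m = coefs (\sum_(i < m.+1) fconst (coefs F i) * R ^+ i) m.
Proof. by []. Qed.

Lemma eqs_exp R k : coefs R 0%N = 0 -> eqs k (R ^+ k) 0.
Proof.
move=> R0; have R1 : eqs 1 R 0 by move=> [].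
by elim: k => [|k IHk] //; rewrite exprS -add1n; apply: eqsM0.
Qed.

Lemma eqs_part R F n N : coefs R 0%N = 0 -> (n <= N)%N ->
  eqs n (\sum_(i < N) fconst (coefs F i) * R ^+ i) (\sum_(i < n) fconst (coefs F i) * R ^+ i).
Proof.
move=> R0 nN m mn; rewrite -(subnKC nN) big_split_ord cfD /= [X in _ + X](_ : _ = 0) ?addr0 //.
rewrite cf_sum big1 // => i _; rewrite cf_constM.
by rewrite (eqs_exp R0) ?mulr0 //; lia.
Qed.

Lemma comp_part F R n : coefs R 0%N = 0 ->
  eqs n (comp F R) (\sum_(i < n) fconst (coefs F i) * R ^+ i).
Proof. by move=> R0 m mn; apply/esym/eqs_part. Qed.

Lemma comp_eqs n F H R : coefs R 0%N = 0 -> eqs n F H -> eqs n (comp F R) (comp H R).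
Proof.
move=> R0 FH; apply: eqs_trans (@comp_part F _ n R0) _.
refine (eqs_trans _ (eqs_sym (@comp_part H _ n R0))).
by rewrite (eq_bigr (fun i : 'I_n => fconst (coefs H i) * R ^+ i)) // => i _; rewrite FH.
Qed.

Lemma compD F H R : coefs R 0%N = 0 -> comp (F + H) R = comp F R + comp H R.
Proof.
move=> R0; apply: fserP => m; rewrite cfD /= -cfD -big_split; congr (coefs _ m).
by apply: eq_bigr => i _; rewrite ?cfD fconstD mulrDl.
Qed.

Lemma compN F R : coefs R 0%N = 0 -> comp (- F) R = - comp F R.
Proof.
move=> R0; apply: fserP => m; rewrite cfN /= -cfN -sumrN; congr (coefs _ m).
by apply: eq_bigr => i _; rewrite ?cfN rmorphN mulNr.
Qed.

Lemma comp0 R : comp 0 R = 0.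
Proof.
apply: fserP => m /=; rewrite big1 // => i _.
by rewrite rmorph0 mul0r.
Qed.

Lemma comp1 R : comp 1 R = 1.
Proof.
apply: fserP => m /=; rewrite big_ord_recl big1 ?addr0; last first.
  by move=> i _; rewrite ?cf1 /= rmorph0 mul0r.
by rewrite ?cf1 rmorph1 mul1r expr0.
Qed.

Lemma comp_sum (I : Type) (r : seq I) (F : I -> fser A) R : coefs R 0%N = 0 ->
  comp (\sum_(i <- r) F i) R = \sum_(i <- r) comp (F i) R.
Proof.
move=> R0; elim: r => [|i r IHr]; first by rewrite !big_nil comp0.
by rewrite !big_cons compD // IHr.
Qed.

Lemma eqs_horner (p : {poly A}) R n : coefs R 0%N = 0 ->
  eqs n (map_poly fconst p).[R] (\sum_(i < n) fconst p`_i * R ^+ i).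
Proof.
move=> R0; pose N := maxn n (size p).
have -> : (map_poly fconst p).[R] = \sum_(i < N) fconst p`_i * R ^+ i.
  rewrite (@horner_coef_wide _ N); last first.
    by rewrite (leq_trans (size_poly _ _)) // leq_maxr.
  by apply: eq_bigr => i _; rewrite coef_map.
have -> : \sum_(i < N) fconst p`_i * R ^+ i =
    \sum_(i < N) fconst (coefs (Fser (nth 0 p)) i) * R ^+ i by [].
by apply: eqs_part; rewrite ?leq_maxl.
Qed.

Lemma compM F H R : coefs R 0%N = 0 -> comp (F * H) R = comp F R * comp H R.
Proof.
move=> R0; apply: eqs_eq => n.
have hF (K : fser A) : eqs n (comp K R) (map_poly fconst (trunc n K)).[R].
  apply: eqs_trans (@comp_part K _ n R0) _; refine (eqs_trans _ (eqs_sym (@eqs_horner _ _ n R0))).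
  by rewrite (eq_bigr (fun i : 'I_n => fconst (trunc n K)`_i * R ^+ i)) // => i _; rewrite coef_trunc.
apply: eqs_trans (_ : eqs n _ ((map_poly fconst (trunc n F)).[R] * (map_poly fconst (trunc n H)).[R])) _; last first.
  by apply: eqsM; apply: eqs_sym.
rewrite -hornerM -rmorphM /=.
apply: eqs_trans (@comp_part _ _ n R0) _; refine (eqs_trans _ (eqs_sym (@eqs_horner _ _ n R0))).
rewrite (eq_bigr (fun i : 'I_n => fconst (trunc n F * trunc n H)`_i * R ^+ i)) // => i _.
by rewrite -(fser_mul_trunc _ _ (ltn_ord i)).
Qed.

Lemma compX R : coefs R 0%N = 0 -> comp X R = R.
Proof.
move=> R0; apply: fserP => -[|m]; rewrite cf_comp.
  by rewrite big_ord1 cf_constM mul0r R0.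
rewrite !big_ord_recl big1 ?addr0; last by move=> i _; rewrite [coefs _ _]/= rmorph0 mul0r.
by rewrite cfD !cf_constM mul0r add0r mul1r.
Qed.

Lemma comp_exp F R k : coefs R 0%N = 0 -> comp (F ^+ k) R = comp F R ^+ k.
Proof. by move=> R0; elim: k => [|k IHk]; rewrite ?comp1 // !exprS compM // IHk. Qed.

Lemma comp_const c R : comp (fconst c) R = fconst c.
Proof.
apply: fserP => m /=; rewrite big_ord_recl big1 ?addr0; last first.
  by move=> i _; rewrite /= rmorph0 mul0r.
by rewrite expr0 mulr1.
Qed.

Lemma comp_assoc F H R : coefs H 0%N = 0 -> coefs R 0%N = 0 ->
  comp (comp F H) R = comp F (comp H R).
Proof.
move=> H0 R0; have HR0 : coefs (comp H R) 0%N = 0.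
  by rewrite /= big_ord1 H0 rmorph0 mul0r.
apply: eqs_eq => n; apply: eqs_trans (comp_eqs R0 (@comp_part F _ n H0)) _.
rewrite comp_sum //; refine (eqs_trans _ (eqs_sym (@comp_part F _ n HR0))).
rewrite (eq_bigr (fun i : 'I_n => fconst (coefs F i) * comp H R ^+ i)) // => i _.
by rewrite compM // comp_const comp_exp.
Qed.

Definition str p F := comp F (X ^+ p).

Lemma cf_str p F n : (0 < p)%N -> coefs (str p F) n = if (p %| n)%N then coefs F (n %/ p) else 0.
Proof.
move=> p0; rewrite /= cf_sum.
have E (i : 'I_n.+1) : coefs (fconst (coefs F i) * (X ^+ p) ^+ i) n = if n == (p * i)%N then coefs F i else 0.
  by rewrite cf_constM -exprM cfXn; case: eqP; rewrite (mulr1, mulr0).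
rewrite (eq_bigr _ (fun i _ => E i)); have [/dvdnP[k ->]|pn] := boolP (p %| n)%N.
  rewrite mulnK // -big_mkcond /=.
  have kn : (k < (k * p).+1)%N by rewrite ltnS leq_pmulr.
  rewrite (big_pred1 (Ordinal kn)) // => i; apply/eqP/eqP => [e|->]; last exact: mulnC.
  by apply/val_inj/eqP; rewrite -(eqn_pmul2l p0) /= -e mulnC.
rewrite big1 // => i _; case: eqP => // e; case/negP: pn; rewrite e; exact: dvdn_mulr.
Qed.

End Composition.

(** * General and quartic orientations *)

Section InfiniteSums.

Variable A : comNzRingType.
Implicit Types (g : nat -> fser A) (F : fser A).

Definition fsum g : fser A := Fser (fun k => coefs (\sum_(m < k.+1) X ^+ m * g m) k).

Lemma fsum_part n g : eqs n (fsum g) (\sum_(m < n) X ^+ m * g m).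
Proof.
move=> k kn; rewrite [LHS]/=; have -> : n = (k.+1 + (n - k.+1))%N by lia.
rewrite big_split_ord cfD /= [X in _ + X](_ : _ = 0) ?addr0 //.
by rewrite cf_sum big1 // => i _; rewrite cfXnM; case: ltnP => //; lia.
Qed.

Lemma fsum_unique F g : (forall n, eqs n F (\sum_(m < n) X ^+ m * g m)) -> F = fsum g.
Proof.
move=> h; apply: eqs_eq => n; apply: eqs_trans (h n) _.
exact/eqs_sym/fsum_part.
Qed.

Lemma fsum_recl g : fsum g = g 0%N + X * fsum (fun m => g m.+1).
Proof.
apply/esym/fsum_unique => -[//|n]; rewrite big_ord_recl mul1r; apply: eqsD => //.
under eq_bigr => i _ do rewrite lift0 exprS -mulrA.
rewrite -mulr_sumr; apply: eqsX; exact: fsum_part.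
Qed.

Lemma fsumD g h : fsum g + fsum h = fsum (fun m => g m + h m).
Proof.
apply: fsum_unique => n; under eq_bigr => i _ do rewrite mulrDr.
by rewrite big_split; apply: eqsD; apply: fsum_part.
Qed.

Lemma eq_fsum g h : (forall m, g m = h m) -> fsum g = fsum h.
Proof. by move=> gh; apply: fsum_unique => n k kn; rewrite (@fsum_part n) //; congr (coefs _ k); apply: eq_bigr => i _; rewrite gh. Qed.

Lemma eqs_fsum0 n g : (forall m, eqs n (g m) 0) -> eqs n (fsum g) 0.
Proof.
move=> h; apply: (eqs_trans (@fsum_part n g)) => k kn; rewrite cf_sum big1 // => i _.
by rewrite cfXnM; case: ltnP => // _; rewrite h //; lia.
Qed.

End InfiniteSums.

Section Splitting.

Variables (L : eqType) (W : zmodType).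
Implicit Types (u v : seq L) (g : seq L -> seq L -> W).

Definition Spl c g u := \sum_(w <- wsplits c u) g w.1 w.2.

Lemma Spl_nil c g : Spl c g [::] = 0.
Proof. by rewrite /Spl big_nil. Qed.

Lemma Spl_cons c g b u :
  Spl c g (b :: u) = (if b == c then g [::] u else 0) + Spl c (fun a r => g (b :: a) r) u.
Proof. by rewrite /Spl /= big_cat big_map; case: eqP => _; rewrite ?big_seq1 ?big_nil. Qed.

Lemma Spl_cat c g u v :
  Spl c g (u ++ v) = Spl c (fun a r => g a (r ++ v)) u + Spl c (fun a r => g (u ++ a) r) v.
Proof.
elim: u g => [|b u IHu] g; first by rewrite Spl_nil add0r.
by rewrite cat_cons !Spl_cons IHu addrA.
Qed.

Lemma eq_Spl c g g' u : (forall a r, u = a ++ c :: r -> g a r = g' a r) -> Spl c g u = Spl c g' u.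
Proof. by move=> e; apply: eq_big_seq => w /wsplitsP /e. Qed.

Lemma Spl0 c g u : (forall a r, u = a ++ c :: r -> g a r = 0) -> Spl c g u = 0.
Proof. by move=> e; rewrite /Spl big_seq big1 // => w /wsplitsP /e. Qed.

Lemma SplD c g g' u : Spl c g u + Spl c g' u = Spl c (fun a r => g a r + g' a r) u.
Proof. by rewrite /Spl big_split. Qed.

Lemma SplN c g u : - Spl c g u = Spl c (fun a r => - g a r) u.
Proof. by rewrite /Spl sumrN. Qed.

End Splitting.

Lemma SplM (L : eqType) (R : comNzRingType) c (x : R) g (u : seq L) :
  x * Spl c g u = Spl c (fun a r => x * g a r) u.
Proof. by rewrite /Spl mulr_sumr. Qed.

Definition EG : seq bool -> fser rat := wser negb vs_bal.
Definition EQ : seq bool -> fser rat := wser negb vs_q.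

Section EGfacts.

Let V_vs n c v : (size v <= n.*2)%N -> balanced (~~ c :: v) -> v \in vs_bal n c.
Proof. by move=> h1 h2; rewrite mem_vs_bal h1. Qed.
Let vs_V n c v : v \in vs_bal n c -> balanced (~~ c :: v).
Proof. by rewrite mem_vs_bal => /andP[]. Qed.

Lemma EG_nil : EG [::] = 1.
Proof. exact: wser0. Qed.

Lemma EG_cons c u : EG (c :: u) =
  X * (Spl (~~ c) (fun a r => EG a * EG r) u + mser_vert negb vs_bal c u [::]).
Proof. exact: (wser_cons negbK balanced_rot vs_bal_uniq vs_V V_vs). Qed.

Lemma EG_catC u v : EG (u ++ v) = EG (v ++ u).
Proof. exact: (wser_catC negbK balanced_rot vs_bal_uniq vs_V V_vs). Qed.

Lemma EG_long k u : (k.*2 <= (size u).+1)%N -> eqs k (EG u) 0.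
Proof. exact: (wser_long negbK balanced_rot vs_bal_uniq vs_V V_vs). Qed.

End EGfacts.

Definition excess (u : seq bool) : int := (count negb u)%:Z - (count id u)%:Z.

Lemma excess_cat u v : excess (u ++ v) = excess u + excess v.
Proof. by rewrite /excess !count_cat; lia. Qed.

Lemma excess_cons b u : excess (b :: u) = (if b then -1 else 1) + excess u.
Proof. by rewrite -cat1s excess_cat; case: b. Qed.

Lemma excess0 u : (excess u == 0) = balanced u.
Proof. by rewrite /excess /balanced subr_eq0 eq_sym. Qed.

Lemma EG_charge u : excess u != 0 -> EG u = 0.
Proof.
apply: (@wser_charge _ negb balanced vs_bal _ excess) => //.
- by move=> n c v; rewrite mem_vs_bal => /andP[].
- exact: excess_cat.
- by case.
- by move=> v; rewrite -excess0 => /eqP.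
Qed.

Section EQfacts.

Lemma EQ_nil : EQ [::] = 1.
Proof. exact: wser0. Qed.

Lemma EQ_f u : EQ (false :: u) = X * (Spl true (fun a r => EQ a * EQ r) u +
   (EQ [:: true, false, false & u] + EQ [:: false, false, true & u])).
Proof.
rewrite [LHS](wser_cons negbK qwords_rot vs_q_uniq vs_q_V V_vs_q).
rewrite (mser_vert_const negb _ _ _ (l := [:: [:: true; false; false]; [:: false; false; true]])) //.
by rewrite !big_cons big_nil addr0.
Qed.

Lemma EQ_t u : EQ (true :: u) = X * (Spl false (fun a r => EQ a * EQ r) u +
   (EQ [:: false, true, true & u] + EQ [:: true, true, false & u])).
Proof.
rewrite [LHS](wser_cons negbK qwords_rot vs_q_uniq vs_q_V V_vs_q).
rewrite (mser_vert_const negb _ _ _ (l := [:: [:: false; true; true]; [:: true; true; false]])) //.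
by rewrite !big_cons big_nil addr0.
Qed.

Lemma EQ_catC u v : EQ (u ++ v) = EQ (v ++ u).
Proof. exact: (wser_catC negbK qwords_rot vs_q_uniq vs_q_V V_vs_q). Qed.

Lemma EQ_long k u : (k.*2 <= (size u).+1)%N -> eqs k (EQ u) 0.
Proof. exact: (wser_long negbK qwords_rot vs_q_uniq vs_q_V V_vs_q). Qed.

Lemma EQ_charge u : excess u != 0 -> EQ u = 0.
Proof.
apply: (@wser_charge _ negb (mem qwords) vs_q vs_q_V excess) => //.
- exact: excess_cat.
- by case.
- by move=> v; rewrite /= !inE => /or4P[] /eqP ->.
Qed.

End EQfacts.

Lemma Spl_subX (L : eqType) (R : comNzRingType) c (x : R) (g g' : seq L -> seq L -> R) u :
  Spl c (fun a r => g a r - x * g' a r) u = Spl c g u - x * Spl c g' u.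
Proof. by rewrite SplM SplN SplD. Qed.

Section Twist.

Implicit Types (f g : seq bool -> fser rat) (u w : seq bool).

(* Substitution of [- - X (- - +)] for each minus sign ([false]) of [u]. *)
Fixpoint tw f u : fser rat :=
  match u with
  | [::] => f [::]
  | true :: u' => tw (fun w => f (true :: w)) u'
  | false :: u' => tw (fun w => f (false :: w)) u' - X * tw (fun w => f [:: false, false, true & w]) u'
  end.

Lemma eq_tw f g u : f =1 g -> tw f u = tw g u.
Proof. by move=> /funext ->. Qed.

Lemma tw_eqs n f u : (forall w, (size u <= size w)%N -> eqs n (f w) 0) -> eqs n (tw f u) 0.
Proof.
elim: u f => [|[] u IHu] f h /=; first exact: h.
  by apply: IHu => w sw; apply: h.
rewrite -(subr0 0); apply: eqsB; first by apply: IHu => w sw; apply: h.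
rewrite -(mulr0 X); apply: eqsM => //; apply: IHu => w sw; apply: h => /=; lia.
Qed.

Lemma twD f g u : tw (fun w => f w + g w) u = tw f u + tw g u.
Proof. by elim: u f g => [|[] u IHu] f g //=; rewrite !IHu //; ring. Qed.

Lemma twZ x f u : tw (fun w => x * f w) u = x * tw f u.
Proof. by elim: u f => [|[] u IHu] f //=; rewrite !IHu //; ring. Qed.

Lemma twB f g u : tw (fun w => f w - g w) u = tw f u - tw g u.
Proof.
rewrite -[- tw g u]mulN1r -twZ -twD; apply: eq_tw => w; ring.
Qed.

Lemma twZr x f u : tw (fun w => f w * x) u = tw f u * x.
Proof. by rewrite mulrC -twZ; apply: eq_tw => w; rewrite mulrC. Qed.

Lemma tw_cat f u v : tw f (u ++ v) = tw (fun w => tw (fun w' => f (w ++ w')) v) u.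
Proof. by elim: u f => [|[] u IHu] f //=; rewrite !IHu. Qed.

Lemma tw_swap (f : seq bool -> seq bool -> fser rat) u v :
  tw (fun w => tw (f w) v) u = tw (fun w' => tw (f^~ w') u) v.
Proof.
elim: u f => [|[] u IHu] f /=; [exact: eq_tw|exact: (IHu (fun w => f (true :: w)))|].
rewrite (IHu (fun w => f (false :: w))) (IHu (fun w => f [:: false, false, true & w])).
by rewrite -twZ -twB.
Qed.

Lemma tw_mul f g u v : tw (fun w => tw (fun w' => f w * g w') v) u = tw f u * tw g v.
Proof. by rewrite -twZr; apply: eq_tw => w; rewrite twZ. Qed.

Lemma tw_charge f u : (forall w, excess w = excess u -> f w = 0) -> tw f u = 0.
Proof.
elim: u f => [|[] u IHu] f h /=; first by apply: h.
  by apply: IHu => w e; apply: h; rewrite !excess_cons e.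
rewrite !IHu ?mulr0 ?subrr // => w e; apply: h; rewrite !excess_cons e; lia.
Qed.

(** A letter [true] of the substituted word is a letter of [u] or the end of an inserted block; in
    the latter case the two preceding letters [false] of the block stay in the left part. *)
Lemma tw_Spl_t (g : seq bool -> seq bool -> fser rat) u :
  tw (fun w => Spl true g w) u =
  Spl true (fun a r => tw (fun w => tw (g w) r) a) u
  - X * Spl false (fun a r => tw (fun w => tw (g (w ++ [:: false; false])) r) a) u.
Proof.
elim: u g => [|b u IHu] g; first by rewrite /= !Spl_nil mulr0 subrr.
have E : (fun w => Spl true g (true :: w)) = (fun w => g [::] w + Spl true (fun a r => g (true :: a) r) w).
  by apply/funext => w; rewrite Spl_cons.
have E1 : (fun w => Spl true g (false :: w)) = (fun w => Spl true (fun a r => g (false :: a) r) w).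
  by apply/funext => w; rewrite Spl_cons add0r.
have E2 : (fun w => Spl true g [:: false, false, true & w]) =
    (fun w => g [:: false; false] w + Spl true (fun a r => g [:: false, false, true & a] r) w).
  by apply/funext => w; rewrite !Spl_cons !add0r.
case: b => /=; rewrite ?E ?E1 ?E2 ?twD !IHu !Spl_cons /=; first by rewrite add0r; ring.
by rewrite !Spl_subX !add0r; ring.
Qed.

(** The letter [false] at which the word is cut is a single one or one of the two in an inserted
    block, whose other letters go to the side on which they stand. *)
Lemma tw_Spl_f (g : seq bool -> seq bool -> fser rat) u :
  tw (fun w => Spl false g w) u =
  Spl false (fun a r => tw (fun w => tw (fun w' =>
    g w w' - X * (g w [:: false, true & w'] + g (w ++ [:: false]) (true :: w'))) r) a) u.
Proof.
elim: u g => [|b u IHu] g; first by rewrite /= !Spl_nil.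
have E : (fun w => Spl false g (true :: w)) = (fun w => Spl false (fun a r => g (true :: a) r) w).
  by apply/funext => w; rewrite Spl_cons add0r.
have E1 : (fun w => Spl false g (false :: w)) = (fun w => g [::] w + Spl false (fun a r => g (false :: a) r) w).
  by apply/funext => w; rewrite Spl_cons.
have E2 : (fun w => Spl false g [:: false, false, true & w]) =
    (fun w => g [::] [:: false, true & w] + (g [:: false] (true :: w)
      + Spl false (fun a r => g [:: false, false, true & a] r) w)).
  by apply/funext => w; rewrite !Spl_cons /= add0r.
case: b => /=; first by rewrite E IHu Spl_cons add0r.
rewrite E1 E2 !twD !IHu Spl_cons /= Spl_subX.
by rewrite twB twZ twD; ring.
Qed.

End Twist.

(** * Peeling a minus sign in the substituted word *)

Section Telescope.

(** Records the vertices met when a half-edge [true] is peeled repeatedly: its vertex term with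
    [true, true, false] leaves one more [true] behind, and the one with [false, true, true] leaves
    [false, true]. *)
Definition enc (b : seq bool) : seq bool := flatten [seq if x then [:: true] else [:: false; true] | x <- b].

Lemma enc_rcons b x : enc (rcons b x) = enc b ++ (if x then [:: true] else [:: false; true]).
Proof. by rewrite /enc map_rcons flatten_rcons. Qed.

Lemma excess_enc b : excess (enc b) = - (count id b)%:Z.
Proof. by elim: b => [|[] b IHb] //; rewrite /= !excess_cons -/(enc b) IHb /=; lia. Qed.

Lemma enc_suffix b a r : enc b = a ++ false :: r -> excess r < 0.
Proof.
elim: b a => [|x b IHb] [|y a] //=; rewrite -/(enc b); case: x => //=.
- by case=> <-; rewrite excess_cons excess_enc; lia.
- by case=> _ /IHb.
by case=> _; case: a => //= _ a [_ /IHb].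
Qed.

Lemma big_words_cons (R : nmodType) n (f : seq bool -> R) :
  \sum_(b <- words n.+1) f b =
  \sum_(b <- words n) f (true :: b) + \sum_(b <- words n) f (false :: b).
Proof. by rewrite /= big_cat !big_map. Qed.

Lemma big_words_rcons (R : nmodType) n (f : seq bool -> R) :
  \sum_(b <- words n.+1) f b = \sum_(b <- words n) (f (rcons b true) + f (rcons b false)).
Proof.
elim: n f => [|n IHn] f; first by rewrite /= !big_cons !big_nil !addr0.
by rewrite big_words_cons (IHn (fun b => f (true :: b))) (IHn (fun b => f (false :: b))) [RHS]big_words_cons.
Qed.

Variable u : seq bool.

Definition ctx_main b := tw (fun w => EQ (enc b ++ nseq (count id b).+1 false ++ w)) u.
Definition ctx_loop b := tw (fun w => EQ (enc b ++ true :: nseq (count id b).+2 false ++ w)) u.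
Definition ctx_split b := Spl false (fun a r =>
  tw (fun w => EQ (nseq (count id b).+2 false ++ w)) a * tw (fun w => EQ (w ++ enc b)) r) u.

(** The [true] in front of the run of [false] is peeled. Charge kills all loops except the one to
    the next letter, which gives [ctx_main], and those into the context; there the inserted blocks
    produce exactly the [ctx_split] terms of the two longer words. *)
Lemma ctx_loop_rec b : ctx_loop b = X * (ctx_main b +
  (ctx_split b - X * (ctx_split (rcons b true) + ctx_split (rcons b false))) +
  (ctx_loop (rcons b true) + ctx_loop (rcons b false))).
Proof.
set k := count id b.
have cr x : count id (rcons b x) = (k + x)%N by rewrite -cats1 count_cat /= addn0.
have E w : EQ (enc b ++ true :: nseq k.+2 false ++ w) =
    X * (EQ (enc b ++ nseq k.+1 false ++ w) +
     Spl false (fun a r => EQ (nseq k.+2 false ++ a) * EQ (r ++ enc b)) w +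
     (EQ (enc (rcons b true) ++ true :: nseq (count id (rcons b true)).+2 false ++ w) +
      EQ (enc (rcons b false) ++ true :: nseq (count id (rcons b false)).+2 false ++ w))).
  rewrite EQ_catC cat_cons EQ_t; congr (X * (_ + _)); last first.
    rewrite !cr addn0 addn1 !enc_rcons -!catA addrC; congr (_ + _).
      by rewrite [RHS]EQ_catC /= -catA.
    by rewrite [RHS]EQ_catC /= -catA.
  rewrite -catA Spl_cat Spl_cat [X in _ + (_ + X)]Spl0 ?addr0; last first.
    move=> a r /enc_suffix er; rewrite [X in _ * X]EQ_charge ?mulr0 //.
    by apply: contraTneq er => ->.
  congr (_ + _).
  rewrite Spl_cons /= EQ_nil mul1r Spl0 ?addr0.
    by rewrite [RHS]EQ_catC /= -catA.
  move=> a r e; rewrite EQ_charge ?mul0r // excess_cons.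
  suff : 0 <= excess a by lia.
  have : all negb (a ++ false :: r) by rewrite -e /= all_nseq orbT.
  by rewrite all_cat /excess => /andP[+ _]; elim: (a) => //= x a' IHa /andP[/negPf-> /IHa] /=; lia.
rewrite /ctx_loop -/k (eq_tw u E) twZ !twD tw_Spl_f; congr (X * (_ + _ + _)).
rewrite /ctx_split !cr addn0 addn1 SplD -Spl_subX; apply: eq_Spl => a r _.
rewrite -!tw_mul -twD -twZ -twB; apply: eq_tw => w.
rewrite -twD -twZ -twB; apply: eq_tw => w'; rewrite !enc_rcons.
have -> : EQ ((nseq k.+2 false) ++ w ++ [:: false]) = EQ (nseq k.+3 false ++ w).
  by rewrite catA EQ_catC.
have -> : EQ ([:: false, true & w'] ++ enc b) = EQ (w' ++ enc b ++ [:: false; true]).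
  by rewrite [w' ++ _]catA [RHS]EQ_catC.
have -> : EQ ((true :: w') ++ enc b) = EQ (w' ++ enc b ++ [:: true]).
  by rewrite [w' ++ _]catA [RHS]EQ_catC.
by congr (_ - _ * _); rewrite addrC.
Qed.

Definition wsum (f : seq bool -> fser rat) m := \sum_(b <- words m) f b.

(** Summed over all words with a weight X per letter, the [ctx_split] terms telescope and only that
    of the empty word survives. *)
Lemma ctx_loop0 : ctx_loop [::] =
  X * (fsum (wsum ctx_main) + ctx_split [::]).
Proof.
have rec m : wsum ctx_loop m = X * (wsum ctx_main m + (wsum ctx_split m - X * wsum ctx_split m.+1) + wsum ctx_loop m.+1).
  rewrite /wsum !big_words_rcons.
  rewrite mulr_sumr -sumrB -!big_split mulr_sumr; apply: eq_bigr => b _.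
  exact: ctx_loop_rec.
have S0 f : wsum f 0%N = f [::] by rewrite /wsum big_seq1.
have H n : wsum ctx_loop 0%N = X * (\sum_(m < n) X ^+ m * wsum ctx_main m + wsum ctx_split 0%N)
    + X ^+ n * (wsum ctx_loop n - X * wsum ctx_split n).
  elim: n => [|n IHn]; first by rewrite big_ord0; ring.
  rewrite IHn big_ord_recr /= (rec n) exprS; ring.
rewrite -!S0; apply: eqs_eq => n; rewrite (H n) -[X * (fsum _ + _)]addr0; apply: eqsD; last exact: eqsXn0.
by apply: eqsM => //; apply: eqsD => //; apply/eqs_sym/fsum_part.
Qed.

(** Two cancellations justify the substitution: the vertex term [false, false, true] of [EQ_f]
    cancels the inserted block, and the loops that end in inserted blocks cancel [ctx_split
    [::]]. *)
Lemma tw_EQ_f : tw EQ (false :: u) =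
  X * (Spl true (fun a r => tw EQ a * tw EQ r) u + X * fsum (wsum ctx_main)).
Proof.
have E : (fun w => EQ (false :: w)) = (fun w => X * (Spl true (fun a r => EQ a * EQ r) w +
   (EQ [:: true, false, false & w] + EQ [:: false, false, true & w]))).
  by apply/funext => w; apply: EQ_f.
have l0 : tw (fun w => EQ [:: true, false, false & w]) u = ctx_loop [::] by [].
rewrite /= E twZ !twD tw_Spl_t l0 ctx_loop0 /ctx_split /=.
under [Spl true _ u]eq_Spl => a r _ do rewrite tw_mul.
have -> : Spl false (fun a r => tw (fun w => tw (fun w' => EQ (w ++ [:: false; false]) * EQ w') r) a) u =
    Spl false (fun a r => tw (fun w => EQ [:: false, false & w]) a * tw (fun w => EQ (w ++ [::])) r) u.
  apply: eq_Spl => a r _; rewrite tw_mul; congr (_ * _); apply: eq_tw => w; first exact: EQ_catC.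
  by rewrite cats0.
ring.
Qed.

End Telescope.

(** * Substituted words of given excess *)

Section Unfolding.

Variable u : seq bool.

Definition ectx (y : seq bool) := tw (fun w => EQ (y ++ w)) u.

Lemma ectx_long k y : (k.*2 <= (size y).+1)%N -> eqs k (ectx y) 0.
Proof. by move=> h; apply: tw_eqs => w _; apply: EQ_long; rewrite size_cat; lia. Qed.

(** In noncommuting letters t and f, the sum over all words in X t and f - X f f t is the inverse of
    1 - X t - f + X f f t = (1 - f)(1 - X (t + f t)). It is therefore the sum of X^|b| [enc b] f^i
    over all b and i. The part of excess [j] is the one where i is [j] plus the number of [true] in
    [b]. *)
Definition uterm (j : int) y b : fser rat :=
  if 0 <= j + (count id b)%:Z then
    ectx (y ++ enc b ++ nseq (absz (j + (count id b)%:Z)) false) else 0.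

Definition useries j y := fsum (wsum (uterm j y)).

Lemma useries_step j y : useries j y =
  (if 0 <= j then ectx (y ++ nseq (absz j) false) else 0)
  + X * (useries (j + 1) (y ++ [:: true]) + useries j (y ++ [:: false; true])).
Proof.
rewrite /useries fsum_recl fsumD; congr (_ + X * _).
  by rewrite /wsum big_seq1 /uterm addr0.
apply: eq_fsum => m; rewrite /wsum big_words_cons; congr (_ + _); apply: eq_bigr => b _.
  by rewrite /uterm -addrA PoszD /= -!catA.
by rewrite /uterm /= ?add0n -!catA.
Qed.

Lemma useries_rec j y : useries j y = (if j == 0 then ectx y else 0)
  + X * useries (j + 1) (y ++ [:: true])
  + (useries (j - 1) (y ++ [:: false]) - X * useries (j - 1) (y ++ [:: false; false; true])).
Proof.
rewrite (useries_step j) (useries_step (j - 1)) subrK -!catA /=.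
have -> : (if 0 <= j then ectx (y ++ nseq (absz j) false) else 0) = (if j == 0 then ectx y else 0)
   + (if 0 <= j - 1 then ectx (y ++ false :: nseq (absz (j - 1)%R) false) else 0); last by ring.
have [->|j0] := eqVneq j 0; first by rewrite /= cats0 addr0.
rewrite add0r; have -> : (0 <= j) = (0 <= j - 1) by lia.
by case: ifP => // j1; have -> : absz j = (absz (j - 1)%R).+1 by lia.
Qed.

Fixpoint upart (l : nat) (j : int) y : fser rat :=
  if l is l'.+1 then (if j == 0 then ectx y else 0)
    + X * upart l' (j + 1) (y ++ [:: true])
    + (upart l' (j - 1) (y ++ [:: false]) - X * upart l' (j - 1) (y ++ [:: false; false; true]))
  else 0.

Lemma useries_long n j y : (n.*2 <= size y)%N -> eqs n (useries j y) 0.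
Proof.
move=> h; apply: eqs_fsum0 => m; rewrite /wsum => k kn; rewrite cf_sum big1 // => b _.
rewrite /uterm; case: ifP => // _; rewrite (ectx_long _ kn) // size_cat; lia.
Qed.

Lemma upart_useries n l j y : (n.*2 <= size y + l)%N -> eqs n (upart l j y) (useries j y).
Proof.
elim: l j y => [|l IHl] j y h; first by rewrite addn0 in h; apply/eqs_sym/useries_long.
rewrite useries_rec /=; apply: eqsD; first apply: eqsD => //.
  by apply: eqsM => //; apply: IHl; rewrite size_cat /=; lia.
apply: eqsB; first by apply: IHl; rewrite size_cat /=; lia.
by apply: eqsM => //; apply: IHl; rewrite size_cat /=; lia.
Qed.

Lemma upartE l j y : upart l j y =
  \sum_(i < l) \sum_(v <- words i) (if excess v == j then
    X ^+ count id v * tw (fun w => ectx (y ++ w)) v else 0).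
Proof.
elim: l j y => [|l IHl] j y; first by rewrite big_ord0.
rewrite /= big_ord_recl big_seq1 -addrA; congr (_ + _).
  by rewrite /= mul1r cats0 eq_sym.
rewrite !IHl !mulr_sumr -sumrB -big_split /=; apply: eq_bigr => i _.
rewrite big_cat !big_map !mulr_sumr -sumrB /=; congr (_ + _); apply: eq_bigr => v _.
  rewrite excess_cons /= add1n; have -> : (-1 + excess v == j) = (excess v == j + 1) by lia.
  by case: ifP => _; rewrite ?mulr0 // exprS -mulrA; congr (_ * (_ * _)); apply: eq_tw => w; rewrite -catA.
rewrite excess_cons /= add0n; have -> : (1 + excess v == j) = (excess v == j - 1) by lia.
case: ifP => _; rewrite ?mulr0 ?subr0 // mulrBr; congr (_ - _).
  by congr (_ * _); apply: eq_tw => w; rewrite -catA.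
by rewrite mulrCA; congr (_ * (_ * _)); apply: eq_tw => w; rewrite -catA.
Qed.

End Unfolding.

Section Stretch.

Variables (A : comNzRingType) (p : nat).
Hypothesis p0 : (0 < p)%N.

Lemma cf0_Xn : coefs (X ^+ p : fser A) 0%N = 0.
Proof. by rewrite cfXn; case: p p0. Qed.

Lemma strM (F H : fser A) : str p (F * H) = str p F * str p H.
Proof. exact/compM/cf0_Xn. Qed.
Lemma strD (F H : fser A) : str p (F + H) = str p F + str p H.
Proof. exact/compD/cf0_Xn. Qed.
Lemma str_sum (I : Type) (r : seq I) (F : I -> fser A) :
  str p (\sum_(i <- r) F i) = \sum_(i <- r) str p (F i).
Proof. exact/comp_sum/cf0_Xn. Qed.
Lemma strX : str p (X : fser A) = X ^+ p.
Proof. exact/compX/cf0_Xn. Qed.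
Lemma str1 : str p (1 : fser A) = 1.
Proof. exact: comp1. Qed.
Lemma str0 : str p (0 : fser A) = 0.
Proof. exact: comp0. Qed.
Lemma str_eqs n (F H : fser A) : eqs n F H -> eqs n (str p F) (str p H).
Proof. exact/comp_eqs/cf0_Xn. Qed.
Lemma str_inj : injective (@str A p).
Proof.
move=> F H e; apply: fserP => n; have := congr1 (fun K => coefs K (n * p)) e.
by rewrite !cf_str // dvdn_mull // mulnK.
Qed.

End Stretch.

Lemma str_str (A : comNzRingType) p q (F : fser A) : (0 < p)%N -> (0 < q)%N ->
  str p (str q F) = str (q * p) F.
Proof.
move=> p0 q0; apply: fserP => n; rewrite !cf_str ?muln_gt0 ?q0 //.
have [/dvdnP[k ->]|pn] := boolP (p %| n)%N.
  by rewrite mulnK // dvdn_pmul2r // divnMr.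
by case: ifP => // /(dvdn_trans (dvdn_mull q (dvdnn p))); rewrite (negPf pn).
Qed.

Lemma tw_EQ_charge u : excess u != 0 -> tw EQ u = 0.
Proof. by move=> u0; apply: tw_charge => w e; rewrite EQ_charge ?e. Qed.

Lemma tw_EQ_catC u v : tw EQ (u ++ v) = tw EQ (v ++ u).
Proof.
by rewrite !tw_cat tw_swap; apply: eq_tw => w; apply: eq_tw => w'; rewrite EQ_catC.
Qed.

Lemma ctx_main_useries u : fsum (wsum (ctx_main u)) = useries u 1 [::].
Proof.
apply: eq_fsum => m; apply: eq_bigr => b _; rewrite /uterm /ctx_main /ectx.
by apply: eq_tw => w; rewrite /= -catA.
Qed.

Lemma EG_vert n l u : (n.*2 < l)%N -> eqs n (mser_vert negb vs_bal false u [::])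
  (\sum_(i < l) \sum_(v <- words i) if excess v == 1 then EG (v ++ u) else 0).
Proof.
move=> nl m mn; rewrite cf_sum /= /vs_bal big_flatten big_map.
have E i : \sum_(v <- [seq v <- words i | balanced (true :: v)]) coefs (mser negb vs_bal [:: v ++ u]) m
    = coefs (\sum_(v <- words i) if excess v == 1 then EG (v ++ u) else 0) m.
  rewrite big_filter big_mkcond cf_sum; apply: eq_bigr => v _.
  rewrite -excess0 excess_cons; have -> : (-1 + excess v == 0) = (excess v == 1) by lia.
  by case: ifP.
rewrite (eq_bigr _ (fun i _ => E i)) -[iota 0 _]/(index_iota 0 m.*2.+1) big_mkord.
have -> : l = (m.*2.+1 + (l - m.*2.+1))%N by lia.
rewrite big_split_ord [X in _ = _ + X]big1 ?addr0 // => i _.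
rewrite cf_sum big_seq big1 // => v; rewrite mem_words => /eqP /= sv.
case: ifP => // _; rewrite (@EG_long m.+1) // size_cat; lia.
Qed.

Lemma balanced_neg u : excess u = 0 -> u != [::] -> exists a r, u = a ++ false :: r.
Proof.
move=> eu u0; have : has negb u.
  rewrite has_count lt0n; apply: contraNneq u0 => cn.
  move: eu; rewrite /excess cn sub0r => /eqP; rewrite oppr_eq0 => /eqP [ci].
  by rewrite -size_eq0 -(count_predC id) ci; have -> : count (predC id) u = count negb u by []; rewrite cn.
by case/hasP => -[] // fu _; case/splitPr: fu => a r; exists a, r.
Qed.

(* Each [-] of an Eulerian orientation stands for [- - X (- - +)] in the quartic
   model, which forbids the next vertex on its strand to be of type [- - +]. *)
Theorem EG_EQ u : excess u = 0 -> str 2 (EG u) = X ^+ count id u * tw EQ u.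
Proof.
move=> eu; apply: eqs_eq => n; elim: n u eu => [//|n IHn] u eu.
have [->|u0] := eqVneq u [::]; first by rewrite EG_nil str1 //= EQ_nil mulr1.
(* Both sides are invariant under rotation, so the word may be taken to start with [false], the
   letter that [tw_EQ_f] peels. *)
have [a [r uE]] := balanced_neg eu u0.
have -> : str 2 (EG u) = str 2 (EG (false :: (r ++ a))) by rewrite uE EG_catC.
have -> : X ^+ count id u * tw EQ u = X ^+ count id (false :: (r ++ a)) * tw EQ (false :: (r ++ a)).
  by rewrite uE tw_EQ_catC !count_cat addnC -count_cat.
have {eu u0 uE} : excess (false :: (r ++ a)) = 0 by rewrite -eu uE !excess_cat !excess_cons excess_cat; lia.
move: (r ++ a) => {u a r} u eu; have eu1 : excess u = -1 by move: eu; rewrite excess_cons; lia.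
rewrite EG_cons tw_EQ_f strM // strX // strD //.
set Q1 := Spl _ _ _; set Q2 := mser_vert _ _ _ _ _; set Q3 := Spl _ _ _; set Q4 := fsum _.
have -> : X ^+ count id (false :: u) * (X * (Q3 + X * Q4)) =
    X ^+ 2 * (X ^+ count id u * Q4) + X * (X ^+ count id u * Q3) by rewrite /=; ring.
rewrite mulrDr addrC; apply: eqs_le (_ : eqs n.+1 _ _) => //.
apply: eqsD.
  apply: (@eqs_le _ n.+2) => //; apply: (@eqsXn _ 2).
  apply: eqs_trans (str_eqs (ltn0Sn 1) (@EG_vert n (n.*2.+1) u (ltnSn _))) _.
  rewrite str_sum // /Q4 ctx_main_useries.
  apply: eqs_trans (_ : eqs n (X ^+ count id u * upart u n.*2.+1 1 [::]) _); last first.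
    by apply: eqsM => //; apply: upart_useries; rewrite /=; lia.
  rewrite upartE mulr_sumr; apply: eqs_sum => i _.
  rewrite str_sum // mulr_sumr; apply: eqs_sum => v _.
  case: ifP => [/eqP ev|_]; last by rewrite str0 // mulr0.
  apply: eqs_trans (IHn (v ++ u) _) _; first by rewrite excess_cat ev eu1.
  by rewrite count_cat tw_cat exprD mulrA [_ ^+ count id u * _]mulrC.
have -> : X * (X ^+ count id u * Q3) = X ^+ (count id u).+1 * Q3 by rewrite exprS mulrA.
rewrite /Q1 /Q3 {Q1 Q2 Q3 Q4} /Spl str_sum // !mulr_sumr.
apply: (@eqs_le _ n.+2) => //; apply: eqs_sum => -[a r] /wsplitsP /= uE.
have [ea|ea] := eqVneq (excess a) 0; last first.
  by rewrite EG_charge // tw_EQ_charge // !mul0r str0 // !mulr0.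
have er : excess r = 0 by move: eu1; rewrite uE excess_cat excess_cons ea; lia.
rewrite strM //.
have -> : X ^+ (count id u).+1 * (tw EQ a * tw EQ r) =
    X ^+ 2 * ((X ^+ count id a * tw EQ a) * (X ^+ count id r * tw EQ r)).
  by rewrite uE count_cat /= add1n addnS !exprS exprD; ring.
by apply: (@eqsXn _ 2); apply: eqsM; apply: IHn.
Qed.

Definition gser : fser rat := Fser (fun n => (g n)%:R).

(** The edge at the [false] of a root vertex of degree two is a loop or leads to another vertex;
    contracting it in the latter case gives an arbitrary root vertex with a marked outgoing
    half-edge. *)
Lemma EG_ft : EG [:: false; true] = X * (1 + gser).
Proof.
rewrite EG_cons Spl_cons Spl_nil addr0 /= EG_nil mulr1; congr (X * (1 + _)).
apply: fserP => n; rewrite /= g_M natr_sum; apply: eq_bigr => v _.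
by rewrite -[LHS]/(coefs (EG (v ++ [:: true])) n) EG_catC.
Qed.

Lemma EQ_tfft : EQ [:: true; false; false; true] = str 2 gser.
Proof.
have := EG_EQ (erefl : excess [:: false; true] = 0).
rewrite EG_ft strM // strD // strX // str1 /= EQ_f Spl_cons Spl_nil addr0 /= EQ_nil mulr1 expr1.
have -> : X ^+ 2 * (1 + str 2 gser) = X * (X * (1 + str 2 gser)) by rewrite exprS expr1 mulrA.
rewrite -mulrBr => /mulXI/mulXI; rewrite addrA addrK => /addrI ->.
by [].
Qed.

(** The two words are rotations of each other, whence the factor 2 between Q(t, 0) and G(t). *)
Lemma EQ_ttff : EQ [:: true; true; false; false] = str 2 gser.
Proof. by rewrite -EQ_tfft; exact: (EQ_catC [:: true] [:: true; false; false]). Qed.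

Lemma EQ_ft : EQ [:: false; true] = X * (1 + 2%:R * str 2 gser).
Proof.
rewrite EQ_f Spl_cons Spl_nil addr0 /= EQ_nil mulr1 EQ_tfft.
rewrite (EQ_catC [:: false; false] [:: true; true]) /= EQ_ttff.
by rewrite mulr2n mulrDl mul1r.
Qed.

Lemma q_g v : (q v 0)%:R = 2%:R * (g v)%:R :> rat.
Proof.
rewrite q_M natrD.
rewrite -[X in X + _]/(coefs (EQ [:: true; true; false; false]) (2 * v)).
rewrite -[X in _ + X]/(coefs (EQ [:: true; false; false; true]) (2 * v)).
rewrite EQ_ttff EQ_tfft cf_str // dvdn_mulr // mulKn //=.
by rewrite mulr2n mulrDl mul1r.
Qed.

(** * A cubic model *)

(* The cubic model obtained by expanding each vertex of a quartic orientation
   without alternating vertices into an oriented edge: [hp] and [hn] are the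
   half-edges of the original edges, [hz] and [hy] those of the new ones. *)
Definition letter : eqType := (bool * bool)%type.
Definition hp : letter := (false, true).
Definition hn : letter := (false, false).
Definition hz : letter := (true, true).
Definition hy : letter := (true, false).
Definition lbar (c : letter) : letter := (c.1, ~~ c.2).

Definition hwords : seq (seq letter) :=
  [:: [:: hz; hp; hn]; [:: hp; hn; hz]; [:: hn; hz; hp];
      [:: hy; hn; hp]; [:: hn; hp; hy]; [:: hp; hy; hn]].

Definition vs_h (n : nat) (c : letter) : seq (seq letter) :=
  [seq behead w | w <- hwords & head c w == lbar c].

Lemma lbarK : involutive lbar. Proof. by move=> [? []]. Qed.

Lemma hwords_case (P : seq letter -> Prop) :
  P [:: hz; hp; hn] -> P [:: hp; hn; hz] -> P [:: hn; hz; hp] ->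
  P [:: hy; hn; hp] -> P [:: hn; hp; hy] -> P [:: hp; hy; hn] ->
  forall w, w \in hwords -> P w.
Proof.
move=> h1 h2 h3 h4 h5 h6 w.
by rewrite !inE => /orP[/eqP->|/or4P[/eqP->|/eqP->|/eqP->|/orP[/eqP->|/eqP->]]].
Qed.

Lemma hwords_rot k w : (rot k w \in hwords) = (w \in hwords).
Proof.
have imp i v : v \in hwords -> rot i v \in hwords.
  by move: v; apply: hwords_case; move: i => [|[|[|i]]]; rewrite !inE.
by apply/idP/idP; [rewrite -{2}(rotK k w) /rotr|]; apply: imp.
Qed.

Lemma hwords_bar w : w \in hwords -> map lbar w \in hwords.
Proof. by move: w; apply: hwords_case; rewrite !inE. Qed.

Lemma vs_h_uniq n c : uniq (vs_h n c). Proof. by case: c => [[] []]. Qed.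

Lemma vs_h_V n c v : v \in vs_h n c -> lbar c :: v \in hwords.
Proof. by case: c => [[] []]; rewrite !inE; do ?case/orP; move=> /eqP ->. Qed.

Lemma V_vs_h n c v : (size v <= n.*2)%N -> lbar c :: v \in hwords -> v \in vs_h n c.
Proof.
move=> _ vh; apply/mapP; exists (lbar c :: v) => //.
by rewrite mem_filter vh andbT /=.
Qed.

Definition EH : seq letter -> fser rat := wser lbar vs_h.

Lemma EH_nil : EH [::] = 1.
Proof. exact: wser0. Qed.

Lemma EH_n u : EH (hn :: u) = X * (Spl hp (fun a r => EH a * EH r) u +
   (EH [:: hn, hz & u] + EH [:: hy, hn & u])).
Proof.
rewrite [LHS](wser_cons lbarK hwords_rot vs_h_uniq vs_h_V V_vs_h).
rewrite (mser_vert_const lbar _ _ _ (l := [:: [:: hn; hz]; [:: hy; hn]])) //.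
by rewrite !big_cons big_nil addr0.
Qed.

Lemma EH_z u : EH (hz :: u) = X * (Spl hy (fun a r => EH a * EH r) u + EH [:: hn, hp & u]).
Proof.
rewrite [LHS](wser_cons lbarK hwords_rot vs_h_uniq vs_h_V V_vs_h).
rewrite (mser_vert_const lbar _ _ _ (l := [:: [:: hn; hp]])) //.
by rewrite !big_cons big_nil addr0.
Qed.

Lemma EH_y u : EH (hy :: u) = X * (Spl hz (fun a r => EH a * EH r) u + EH [:: hp, hn & u]).
Proof.
rewrite [LHS](wser_cons lbarK hwords_rot vs_h_uniq vs_h_V V_vs_h).
rewrite (mser_vert_const lbar _ _ _ (l := [:: [:: hp; hn]])) //.
by rewrite !big_cons big_nil addr0.
Qed.

Lemma EH_catC u v : EH (u ++ v) = EH (v ++ u).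
Proof. exact: (wser_catC lbarK hwords_rot vs_h_uniq vs_h_V V_vs_h). Qed.

Lemma EH_bar u : EH (map lbar u) = EH u.
Proof.
apply: (wser_morph lbarK hwords_rot vs_h_uniq vs_h_V V_vs_h) => //.
- exact: lbarK.
- move=> w; apply/idP/idP; last exact: hwords_bar.
  by move=> /hwords_bar; rewrite (mapK lbarK).
Qed.

Definition hcharge (u : seq letter) : int := (count_mem hn u)%:Z - (count_mem hp u)%:Z.

Lemma EH_charge u : hcharge u != 0 -> EH u = 0.
Proof.
apply: (@wser_charge _ lbar (mem hwords) vs_h vs_h_V hcharge) => //.
- by move=> v w; rewrite /hcharge !count_cat; lia.
- by case=> [[] []].
- by apply: hwords_case.
Qed.

Definition hinj : seq bool -> seq letter := map (pair false).

Lemma hcharge_inj u : hcharge (hinj u) = excess u.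
Proof. by rewrite /hcharge /excess !count_map; congr (Posz _ - Posz _); apply: eq_count => -[]. Qed.

Lemma Spl_hinj (A : zmodType) c (f : seq letter -> seq letter -> A) u :
  Spl (false, c) f (hinj u) = Spl c (fun a r => f (hinj a) (hinj r)) u.
Proof.
elim: u f => [|b u IHu] f; first by rewrite !Spl_nil.
by rewrite /= !Spl_cons IHu.
Qed.

Lemma Spl_hinj0 (A : zmodType) c (f : seq letter -> seq letter -> A) u :
  Spl (true, c) f (hinj u) = 0.
Proof.
elim: u f => [|b u IHu] f; first by rewrite !Spl_nil.
by rewrite /= !Spl_cons IHu addr0.
Qed.

(** A single new half-edge among original ones cannot close a loop; peeling it contracts the new
    edge and restores a quartic vertex, of type [false, false, true] here and [true, false, false]
    in the next lemma. *)
Lemma EH_nz u : EH [:: hn, hz & hinj u] = X * EH (hinj [:: false, false, true & u]).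
Proof.
rewrite (EH_catC [:: hn] (hz :: hinj u)) /= EH_z.
have -> : hinj u ++ [:: hn] = hinj (u ++ [:: false]) by rewrite /hinj map_cat.
rewrite Spl_hinj0 add0r; congr (X * _).
rewrite (EH_catC [:: hn] (hinj [:: false, true & u])) /=.
by rewrite /hinj map_cat.
Qed.

Lemma EH_yn u : EH [:: hy, hn & hinj u] = X * EH (hinj [:: true, false, false & u]).
Proof. by rewrite EH_y (Spl_hinj0 true _ (false :: u)) add0r. Qed.

(** For a root vertex of degree 2k, a quartic map with V ordinary vertices has E = 2V + k edges and
    its expansion has E' = E + V, so that 3E = k + 2E'. This gives the exponents; the recursions
    agree by [EH_nz] and [EH_yn]. *)
Theorem EQ_EH u : excess u = 0 -> str 3 (EQ u) = X ^+ count id u * str 2 (EH (hinj u)).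
Proof.
have p2 : (0 < 2)%N by []. have p3 : (0 < 3)%N by [].
move=> eu; apply: eqs_eq => n; elim: n u eu => [//|n IHn] u eu.
have [->|u0] := eqVneq u [::]; first by rewrite EQ_nil EH_nil !str1 //= mulr1.
have [a [r uE]] := balanced_neg eu u0.
have -> : EQ u = EQ (false :: (r ++ a)) by rewrite uE EQ_catC.
have -> : EH (hinj u) = EH (hinj (false :: (r ++ a))).
  by rewrite uE /hinj map_cat EH_catC -map_cat.
have -> : count id u = count id (r ++ a) by rewrite uE !count_cat addnC.
have {eu u0 uE} : excess (false :: (r ++ a)) = 0 by rewrite -eu uE !excess_cat !excess_cons excess_cat; lia.
move: (r ++ a) => {u a r} u eu; have eu1 : excess u = -1 by move: eu; rewrite excess_cons; lia.
rewrite EQ_f [hinj _]/= EH_n (strM p3 X) (@strX _ _ p3) !(strD p3) Spl_hinj EH_nz EH_yn (strM p2 X) (@strX _ _ p2).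
set p := count id u.
set S1 := Spl _ _ _; set S2 := Spl _ _ _.
set A1 := EQ _; set A2 := EQ _; set B2 := EH _; set B1 := EH _.
rewrite (strD p2 S2) (strD p2 (X * B2)) (strM p2 X B2) (strM p2 X B1) (@strX _ _ p2).
have -> : X ^+ p * (X ^+ 2 * (str 2 S2 + (X ^+ 2 * str 2 B2 + X ^+ 2 * str 2 B1))) =
  X ^+ 3 * (X ^+ p.+1 * str 2 B1 + X ^+ p.+1 * str 2 B2) + X ^+ 2 * (X ^+ p * str 2 S2).
  by rewrite !exprS; ring.
rewrite mulrDr addrC; apply: eqs_le (_ : eqs n.+1 _ _) => //.
apply: eqsD.
  apply: (@eqs_le _ n.+3); first by lia.
  apply: (@eqsXn _ 3).
  by apply: eqsD; apply: IHn; rewrite !excess_cons eu1.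
have -> : X ^+ 2 * (X ^+ p * str 2 S2) = X ^+ p.+2 * str 2 S2 by rewrite mulrA -exprD.
rewrite /S1 /S2 /Spl (str_sum p3) (str_sum p2) !mulr_sumr.
apply: (@eqs_le _ n.+3); first by lia.
  apply: eqs_sum => -[a r] /wsplitsP /= uE.
have [ea|ea] := eqVneq (excess a) 0; last first.
  have ha : hcharge (hinj a) != 0 by rewrite hcharge_inj.
  by rewrite (EQ_charge ea) (EH_charge ha) !mul0r !str0 !mulr0.
have er : excess r = 0 by move: eu1; rewrite uE excess_cat excess_cons ea; lia.
rewrite (strM p3 (EQ a)) (strM p2 (EH (hinj a))).
have -> : X ^+ p.+2 * (str 2 (EH (hinj a)) * str 2 (EH (hinj r))) =
    X ^+ 3 * ((X ^+ count id a * str 2 (EH (hinj a))) * (X ^+ count id r * str 2 (EH (hinj r)))).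
  by rewrite /p uE count_cat /= add1n addnS !exprS exprD; ring.
by apply: (@eqsXn _ 3); apply: eqsM; apply: IHn.
Qed.

Lemma str2 k : (0 < k)%N -> str k (2%:R : fser rat) = 2%:R.
Proof. by move=> k0; rewrite mulr2n strD // str1. Qed.

Lemma EH_np : EH [:: hn; hp] = X * (1 + 2%:R * str 3 gser).
Proof.
apply: (@str_inj _ 2) => //.
have := EQ_EH (erefl : excess [:: false; true] = 0).
have p2 : (0 < 2)%N by []. have p3 : (0 < 3)%N by [].
rewrite EQ_ft (strM p3 X) (@strX _ _ p3) (strD p3) (strM p3) (str1 _ _) (str_str _ p3 p2) (@str2 _ p3).
have -> : hinj [:: false; true] = [:: hn; hp] by [].
have -> : count id [:: false; true] = 1%N by [].
rewrite expr1 exprS -mulrA => /mulXI <-.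
by rewrite (strM p2 X) (@strX _ _ p2) (strD p2 1) (strM p2 2%:R) (str1 _ _) (str_str _ p2 p3) (@str2 _ p2).
Qed.

Lemma Spl_nseq0 (L : eqType) (A : zmodType) (c d : L) (f : seq L -> seq L -> A) n :
  d != c -> Spl c f (nseq n d) = 0.
Proof. by move=> dc; apply: Spl0 => a r e; case/idP: (negPf dc); have : c \in nseq n d; [rewrite e mem_cat mem_head orbT | rewrite mem_nseq eq_sym => /andP[]]. Qed.

Lemma Spl_nseq (L : eqType) (A : zmodType) (c : L) (f : seq L -> seq L -> A) n :
  Spl c f (nseq n c) = \sum_(k < n) f (nseq k c) (nseq (n.-1 - k) c).
Proof.
elim: n f => [|n IHn] f; first by rewrite Spl_nil big_ord0.
rewrite Spl_cons eqxx IHn big_ord_recl subn0; congr (_ + _).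
by apply: eq_bigr => i _; rewrite lift0 /=; congr (f _ (nseq _ _)); lia.
Qed.

Definition Fz a b := EH (nseq a hz ++ nseq b hy).

Lemma Fz_sym a b : Fz a b = Fz b a.
Proof. by rewrite /Fz -EH_bar map_cat !map_nseq EH_catC. Qed.

(* [Kz a b 0 0] is the vertex term in the equation of [Fz a.+1 b]; peeling its
   half-edge [hn] moves the new half-edges to both ends of the word. *)
Definition Kz a b i j := EH (hn :: nseq i hz ++ hp :: nseq a hz ++ nseq (b + j) hy).

Lemma Kz_rec a b i j : Kz a b i j = X * (Fz 0 i * Fz a (b + j) + (Kz a b i.+1 j + Kz a b i j.+1)).
Proof.
rewrite /Kz EH_n; congr (X * (_ + (_ + _))).
  rewrite Spl_cat Spl_nseq0 // add0r Spl_cons eqxx Spl_cat !Spl_nseq0 // !addr0.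
  by rewrite Fz_sym /Fz !cats0.
have -> : nseq (b + j.+1) hy = nseq (b + j) hy ++ [:: hy] by rewrite addnS -addn1 nseqD.
by rewrite (EH_catC [:: hy] (hn :: _)) /= -catA cat_cons -catA.
Qed.

Lemma Fz_rec a b : Fz a.+1 b = X * (\sum_(k < b) Fz a k * Fz 0 (b.-1 - k) + Kz a b 0 0).
Proof.
rewrite /Fz /= EH_z; congr (X * (_ + _)); last by rewrite /Kz addn0.
by rewrite Spl_cat Spl_nseq0 // add0r Spl_nseq.
Qed.

(** The recursion is unrolled [n] times; the binomial coefficient counts the orders of i steps of
    one kind and d - i of the other. *)
Lemma pascal_iter (A : comNzRingType) (w f : nat -> fser A) (K : nat -> nat -> fser A) :
  (forall i j, K i j = X * (w i * f j + (K i.+1 j + K i j.+1))) ->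
  forall n, K 0%N 0%N =
   \sum_(d < n) X ^+ d.+1 * (\sum_(i < d.+1) 'C(d, i)%:R * (w i * f (d - i)%N)) +
   X ^+ n * \sum_(i < n.+1) 'C(n, i)%:R * K i (n - i)%N.
Proof.
move=> Krec; elim=> [|n ->]; first by rewrite big_ord0 add0r big_ord_recl big_ord0 mul1r mul1r addr0.
rewrite [X in _ = X + _]big_ord_recr -[RHS]addrA; congr (_ + _).
have -> : \sum_(i < n.+1) 'C(n, i)%:R * K i (n - i)%N =
   X * (\sum_(i < n.+1) 'C(n, i)%:R * (w i * f (n - i)%N) +
      \sum_(i < n.+2) 'C(n.+1, i)%:R * K i (n.+1 - i)%N).
  rewrite big_ord_recl [Z in _ = _ * (_ + Z)]big_ord_recl.
  rewrite bin0 mul1r subn0 Krec.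
  have -> : \sum_(i < n.+1) 'C(n.+1, lift ord0 i)%:R * K (lift ord0 i) (n.+1 - lift ord0 i)%N =
    \sum_(i < n.+1) 'C(n, i)%:R * K i.+1 (n - i)%N + \sum_(i < n) 'C(n, i.+1)%:R * K i.+1 (n - i)%N.
    under eq_bigr => i _ do rewrite lift0 binS natrD mulrDl subSS addrC.
    rewrite big_split; congr (_ + _).
    by rewrite big_ord_recr /= bin_small // mul0r addr0.
  rewrite [\sum_(i < n.+1) 'C(n, i)%:R * (w i * _)]big_ord_recl bin0 mul1r subn0.
  rewrite [\sum_(i < n.+1) 'C(n, i)%:R * K i.+1 _]big_ord_recl bin0 mul1r subn0.
  have -> : \sum_(i < n) 'C(n, lift ord0 i)%:R * K (lift ord0 i) (n - lift ord0 i)%N =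
    X * (\sum_(i < n) 'C(n, lift ord0 i)%:R * (w (lift ord0 i) * f (n - lift ord0 i)%N) +
     \sum_(i < n) 'C(n, lift ord0 i)%:R * K (lift ord0 i).+1 (n - lift ord0 i)%N +
     \sum_(i < n) 'C(n, i.+1)%:R * K i.+1 (n - i)%N).
    rewrite -!big_split mulr_sumr; apply: eq_bigr => i _; rewrite Krec lift0.
    have -> : (n - i)%N = (n - i.+1).+1 by have := ltn_ord i; lia.
    by move: (_ - _)%N => k /=; ring.
  rewrite subn0 bin0 mul1r /=; ring.
by rewrite exprS; ring.
Qed.

(* With H_n = sum_b H (n - 1) b x^(b + 1), the last clause says that
   H_(n+1) is the part with positive powers of x of theta H_n, where theta is
   H_1 + sum_j x^-j sum_i 'C(i + j, j) H 0 i. *)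
Definition is_sol (H : nat -> nat -> fser rat) :=
  [/\ H 0%N 0%N = X ^+ 3, forall a b, H a b = H b a, forall a b, eqs 1 (H a b) 0 &
   forall n a b, eqs n (H a.+1 b) (\sum_(k < b) H a k * H 0%N (b.-1 - k)%N +
     \sum_(d < n) \sum_(i < d.+1) 'C(d, i)%:R * (H 0%N i * H a (b + (d - i))%N))].

(** The recursion reaches only [H a.+1 b], and symmetry supplies [H 0 b]. Since all the series
    vanish at 0, products gain one order of agreement. *)
Lemma is_sol_unique H H' : is_sol H -> is_sol H' -> forall a b, H a b = H' a b.
Proof.
move=> [h00 hs h1 hr] [h00' hs' h1' hr'] a b; apply: eqs_eq => n.
elim: n a b => [//|n IHn].
have prod a b c d : eqs n.+1 (H a b * H c d) (H' a b * H' c d).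
  exact: (@eqsM_gain _ n 1).
have step a b : eqs n.+1 (H a.+1 b) (H' a.+1 b).
  apply: eqs_trans (hr n.+1 a b) _; refine (eqs_trans _ (eqs_sym (hr' n.+1 a b))).
  apply: eqsD; first by apply: eqs_sum => k _; apply: prod.
  apply: eqs_sum => d _; apply: eqs_sum => i _.
  by apply: eqsM => //; apply: prod.
move=> [|a] [|b]; first by rewrite h00 h00'.
- by rewrite hs hs'.
- exact: step.
- exact: step.
Qed.

(** An ordinary vertex of the cubic model has two original half-edges and one new one. With e new
    edges, the number of edges plus a + b is therefore 3e, so this is a series in X^3 where such a
    map has exponent e + 1. The extra factor X^3 makes the quadratic system homogeneous. *)
Definition Hz a b := X ^+ (3 + a + b) * Fz a b.

Lemma Hz_sol : is_sol Hz.
Proof.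
split=> [|a b|a b|n a b].
- by rewrite /Hz /Fz EH_nil mulr1.
- by rewrite /Hz Fz_sym addnAC.
- by rewrite /Hz -addnA addSn exprS -mulrA => -[|//] _; rewrite cfXM cf0.
have KE := pascal_iter (Kz_rec a b).
rewrite /Hz Fz_rec (KE n).
set S := \sum_(k < b) _; set T := \sum_(d < n) (X ^+ _ * _); set R := \sum_(i < n.+1) _.
have -> : X ^+ (3 + a.+1 + b) * (X * (S + (T + X ^+ n * R))) =
    X ^+ (5 + a + b) * S + X ^+ (5 + a + b) * T + X ^+ n * (X ^+ (5 + a + b) * R).
  have -> : (5 + a + b = (3 + a.+1 + b).+1)%N by lia.
  by rewrite exprS; ring.
rewrite -[X in eqs n _ X]addr0; apply: eqsD; last exact: eqsXn0.
have -> : X ^+ (5 + a + b) * S = \sum_(k < b) X ^+ (3 + a + k) * Fz a k * (X ^+ (3 + 0 + (b.-1 - k)) * Fz 0 (b.-1 - k)).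
  rewrite mulr_sumr; apply: eq_bigr => k _.
  have -> : (5 + a + b = (3 + a + k) + (3 + 0 + (b.-1 - k)))%N by have := ltn_ord k; lia.
  by rewrite exprD; ring.
apply: eqsD => //; rewrite mulr_sumr; apply: eqs_sum => d _.
rewrite !mulr_sumr; apply: eqs_sum => i _.
suff -> : X ^+ (5 + a + b) * (X ^+ d.+1 * ('C(d, i)%:R * (Fz 0 i * Fz a (b + (d - i))))) =
  'C(d, i)%:R * (X ^+ (3 + 0 + i) * Fz 0 i * (X ^+ (3 + a + (b + (d - i))) * Fz a (b + (d - i)))) by [].
rewrite mulrA -exprD.
have -> : (5 + a + b + d.+1 = (3 + 0 + i) + (3 + a + (b + (d - i))))%N by have := ltn_ord i; lia.
by rewrite exprD; ring.
Qed.

Lemma Hz01 : Hz 0 1 = X ^+ 6 * (1 + 2%:R * str 3 gser).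
Proof.
rewrite /Hz Fz_sym /Fz /= EH_z Spl_nil add0r EH_np !exprS; ring.
Qed.

(** * Series in r, x and z, and their exponentials *)

Import Num.Theory.

(* A series in z, x and r whose monomials z^n x^m r^N satisfy n, m <= N is
   stored as a series in y = r x z, p = 1/z, q = 1/x: the coefficient of
   y^N p^s q^k is that of z^(N-s) x^(N-k) r^N. *)
Definition qring : comNzRingType := fser rat.
Definition pring : comNzRingType := fser qring.
Definition yring : comNzRingType := fser pring.

Definition cf1y (F : yring) (n : nat) : pring := coefs (F : fser pring) n.
Definition cf1p (F : pring) (n : nat) : qring := coefs (F : fser qring) n.
Definition cf1q (F : qring) (n : nat) : rat := coefs (F : fser rat) n.

Definition c3 (F : yring) N s k : rat := cf1q (cf1p (cf1y F N) s) k.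
Definition ser3 (f : nat -> nat -> nat -> rat) : yring :=
  Fser (fun N => Fser (fun s => Fser (f N s) : qring) : pring).

Lemma c3E F N s k : c3 F N s k = cf1q (cf1p (cf1y F N) s) k. Proof. by []. Qed.

Lemma c3_ser3 f N s k : c3 (ser3 f) N s k = f N s k. Proof. by []. Qed.

Lemma c3P (F H : yring) : (forall N s k, c3 F N s k = c3 H N s k) -> F = H.
Proof. by move=> e; apply: fserP => N; apply: fserP => s; apply: fserP => k; apply: e. Qed.

Lemma c30 N s k : c3 0 N s k = 0. Proof. by []. Qed.
Lemma c31 N s k : c3 1 N s k = [&& N == 0%N, s == 0%N & k == 0%N]%:R.
Proof. by case: N => [|N]; case: s => [|s]; case: k. Qed.
Lemma c3D F H N s k : c3 (F + H) N s k = c3 F N s k + c3 H N s k.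
Proof. by []. Qed.
Lemma c3N F N s k : c3 (- F) N s k = - c3 F N s k.
Proof. by []. Qed.
Lemma c3B F H N s k : c3 (F - H) N s k = c3 F N s k - c3 H N s k.
Proof. by rewrite c3D c3N. Qed.
Lemma cf1y_sum n (F : nat -> yring) N : cf1y (\sum_(i < n) F i) N = \sum_(i < n) cf1y (F i) N.
Proof. exact: cf_sum. Qed.
Lemma cf1p_sum n (F : nat -> pring) N : cf1p (\sum_(i < n) F i) N = \sum_(i < n) cf1p (F i) N.
Proof. exact: cf_sum. Qed.
Lemma cf1q_sum n (F : nat -> qring) N : cf1q (\sum_(i < n) F i) N = \sum_(i < n) cf1q (F i) N.
Proof. exact: cf_sum. Qed.
Lemma c3_sum n (F : nat -> yring) N s k : c3 (\sum_(i < n) F i) N s k = \sum_(i < n) c3 (F i) N s k.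
Proof. by rewrite /c3 cf1y_sum (@cf1p_sum _ (fun i => cf1y (F i) N)) (@cf1q_sum _ (fun i => cf1p (cf1y (F i) N) s)). Qed.
Lemma c3M F H N s k : c3 (F * H) N s k =
  \sum_(i < N.+1) \sum_(j < s.+1) \sum_(l < k.+1) c3 F i j l * c3 H (N - i) (s - j) (k - l).
Proof.
have ey : cf1y (F * H) N = \sum_(i < N.+1) cf1y F i * cf1y H (N - i)%N by [].
have ep (K K' : pring) n : cf1p (K * K') n = \sum_(i < n.+1) cf1p K i * cf1p K' (n - i)%N by [].
have ek (K K' : qring) n : cf1q (K * K') n = \sum_(i < n.+1) cf1q K i * cf1q K' (n - i)%N by [].
rewrite /c3 ey (@cf1p_sum _ (fun i => cf1y F i * cf1y H (N - i)%N)).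
rewrite (@cf1q_sum _ (fun i => cf1p (cf1y F i * cf1y H (N - i)%N) s)); apply: eq_bigr => i _.
rewrite ep (@cf1q_sum _ (fun j => cf1p (cf1y F i) j * cf1p (cf1y H (N - i)%N) (s - j)%N)).
by apply: eq_bigr => j _; rewrite ek.
Qed.

Definition const3 (c : rat) : yring := fconst (fconst (fconst c : qring) : pring).

Lemma c3_constM c F N s k : c3 (const3 c * F) N s k = c * c3 F N s k.
Proof.
have ey : cf1y (const3 c * F) N = (fconst (fconst c : qring) : pring) * cf1y F N by exact: cf_constM.
have ep (K : pring) n : cf1p ((fconst (fconst c : qring) : pring) * K) n = (fconst c : qring) * cf1p K n by exact: cf_constM.
have ek (K : qring) n : cf1q ((fconst c : qring) * K) n = c * cf1q K n by exact: cf_constM.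
by rewrite /c3 ey ep ek.
Qed.

Lemma const3D c d : const3 (c + d) = const3 c + const3 d.
Proof.
rewrite -[LHS]mulr1 -[const3 c]mulr1 -[const3 d]mulr1.
by apply: c3P => N s k; rewrite c3D !c3_constM mulrDl.
Qed.

Lemma const3M c d : const3 (c * d) = const3 c * const3 d.
Proof.
by rewrite -[LHS]mulr1 -[const3 d]mulr1; apply: c3P => N s k; rewrite !c3_constM mulrA.
Qed.

Lemma const3_1 : const3 1 = 1.
Proof. by rewrite -[LHS]mulr1; apply: c3P => N s k; rewrite c3_constM mul1r. Qed.

Definition supp (S : nat -> nat -> nat -> bool) F :=
  forall N s k, ~~ S N s k -> c3 F N s k = 0.

Lemma suppM (S1 S2 S3 : nat -> nat -> nat -> bool) F H :
  (forall N s k N' s' k', S1 N s k -> S2 N' s' k' -> S3 (N + N')%N (s + s')%N (k + k')%N) ->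
  supp S1 F -> supp S2 H -> supp S3 (F * H).
Proof.
move=> S123 sF sH N s k h; rewrite c3M.
rewrite big1 // => i _; rewrite big1 // => j _; rewrite big1 // => l _.
have [S1i|/sF ->] := boolP (S1 i j l); last by rewrite mul0r.
have [S2i|/sH ->] := boolP (S2 (N - i) (s - j) (k - l))%N; last by rewrite mulr0.
move: (S123 _ _ _ _ _ _ S1i S2i); rewrite !subnKC ?(negPf h) // -ltnS; exact: ltn_ord.
Qed.

Definition symm (F : yring) := forall N s k, c3 F N s k = c3 F N k s.

Lemma symmM F H : symm F -> symm H -> symm (F * H).
Proof.
move=> sF sH N s k; rewrite !c3M; apply: eq_bigr => i _; rewrite exchange_big.
by apply: eq_bigr => l _; apply: eq_bigr => j _; rewrite sF sH.
Qed.

(** The derivation z d/dz: the exponent of z in the monomial of indices N, s, k is N - s. *)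
Definition Dz (F : yring) : yring := ser3 (fun N s k => (N%:R - s%:R) * c3 F N s k).

Lemma c3_Dz F N s k : c3 (Dz F) N s k = (N%:R - s%:R) * c3 F N s k.
Proof. by []. Qed.

#[local] Opaque Dz c3.

Lemma DzD F H : Dz (F + H) = Dz F + Dz H.
Proof. by apply: c3P => N s k; rewrite c3D !c3_Dz c3D mulrDr. Qed.

Lemma DzN F : Dz (- F) = - Dz F.
Proof. by apply: c3P => N s k; rewrite c3N !c3_Dz c3N mulrN. Qed.

Lemma Dz1 : Dz 1 = 0.
Proof.
apply: c3P => N s k; rewrite c3_Dz c31 c30.
by case: N => [|N]; case: s => [|s]; rewrite /= ?subrr ?mul0r ?mulr0.
Qed.

Lemma DzM F H : Dz (F * H) = Dz F * H + F * Dz H.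
Proof.
apply: c3P => N s k; rewrite (c3D (Dz F * H)).
rewrite (c3_Dz (F * H)).
rewrite (c3M F H).
rewrite (c3M (Dz F)).
rewrite (c3M F (Dz H)).
rewrite mulr_sumr.
rewrite -[RHS]big_split.
apply: eq_bigr => i _.
rewrite -[RHS]big_split mulr_sumr; apply: eq_bigr => j _.
rewrite -[RHS]big_split mulr_sumr; apply: eq_bigr => l _.
rewrite !c3_Dz !natrB -1?ltnS ?ltn_ord //=; move: (c3 F _ _ _) (c3 H _ _ _) => u v; ring.
Qed.

Lemma Dz_const c F : Dz (const3 c * F) = const3 c * Dz F.
Proof. by apply: c3P => N s k; rewrite c3_Dz !c3_constM c3_Dz mulrCA. Qed.

Lemma Dz_sum n (F : nat -> yring) : Dz (\sum_(i < n) F i) = \sum_(i < n) Dz (F i).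
Proof.
apply: c3P => N s k; rewrite c3_Dz c3_sum (@c3_sum _ (fun i => Dz (F i))) mulr_sumr.
by apply: eq_bigr => i _; rewrite c3_Dz.
Qed.

Lemma DzX F n : Dz (F ^+ n.+1) = const3 n.+1%:R * (F ^+ n * Dz F).
Proof.
have cS m : const3 m.+1%:R = const3 m%:R + 1.
  by rewrite -natr1 const3D const3_1.
elim: n => [|n IHn]; first by rewrite expr1 const3_1 expr0 !mul1r.
rewrite exprS DzM IHn [in RHS]cS; move: (const3 _) (Dz F) => c D.
by rewrite exprS; ring.
Qed.

Definition expS : fser pring := Fser (fun i => fconst (fconst (i`!%:R^-1) : qring)).

Section Exponential.

Variable K : yring.
Hypothesis K0 : cf1y K 0 = 0.

Definition expE : yring := comp expS K.

Lemma expE_part n : eqs n (expE : fser pring) (\sum_(i < n) const3 (i`!%:R^-1) * K ^+ i : yring).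
Proof. exact: comp_part. Qed.

Lemma c3_expE n N s k : (N < n)%N -> c3 expE N s k = \sum_(i < n) i`!%:R^-1 * c3 (K ^+ i) N s k.
Proof.
move=> Nn; have e : cf1y expE N = cf1y (\sum_(i < n) const3 (i`!%:R^-1) * K ^+ i) N := @expE_part n N Nn.
rewrite c3E e -c3E.
rewrite (@c3_sum _ (fun i => const3 i`!%:R^-1 * K ^+ i)).
by apply: eq_bigr => i _; rewrite c3_constM.
Qed.

Lemma Dz_expE : Dz expE = Dz K * expE.
Proof.
pose E n := \sum_(i < n) const3 (i`!%:R^-1) * K ^+ i.
have DE n : Dz (E n.+1) = Dz K * E n.
  rewrite /E (@Dz_sum _ (fun i => const3 i`!%:R^-1 * K ^+ i)) big_ord_recl expr0 Dz_const Dz1 mulr0 add0r.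
  rewrite mulr_sumr; apply: eq_bigr => i _; rewrite lift0 Dz_const DzX.
  have -> : const3 (i`!)%:R^-1 = const3 (i.+1)`!%:R^-1 * const3 i.+1%:R.
    by rewrite -const3M factS natrM invfM mulrAC mulVf ?mul1r // pnatr_eq0.
  by rewrite [RHS]mulrC !mulrA.
apply: c3P => N s k.
have -> : c3 (Dz expE) N s k = c3 (Dz (E N.+2)) N s k.
  rewrite !c3_Dz (@c3_expE N.+2) // (@c3_sum _ (fun i => const3 i`!%:R^-1 * K ^+ i)).
  by congr (_ * _); apply: eq_bigr => i _; rewrite c3_constM.
rewrite DE !c3M; apply: eq_bigr => i _; apply: eq_bigr => j _; apply: eq_bigr => l _.
congr (_ * _); rewrite (@c3_expE N.+1) ?ltnS ?leq_subr // (@c3_sum _ (fun i => const3 i`!%:R^-1 * K ^+ i)).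
by apply: eq_bigr => m _; rewrite c3_constM.
Qed.

Lemma symm_expE : symm K -> symm expE.
Proof.
move=> sK N s k; rewrite !(@c3_expE N.+1) //; apply: eq_bigr => i _; congr (_ * _).
case: i => j _ /=; elim: j N s k => [|j IHj] N s k.
  by rewrite expr0 !c31 [X in _ && X]andbC.
by rewrite exprS; apply: symmM.
Qed.

Lemma supp_expE (S : nat -> nat -> nat -> bool) : (forall N s k N' s' k', S N s k -> S N' s' k' -> S (N + N')%N (s + s')%N (k + k')%N) ->
  supp S K -> supp S (expE - 1).
Proof.
move=> SS sK N s k h; rewrite c3B (@c3_expE N.+1) //.
rewrite big_ord_recl expr0 fact0 invr1 mul1r addrC addKr.
apply: big1 => i _; rewrite lift0.
suff -> : c3 (K ^+ i.+1) N s k = 0 by rewrite mulr0.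
case: i => j _ /=; elim: j N s k h => [|j IHj] N s k h; first by rewrite expr1 sK.
by rewrite exprS (@suppM S S S).
Qed.

End Exponential.

(* Catalan number of index [N - 1], and 0 for [N = 0] because of x / 0 = 0. *)
Definition fcat N : rat := 'C(2 * N.-1, N.-1)%:R / N%:R.

Lemma fcat0 : fcat 0 = 0. Proof. by rewrite /fcat invr0 mulr0. Qed.

Lemma fcat_rec n : n.+2%:R * fcat n.+2 = (4 * n.+1%:R - 2) * fcat n.+1.
Proof.
have e : (n.+1 * 'C(2 * n.+1, n.+1) = 2 * (2 * n).+1 * 'C(2 * n, n))%N.
  have e1 := mul_bin_diag (2 * n.+1) n.
  have e2 : 'C((2 * n).+1, n) = 'C((2 * n).+1, n.+1) by rewrite -bin_sub; [congr 'C(_, _); lia | lia].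
  have e3 := mul_bin_diag (2 * n).+1 n.
  move: e1 e2 e3; have -> : (2 * n.+1 = (2 * n).+2)%N by lia.
  rewrite /= => e1 e2 e3; rewrite -e1 e2; nia.
have n1 : n.+1%:R != 0 :> rat by rewrite pnatr_eq0.
have n2 : n.+2%:R != 0 :> rat by rewrite pnatr_eq0.
rewrite /fcat -[n.+2.-1]/n.+1 -[n.+1.-1]/n.
have := congr1 (fun m => m%:R : rat) e; rewrite !natrM -[(2 * n).+1%:R]natr1 natrM.
move: ('C(_, _)%:R) ('C(_, _)%:R) => a b ea.
rewrite mulrCA mulfV // mulr1; apply: (mulfI n1); rewrite ea [RHS]mulrCA !mulrA [in RHS]mulrAC mulfK //.
by rewrite -natr1; ring.
Qed.

(** * The Catalan series and ballot numbers *)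

Section Euler.

Implicit Types F H : fser rat.

Definition Dx F : fser rat := Fser (fun n => n%:R * coefs F n).

Lemma cf_Dx F n : coefs (Dx F) n = n%:R * coefs F n. Proof. by []. Qed.

Lemma DxM F H : Dx (F * H) = Dx F * H + F * Dx H.
Proof.
apply: fserP => n; rewrite cfD cf_Dx !cfM -[RHS]big_split mulr_sumr; apply: eq_bigr => i _.
by rewrite !cf_Dx natrB -1?ltnS ?ltn_ord //=; ring.
Qed.

(** With d = 1 - 2 F and D = X d/dX, both d^2 and 1 - 4 X solve the linear equation D E = 4 X (D E -
    E), whose solutions are determined by their constant terms. *)
Lemma catalan : let F := Fser fcat in F - F ^+ 2 = X.
Proof.
move=> F; pose d := 1 - 2%:R * F.
have DB (A B : fser rat) : Dx (A - B) = Dx A - Dx B.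
  by apply: fserP => n; rewrite cfB !cf_Dx cfB mulrBr.
have c2 (A : fser rat) n : coefs (2%:R * A) n = 2%:R * coefs A n.
  by rewrite !mulr_natl cfMn.
have c4 (A : fser rat) n : coefs (4%:R * A) n = 4%:R * coefs A n.
  by rewrite !mulr_natl cfMn.
have DF : Dx F = X + 4%:R * (X * Dx F) - 2%:R * (X * F).
  apply: fserP => -[|[|n]]; rewrite cfB cfD c2 c4 !cfXM !cf_Dx /= ?fcat0 ?mulr0 ?mul0r ?subr0 ?addr0 //.
  rewrite -/(fcat n.+2) fcat_rec add0r mulrBl mulrA.
  by [].
have D1 : Dx 1 = 0.
  by apply: fserP => -[|n]; rewrite cf_Dx cf1 ?mul0r ?mulr0.
have D2 (A : fser rat) : Dx (2%:R * A) = 2%:R * Dx A.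
  by apply: fserP => n; rewrite c2 !cf_Dx c2 mulrCA.
have DX : Dx X = X by apply: fserP => -[|[|n]]; rewrite cf_Dx ?mul1r ?mulr0 ?mul0r.
have Dd : Dx (d * d) = 4%:R * (X * Dx (d * d)) - 4%:R * (X * (d * d)).
  have e : Dx d = - (2%:R * Dx F) by rewrite /d DB D1 D2 sub0r.
  rewrite DxM e; move: (Dx F) DF => G eG; rewrite {1 2}eG /d; ring.
have D4 (A : fser rat) : Dx (4%:R * A) = 4%:R * Dx A.
  by apply: fserP => n; rewrite c4 !cf_Dx c4 mulrCA.
have De : Dx (1 - 4%:R * X) = 4%:R * (X * Dx (1 - 4%:R * X)) - 4%:R * (X * (1 - 4%:R * X)).
  by rewrite DB D1 D4 DX; ring.
have dd : d * d = 1 - 4%:R * X.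
  have : d * d - (1 - 4%:R * X) = 0.
    set E := _ - _; have DE : Dx E = 4%:R * (X * Dx E) - 4%:R * (X * E).
      by rewrite /E DB {1}Dd {1}De; move: (Dx (d * d)) (Dx (1 - _)) (d * d) => a b c; ring.
    apply: fserP => n; rewrite cf0; elim: n => [|n IHn].
      rewrite /E cfB cfM big_ord1 !cfB !c2 c4 /= fcat0; ring.
    apply: (@mulfI _ n.+1%:R); first by rewrite pnatr_eq0.
    by rewrite -cf_Dx DE cfB !c4 !cfXM cf_Dx IHn !mulr0 subr0.
  by move/eqP; rewrite subr_eq0 => /eqP.
have : 4%:R * (F - F ^+ 2 - X) = 0.
  have -> : 4%:R * (F - F ^+ 2 - X) = (1 - 4%:R * X) - d * d by rewrite /d; ring.
  by rewrite dd subrr.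
move=> e; apply: fserP => n; apply/eqP; rewrite -subr_eq0 -cfB.
have := congr1 (fun A => coefs A n) e; rewrite c4 cf0 => /eqP.
by rewrite mulf_eq0 pnatr_eq0.
Qed.

End Euler.

(** Ballot numbers: for s < N, the coefficient of u^N in the power N - s of the series [Fser fcat]
    in u. *)
Definition bal N s : rat := if (s < N)%N then (N%:R - s%:R) / N%:R * 'C(N + s.-1, s)%:R else 0.

Lemma bal0 N : bal N.+1 0 = 1.
Proof. by rewrite /bal /= bin0 subr0 mulr1 divff // pnatr_eq0. Qed.

Lemma bal_last N : bal N.+1 N = fcat N.+1.
Proof.
rewrite /bal ltnSn /fcat -natr1 addrAC subrr add0r mul1r mulrC; congr (_%:R / _).
by case: N => [//|N]; congr 'C(_, _); rewrite /=; lia.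
Qed.

Lemma bal_rec N s : (s <= N)%N -> bal N.+2 s.+1 = bal N.+2 s + bal N.+1 s.+1.
Proof.
move=> sN.
have bN t M : (t <= M)%N -> bal M t = (M%:R - t%:R) / M%:R * 'C(M + t.-1, t)%:R.
  by rewrite leq_eqVlt /bal => /orP[/eqP <-|->] //; rewrite ltnn subrr !mul0r.
have [h1 h2 h3] : [/\ s < N.+2, s <= N.+2 & s < N.+1]%N by split; lia.
rewrite (bN _ _ h1) (bN _ _ h2) (bN _ _ h3).
rewrite /=; have -> : 'C(N.+2 + s.-1, s) = 'C(N + s.+1, s).
  by case: s {sN h1 h2 h3} => [|s]; [rewrite !bin0 | congr 'C(_, _); rewrite /=; lia].
have -> : (N.+2 + s = (N + s.+1).+1)%N by lia.
have -> : (N.+1 + s = N + s.+1)%N by lia.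
have e : (s.+1 * 'C(N + s.+1, s.+1) = N.+1 * 'C(N + s.+1, s))%N.
  by rewrite mul_bin_left; congr (_ * _)%N; lia.
have s1 : s.+1%:R != 0 :> rat by rewrite pnatr_eq0.
have n1 : N.+1%:R != 0 :> rat by rewrite pnatr_eq0.
have n2 : N.+2%:R != 0 :> rat by rewrite pnatr_eq0.
rewrite binS natrD; have := congr1 (fun m => m%:R : rat) e; rewrite !natrM.
move: ('C(_, s)%:R) ('C(_, s.+1)%:R) => b a ea.
have -> : a = N.+1%:R * b / s.+1%:R by rewrite -ea mulrAC mulfV ?mul1r.
move: s1 n1 n2; rewrite -!natr1 => s1 n1 n2; field.
by rewrite s1 n1 n2.
Qed.

(** The series 1 / (1 - q), that is 1 / (1 - 1/x). *)
Definition vq : qring := Fser (fun=> 1 : rat).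

Lemma vqX N k : cf1q (vq ^+ N) k = 'C(N + k.-1, k)%:R.
Proof.
elim: N k => [|N IHN] k.
  by rewrite expr0 /cf1q cf1; case: k => [|k] //; rewrite bin_small.
have -> : cf1q (vq ^+ N.+1) k = \sum_(l < k.+1) cf1q (vq ^+ N) l.
  by rewrite exprSr /cf1q cfM; apply: eq_bigr => l _; rewrite mulr1.
under eq_bigr => l _ do rewrite IHN.
elim: k => [|k IHk]; first by rewrite big_ord1 !bin0.
rewrite big_ord_recr IHk /= -natrD; congr _%:R.
case: k {IHk} => [|k]; first by rewrite /= !bin0 !bin1 !addn0 add1n.
by rewrite /= addSnnS [RHS]binS addnC.
Qed.

Definition wp : pring := X * (fconst vq : fser qring).

Lemma wpX N s : cf1p (wp ^+ N) s = if s == N then vq ^+ N else 0.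
Proof.
elim: N s => [|N IHN] s; first by rewrite !expr0 /cf1p cf1; case: s.
have -> : cf1p (wp ^+ N.+1) s = if s is s'.+1 then vq * cf1p (wp ^+ N) s' else 0.
  by rewrite exprS /wp -mulrA /cf1p cfXM; case: s => [//|s]; exact: cf_constM.
by case: s => [//|s]; rewrite IHN eqSS; case: eqP => _; rewrite ?mulr0 // exprS.
Qed.

Definition const2 (c : rat) : pring := fconst (fconst c : qring).

Lemma const2M c d : const2 (c * d) = const2 c * const2 d.
Proof. by rewrite /const2 !rmorphM. Qed.

(** Substitution of y p / (1 - q) = r x / (1 - 1/x) in a series of one variable. *)
Definition phi (F : fser rat) : yring := Fser (fun N => const2 (coefs F N) * wp ^+ N).

Lemma c3_phi F N s k : c3 (phi F) N s k = if s == N then coefs F N * 'C(N + k.-1, k)%:R else 0.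
Proof.
have -> : c3 (phi F) N s k = cf1q (cf1p (const2 (coefs F N) * wp ^+ N) s) k by rewrite c3E.
have -> : cf1p (const2 (coefs F N) * wp ^+ N) s = (fconst (coefs F N) : qring) * cf1p (wp ^+ N) s.
  exact: cf_constM.
rewrite wpX; have -> K : cf1q ((fconst (coefs F N) : qring) * K) k = coefs F N * cf1q K k by exact: cf_constM.
by case: eqP => _; rewrite ?vqX // mulr0.
Qed.

Lemma phiM F H : phi (F * H) = phi F * phi H.
Proof.
apply: fserP => N; rewrite [RHS]cfM.
have -> : coefs (phi (F * H)) N = const2 (\sum_(i < N.+1) coefs F i * coefs H (N - i)%N) * wp ^+ N by [].
have -> : const2 (\sum_(i < N.+1) coefs F i * coefs H (N - i)%N) =
    \sum_(i < N.+1) const2 (coefs F i * coefs H (N - i)%N) by rewrite /const2 !rmorph_sum.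
rewrite mulr_suml; apply: eq_bigr => i _.
have -> : coefs (phi F) i = const2 (coefs F i) * wp ^+ i by [].
have -> : coefs (phi H) (N - i)%N = const2 (coefs H (N - i)%N) * wp ^+ (N - i) by [].
rewrite const2M -!mulrA; congr (_ * _).
by rewrite mulrCA -exprD subnKC // -ltnS.
Qed.

Lemma phiB F H : phi (F - H) = phi F - phi H.
Proof.
by apply: c3P => N s k; rewrite c3B !c3_phi cfB; case: eqP => _; rewrite ?subr0 // mulrBl.
Qed.

(* In terms of x, z and r: with theta the root of theta - theta^2 = r x / (1 - 1/x),
   [yTheta] is z theta, [yP] is the sum of all (z theta)^n with n > 0, and [yU] is
   z r x / (1 - 1/x). *)
Definition yP : yring := ser3 (fun N s k => bal N s * 'C(N + k.-1, k)%:R).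
Definition yTheta : yring :=
  ser3 (fun N s k => if s.+1 == N then fcat N * 'C(N + k.-1, k)%:R else 0).
Definition yp : yring := ser3 (fun N s k => [&& N == 0, s == 1 & k == 0]%N%:R).
Definition yU : yring := ser3 (fun N s k => ((N == 1) && (s == 0))%N%:R).

Lemma c3_yp F N s k : c3 (yp * F) N s k = if s is s'.+1 then c3 F N s' k else 0.
Proof.
rewrite c3M big_ord_recl [X in _ + X]big1 ?addr0 => [|i _]; last first.
  by apply: big1 => j _; apply: big1 => l _; rewrite c3_ser3 mul0r.
case: s => [|s].
  by apply: big1 => j _; apply: big1 => l _; rewrite c3_ser3 (ord1 j) mul0r.
rewrite big_ord_recl [X in _ + X]big_ord_recl [X in X + _]big1 ?add0r => [|l _]; last by rewrite c3_ser3 mul0r.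
rewrite [X in _ + X]big1 ?addr0 => [|j _]; last by apply: big1 => l _; rewrite c3_ser3 mul0r.
rewrite big_ord_recl [X in _ + X]big1 ?addr0 => [|l _]; last by rewrite c3_ser3 mul0r.
by rewrite c3_ser3 mul1r !subn0 subn1.
Qed.

Lemma c3_yU F N s k : c3 (yU * F) N s k = if N is N'.+1 then \sum_(l < k.+1) c3 F N' s l else 0.
Proof.
rewrite c3M; case: N => [|N].
  by apply: big1 => i _; apply: big1 => j _; apply: big1 => l _; rewrite c3_ser3 (ord1 i) mul0r.
rewrite big_ord_recl [X in _ + X]big_ord_recl [X in X + _]big1 ?add0r => [|j _]; last first.
  by apply: big1 => l _; rewrite c3_ser3 mul0r.
rewrite [X in _ + X]big1 ?addr0 => [|i _]; last first.
  by apply: big1 => j _; apply: big1 => l _; rewrite c3_ser3 mul0r.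
rewrite big_ord_recl [X in _ + X]big1 ?addr0 => [|j _]; last first.
  by apply: big1 => l _; rewrite c3_ser3 mul0r.
rewrite (reindex_inj rev_ord_inj); apply: eq_bigr => l _.
rewrite c3_ser3 mul1r subn0 subn1 /=; congr (c3 _ _ _ _).
by have := ltn_ord l; lia.
Qed.

Lemma bin_hockey N k : \sum_(l < k.+1) 'C(N + l.-1, l)%:R = 'C(N.+1 + k.-1, k)%:R :> rat.
Proof.
rewrite -vqX exprSr /cf1q cfM; apply: eq_bigr => l _.
by rewrite mulr1 -[RHS]/(cf1q _ _) vqX.
Qed.

(** Multiplied by p, this is the image of [catalan] under [phi]; multiplication by p only shifts the
    index s, so it can be cancelled. *)
Lemma yTheta_quad : yTheta - yp * yTheta ^+ 2 = yU.
Proof.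
have eT : yp * yTheta = phi (Fser fcat).
  apply: c3P => N [|s] k; rewrite c3_yp c3_phi; last by rewrite c3_ser3.
  by case: N => [|N] //=; rewrite fcat0 mul0r.
have eU : yp * yU = phi X.
  apply: c3P => N [|s] k; rewrite c3_yp c3_phi; first by case: N => [|N] //=; rewrite mul0r.
  rewrite c3_ser3; have [<-|ne] := eqVneq s.+1 N.
    case: s => [|s]; last by rewrite mul0r.
    by case: k => [|k]; rewrite mul1r ?bin0 // add1n binn.
  by case: eqP => // e; case: eqP => // e'; rewrite e e' in ne.
have : yp * (yTheta - yp * yTheta ^+ 2) = yp * yU.
  rewrite eU -catalan phiB expr2 phiM -eT; ring.
by move=> e; apply: c3P => N s k; have := congr1 (fun F => c3 F N s.+1 k) e; rewrite !c3_yp.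
Qed.

(** This is the recursion [bal_rec] of the ballot numbers, the sum over k that comes from [yU] being
    evaluated by [bin_hockey]. *)
Lemma yP_lin : (yp - 1 + yU) * yP + yU = yp * yTheta.
Proof.
have -> : (yp - 1 + yU) * yP + yU = yp * yP - yP + yU * yP + yU by ring.
apply: c3P => N s k; rewrite !c3D c3N !c3_yp c3_yU !c3_ser3.
have hockey M t : \sum_(l < k.+1) c3 yP M t l = bal M t * 'C(M.+1 + k.-1, k)%:R.
  by rewrite -bin_hockey mulr_sumr; apply: eq_bigr => l _; rewrite c3_ser3.
have b0 t M : (M <= t)%N -> bal M t = 0 by rewrite /bal leqNgt => /negPf ->.
case: N => [|N].
  by case: s => [|s]; rewrite ?c3_ser3 !b0 // !mul0r subr0 addr0 /= addr0.
rewrite hockey; case: N => [|N].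
  rewrite (b0 _ 0%N) // mul0r addr0; case: s => [|s]; rewrite ?c3_ser3.
    rewrite bal0 mul1r add0r; have -> : 'C(1 + k.-1, k)%:R = 1 :> rat; last by rewrite addNr.
    by case: k {hockey} => [|k]; rewrite ?bin0 // add1n binn.
  rewrite (b0 s.+1) // mul0r subr0 addr0; case: s => [|s].
    by rewrite eqxx /= (bal_last 0).
  by rewrite b0 // mul0r.
rewrite addr0; case: s => [|s]; rewrite ?c3_ser3; first by rewrite !bal0 add0r addNr.
rewrite -mulrBl -mulrDl eqSS; have [sN|Ns] := leqP s N.
  rewrite (bal_rec sN) (_ : (s == N.+1) = false); last by lia.
  by rewrite opprD addrA subrr add0r addNr mul0r.
rewrite (b0 s.+1 N.+1) ?addr0 ?(leq_trans Ns) //.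
have [->|sN] := eqVneq s N.+1; first by rewrite (b0 N.+2) // subr0 bal_last.
by rewrite !b0 ?subr0 ?mul0r //; lia.
Qed.

(** By [yTheta_quad] the geometric series satisfies the same linear equation as [yP]. The factor p -
    1 + U can be cancelled: if it kills E, then E = p E + U E, whose right side involves only
    smaller s or smaller N. *)
Lemma yP_geom : yP = yTheta + yTheta * yP.
Proof.
pose k0 := yp - 1 + yU.
have : k0 * (yP - (yTheta + yTheta * yP)) = 0.
  have -> : k0 * (yP - (yTheta + yTheta * yP)) = (k0 * yP + yU) * (1 - yTheta) - k0 * yTheta - yU + yU * yTheta.
    by ring.
  rewrite yP_lin /k0.
  have -> : yp * yTheta * (1 - yTheta) - (yp - 1 + yU) * yTheta - yU + yU * yTheta =
    yTheta - yp * yTheta ^+ 2 - yU by ring.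
  by rewrite yTheta_quad subrr.
move=> h; apply/eqP; rewrite -subr_eq0; move: (_ - _) h => E /eqP.
rewrite (_ : k0 * E = yp * E + yU * E - E) ?subr_eq0; last by rewrite /k0; ring.
move=> /eqP/esym hE; apply/eqP; apply: c3P.
elim/ltn_ind=> N IHN; elim=> [|s IHs] k; rewrite hE c3D c3_yp c3_yU c30.
  by rewrite add0r; case: N IHN => // N IHN; apply: big1 => l _; rewrite IHN.
by rewrite IHs add0r; case: N IHN {IHs} => // N IHN; apply: big1 => l _; rewrite IHN.
Qed.

(* The logarithm of the solution: the part with positive powers of x of the sum
   of all (z theta)^n / n. Its symmetry in x and z gives that of the solution. *)
Definition yK : yring := ser3 (fun N s k =>
  if (s < N)%N && (k < N)%N then 'C(N + s.-1, s)%:R * 'C(N + k.-1, k)%:R / N%:R else 0).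

Lemma yK0 : cf1y yK 0 = 0.
Proof. by apply: fserP => s; apply: fserP => k; rewrite -[LHS]/(c3 yK 0 s k). Qed.

Definition yH : yring := expE yK.

Lemma symm_yH : symm yH.
Proof.
apply: (symm_expE yK0) => N s k; rewrite !c3_ser3 andbC; case: ifP => // _.
by rewrite [X in X / _]mulrC.
Qed.

Lemma Dz_yK N s k : c3 (Dz yK) N s k = if (k < N)%N then c3 yP N s k else 0.
Proof.
rewrite c3_Dz !c3_ser3 /bal; case: ltnP => _ /=; last by rewrite mulr0 mul0r if_same.
by case: ifP => _; rewrite ?mulr0 //; ring.
Qed.

Lemma yH_z N s k : (N <= s)%N -> c3 (yH - 1) N s k = 0.
Proof.
move=> Ns; apply: (@supp_expE yK yK0 (fun N s k => s < N)%N) => [||]; rewrite -?leqNgt //.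
  by move=> *; lia.
by move=> N' s' k' h; rewrite c3_ser3 (negPf h).
Qed.

Lemma yH_x N s k : (N <= k)%N -> c3 (yH - 1) N s k = 0.
Proof.
move=> Ns; apply: (@supp_expE yK yK0 (fun N s k => k < N)%N) => [||]; rewrite -?leqNgt //.
  by move=> *; lia.
by move=> N' s' k' h; rewrite c3_ser3 (negPf h) andbF.
Qed.

(* Spitzer's factorization: [(1 - Theta) * H] has no positive power of x. *)
Lemma yH_rec N s k : (k < N)%N -> c3 yH N s k = c3 (yTheta * yH) N s k.
Proof.
pose W := (1 - yTheta) * yH; pose M := yP - Dz yK.
have DT : Dz yTheta = yTheta.
  apply: c3P => N' s' k'; rewrite c3_Dz !c3_ser3; case: eqP => [<-|_]; last by rewrite mulr0.
  by rewrite -natr1 addrAC subrr add0r mul1r.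
(* The logarithmic derivative of 1 - [yTheta] is - [yP] and that of [yH] is [Dz yK], the part of
   [yP] with positive powers of x. Only the other part [M] survives in that of [W]. *)
have DW : Dz W = - (M * W).
  rewrite /W DzM DzD DzN Dz1 DT sub0r Dz_expE ?yK0 // -/yH.
  have hT : yP - yTheta * yP = yTheta by rewrite {1}yP_geom addrK.
  have -> : - yTheta * yH = - (yP - yTheta * yP) * yH by rewrite hT.
  by rewrite /M; ring.
have Mpos N' s' k' : (k' < N')%N -> c3 M N' s' k' = 0.
  by move=> h; rewrite c3B Dz_yK h subrr.
have M0 s' k' : c3 M 0 s' k' = 0 by rewrite c3B Dz_yK c3_ser3 /bal /= mul0r subrr.
suff W0 : forall N s k, (k < N)%N -> c3 W N s k = 0.
  by move=> kN; move: (W0 N s k kN); rewrite /W mulrBl mul1r c3B => /eqP; rewrite subr_eq0 => /eqP.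
elim/ltn_ind=> {s k}N IHN s k kN.
(* [Dz] kills the monomials without z. For these the claim is direct, since H - 1 and [yTheta * yH]
   have only positive powers of z. *)
have [sN|sN] := eqVneq s N.
  have -> : W = (yH - 1) - yTheta * yH + 1 by rewrite /W; ring.
  rewrite c3D c3B yH_z ?sN // sub0r c31 (_ : (N == 0)%N = false); last by lia.
  rewrite addr0 -sN; apply/eqP; rewrite oppr_eq0; apply/eqP.
  apply: (@suppM (fun N s k => s < N)%N (fun N s k => s <= N)%N (fun N s k => s < N)%N) => [|||].
  - by move=> *; lia.
  - by move=> N' s' k' h; rewrite c3_ser3 (_ : (s'.+1 == N')%N = false) //; apply/negbTE; apply: contraNneq h => <-.
  - move=> N' s' k'; rewrite -ltnNge => h; rewrite -[yH](subrK 1) c3D yH_z ?add0r ?(ltnW h) // c31.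
    by case: s' h => [|s'] // _; rewrite andbF.
  - by rewrite -leqNgt.
have nz : N%:R - s%:R != 0 :> rat by rewrite subr_eq0 eqr_nat eq_sym.
apply: (mulfI nz); rewrite mulr0 -c3_Dz DW c3N c3M.
rewrite big1 ?oppr0 // => i _; apply: big1 => j _; apply: big1 => l _.
have [li|il] := ltnP l i; first by rewrite Mpos // mul0r.
case: (posnP i) => [i0|i0]; first by rewrite i0 M0 mul0r.
rewrite IHN ?mulr0 //; have := ltn_ord i; have := ltn_ord l; lia.
Qed.

(* Coefficient of r^i x^(i - l) in theta. *)
Definition tcf i l : rat := fcat i * 'C(i + l.-1, l)%:R.

Lemma c3_Theta F N s k : c3 (yTheta * F) N s k =
  \sum_(i < N.+1) if (0 < i)%N && (i <= s.+1)%N then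
    \sum_(l < k.+1) tcf i l * c3 F (N - i) (s.+1 - i) (k - l) else 0.
Proof.
rewrite c3M; apply: eq_bigr => -[[|i] iN] _ /=.
  by rewrite big1 // => j _; apply: big1 => l _; rewrite c3_ser3 mul0r.
rewrite ltnS; have [si|si] := leqP i s.
  have h : (i < s.+1)%N by [].
  rewrite (bigD1 (Ordinal h)) //= [X in _ + X]big1 ?addr0 => [|j].
    by apply: eq_bigr => l _; rewrite c3_ser3 eqxx subSS.
  rewrite -val_eqE /= => ji; apply: big1 => l _.
  by rewrite c3_ser3 eqSS (negPf ji) mul0r.
apply: big1 => j _; apply: big1 => l _; rewrite c3_ser3 eqSS.
by rewrite (_ : (_ == _) = false) ?mul0r //; have := ltn_ord j; lia.
Qed.

(* Coefficient of z^(a+1) x^(b+1) in [yH], as a series in r. *)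
Definition Hh a b : fser rat :=
  Fser (fun N => if (a < N)%N && (b < N)%N then c3 yH N (N - a.+1) (N - b.+1) else 0).

Lemma cf_Hh a b N : coefs (Hh a b) N =
  if (a < N)%N && (b < N)%N then c3 yH N (N - a.+1) (N - b.+1) else 0.
Proof. by []. Qed.

Lemma Hh_sym a b : Hh a b = Hh b a.
Proof. by apply: fserP => N; rewrite !cf_Hh andbC; case: ifP => // _; apply: symm_yH. Qed.

Lemma Hh_small a b N : (N <= a)%N || (N <= b)%N -> coefs (Hh a b) N = 0.
Proof. by rewrite cf_Hh => h; rewrite (_ : _ && _ = false) //; lia. Qed.

(** For the first power of z in [yTheta * yH] only the constant term of [yH] contributes, so H_1 is
    the part of theta with positive powers of x. *)
Lemma cf_Hh0 b N : coefs (Hh 0 b) N = if (b < N)%N then tcf N (N.-1 - b) else 0.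
Proof.
rewrite cf_Hh; case: N => [//|N]; rewrite andTb; case: ifP => // bN.
rewrite yH_rec ?subSS ?ltnS ?leq_subr // subn0 c3_Theta big_ord_recr /= ltnSn.
rewrite big1 ?add0r => [|i _].
  rewrite subnn big_ord_recr /= subnn big1 ?add0r => [|l _].
    by rewrite -[yH](subrK 1) c3D yH_z // add0r c31 mulr1.
  rewrite -[yH](subrK 1) c3D yH_z // add0r c31 (_ : (_ - _ == 0)%N = false) ?mulr0 //.
  by have := ltn_ord l; lia.
case: ifP => // _; apply: big1 => l _; rewrite -[yH](subrK 1) c3D yH_z // add0r c31.
by rewrite (_ : (_ - _ == 0)%N = false) ?mulr0 //; have := ltn_ord i; lia.
Qed.

(** Terms beyond N vanish, so the bound [L] is free; it may depend on i, which later allows the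
    inner sum to be cut at l = i. *)
Lemma cf_HhS (L : nat -> nat) a b N : (forall i, N <= L i)%N ->
  coefs (Hh a.+1 b) N = \sum_(i < N.+1) \sum_(l < L i | (i <= b + l)%N)
    tcf i l * coefs (Hh a (b + l - i)) (N - i).
Proof.
move=> NL; rewrite cf_Hh.
have tcf0 l : tcf 0 l = 0 by rewrite /tcf fcat0 mul0r.
have [aN|Na] := ltnP a.+1 N; last first.
  rewrite big1 // => -[[|i] iN] _; rewrite [nat_of_ord _]/=; first by apply: big1 => l _; rewrite tcf0 mul0r.
  by apply: big1 => l _; rewrite Hh_small ?mulr0 //; lia.
have [bN|Nb] := ltnP b N; last first.
  by rewrite big1 // => i _; apply: big1 => l li; rewrite Hh_small ?mulr0 //; lia.
rewrite yH_rec; last by lia.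
rewrite c3_Theta; apply: eq_bigr => -[[|i] iN] _; rewrite [nat_of_ord _]/=.
  by rewrite [RHS]big1 // => l _; rewrite tcf0 mul0r.
rewrite andTb; have [ai|ai] := leqP i.+1 (N - a.+2).+1; last first.
  by rewrite [RHS]big1 // => l _; rewrite Hh_small ?mulr0 //; lia.
have -> : (N - b.+1).+1 = (N - b)%N by lia.
rewrite (@big_ord_widen _ _ _ _ (L i.+1) (fun l => tcf i.+1 l * c3 yH (N - i.+1) ((N - a.+2).+1 - i.+1) (N - b.+1 - l))); last by have := NL i.+1; lia.
rewrite big_mkcond [RHS]big_mkcond; apply: eq_bigr => l _.
case: ifP => lN; case: ifP => il //.
- rewrite cf_Hh (_ : _ && _ = true); last by lia.
  by congr (_ * c3 _ _ _ _); lia.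
- rewrite -[yH](subrK 1) c3D yH_x ?add0r ?c31; last by lia.
  by rewrite (_ : (_ - _ == 0)%N = false) ?mulr0 //; lia.
- by rewrite Hh_small ?mulr0 //; lia.
Qed.

Lemma big_ord_swap (V : nmodType) (m n : nat) (F : nat -> V) :
  \sum_(e < m | (e < n)%N) F e = \sum_(e < n | (e < m)%N) F e.
Proof.
rewrite (big_ord_widen_cond (m + n) (fun e => (e < n)%N)) ?leq_addr //.
rewrite [RHS](big_ord_widen_cond (m + n) (fun e => (e < m)%N)) ?leq_addl //.
by apply: eq_bigl => e; rewrite andbC.
Qed.

(* Coefficient of x^-j in theta. *)
Definition ccf j : fser rat := Fser (fun i => tcf i (i + j)).

(** Terms with l < i come from positive powers of x in theta, whose coefficients are the series
    [Hh 0 _]; terms with l = i + j come from x^-j. *)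
Lemma Hh_rec_part d a b N : (N <= d)%N -> coefs (Hh a.+1 b) N =
  \sum_(k < b) coefs (Hh a k * Hh 0 (b.-1 - k)) N + \sum_(j < d) coefs (ccf j * Hh a (b + j)) N.
Proof.
move=> Nd; rewrite (@cf_HhS (fun i => (i + d)%N)); last by move=> i; lia.
under eq_bigr => i _ do rewrite big_split_ord.
rewrite big_split; congr (_ + _); last first.
  under [RHS]eq_bigr => j _ do rewrite cfM.
  rewrite [RHS]exchange_big; apply: eq_bigr => i _.
  rewrite big_mkcond; apply: eq_bigr => j _ /=; rewrite ifT; last by lia.
  by congr (_ * coefs (Hh _ _) _); lia.
rewrite [RHS](reindex_inj rev_ord_inj).
under [RHS]eq_bigr => j _ do rewrite mulrC cfM.
rewrite [RHS]exchange_big; apply: eq_bigr => i _.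
pose F e := tcf i (i.-1 - e) * coefs (Hh a (b.-1 - e)) (N - i).
transitivity (\sum_(e < i | (e < b)%N) F e).
  rewrite (reindex_inj rev_ord_inj); apply: eq_big => [l|l]; rewrite /=; have := ltn_ord l.
    by lia.
  by move=> lti li; rewrite -!/(coefs (Hh _ _) _) /F; congr (tcf _ _ * coefs (Hh _ _) _); lia.
rewrite big_ord_swap big_mkcond; apply: eq_bigr => e _; rewrite [nat_of_ord (rev_ord _)]/=.
rewrite (_ : (b.-1 - (b - e.+1))%N = e); last by have := ltn_ord e; lia.
rewrite cf_Hh0; case: ifP => _; last by rewrite mul0r.
by rewrite /F; congr (_ * coefs (Hh _ _) _); have := ltn_ord e; lia.
Qed.

(** A Vandermonde convolution, obtained by multiplying two powers of 1 / (1 - q). It expresses the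
    nonpositive part of theta through H_1, as the system requires. *)
Lemma ccfE n j : eqs n (ccf j) (\sum_(i < n) 'C(i + j, i)%:R * Hh 0 i).
Proof.
move=> N Nn; rewrite cf_sum.
have -> : \sum_(i < n) coefs ('C(i + j, i)%:R * Hh 0 i) N =
    fcat N * \sum_(i < n | (i < N)%N) 'C(i + j, i)%:R * 'C(N + (N.-1 - i).-1, N.-1 - i)%:R.
  rewrite mulr_sumr [RHS]big_mkcond; apply: eq_bigr => i _.
  rewrite mulr_natl cfMn cf_Hh0; case: ifP => _; last by rewrite mul0rn.
  by rewrite -[LHS]mulr_natl /tcf mulrCA.
rewrite -[LHS]/(tcf N (N + j)) /tcf.
case: N Nn => [|N] Nn; first by rewrite fcat0 !mul0r.
congr (_ * _).
rewrite -(big_ord_widen n (fun i => 'C(i + j, i)%:R * 'C(N.+1 + (N.+1.-1 - i).-1, N.+1.-1 - i)%:R)); last by lia.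
transitivity (cf1q (vq ^+ j.+1 * vq ^+ N.+1) N).
  rewrite -exprD vqX; congr _%:R; rewrite -bin_sub; last by lia.
  have -> : (N.+1 + (N.+1 + j).-1 - (N.+1 + j) = N)%N by lia.
  by case: N Nn => [|N] Nn; [rewrite ?bin0 | congr 'C(_, _); rewrite /=; lia].
rewrite /cf1q cfM; apply: eq_bigr => i _; rewrite -!/(cf1q _ _) !vqX; congr (_%:R * _).
by case: (nat_of_ord i) => [|m]; [rewrite !bin0 | congr 'C(_, _); rewrite /=; lia].
Qed.

Lemma big_triangle (V : nmodType) n (F : nat -> nat -> V) :
  \sum_(d < n) \sum_(i < d.+1) F i (d - i)%N = \sum_(i < n) \sum_(j < n - i) F i j.
Proof.
elim: n => [|n IHn]; first by rewrite !big_ord0.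
rewrite big_ord_recr IHn [RHS]big_ord_recr /= subSnn big_ord1 [X in _ + X]big_ord_recr /= subnn addrA.
congr (_ + _); rewrite -big_split; apply: eq_bigr => i _.
by rewrite subSn ?big_ord_recr // ltnW.
Qed.

Lemma Hh_rec n a b : eqs n (Hh a.+1 b) (\sum_(k < b) Hh a k * Hh 0 (b.-1 - k)%N +
  \sum_(d < n) \sum_(i < d.+1) 'C(d, i)%:R * (Hh 0 i * Hh a (b + (d - i))%N)).
Proof.
move=> N Nn; rewrite (@Hh_rec_part n) ?(ltnW Nn) // cfD cf_sum; congr (_ + _).
pose F i j := 'C(i + j, i)%:R * (Hh 0 i * Hh a (b + j)).
have -> : \sum_(d < n) \sum_(i < d.+1) 'C(d, i)%:R * (Hh 0 i * Hh a (b + (d - i))%N) =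
    \sum_(d < n) \sum_(i < d.+1) F i (d - i)%N.
  by apply: eq_bigr => d _; apply: eq_bigr => i _; rewrite /F subnKC // -ltnS.
rewrite big_triangle.
have F0 i j : (n - i <= j)%N -> coefs (F i j) N = 0.
  move=> ij; rewrite /F mulr_natl cfMn cfM big1 ?mul0rn // => l _.
  have [li|il] := leqP l i; first by rewrite [coefs (Hh 0 i) l]Hh_small ?mul0r // li orbT.
  by rewrite [coefs (Hh a _) _]Hh_small ?mulr0 //; lia.
rewrite cf_sum; have -> : \sum_(i < n) coefs (\sum_(j < n - i) F i j) N = \sum_(i < n) \sum_(j < n) coefs (F i j) N.
  apply: eq_bigr => i _; rewrite cf_sum (@big_ord_widen _ _ _ _ n (fun j => coefs (F i j) N)) ?leq_subr //.
  by rewrite big_mkcond; apply: eq_bigr => j _; case: ltnP => // h; rewrite F0.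
rewrite [RHS]exchange_big; apply: eq_bigr => j _.
rewrite (eqsM (@ccfE n j) (@eqs_refl _ n _)) // mulr_suml cf_sum.
by apply: eq_bigr => i _; rewrite /F mulrA.
Qed.

Lemma cf_Hh00 N : coefs (Hh 0 0) N = if N is n.+1 then n.+1%:R^-1 * 'C(2 * n, n)%:R ^+ 2 else 0.
Proof.
rewrite cf_Hh0; case: N => [//|n]; rewrite ltn0Sn /tcf /fcat /= subn0 mulrAC mulrC expr2.
congr (_ * (_ * _%:R)); case: n => [|n] //; congr 'C(_, _); rewrite /=; lia.
Qed.

Lemma Hh01 : 2%:R * Hh 0 1 = Hh 0 0 - X.
Proof.
apply: fserP => N; rewrite mulr_natl cfMn cfB !cf_Hh0; case: N => [|[|N]]; first by rewrite subr0.
  by have -> : tcf 1 (1.-1 - 0) = 1 by apply/eqP; vm_compute.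
rewrite /= subr0 subn0 subn1 /= /tcf -mulrnAr; congr (_ * _).
rewrite -mulr_natl -natrM; congr _%:R.
case: N => [//|N].
have e := binS (N.+3 + N) N.+1.
have e2 : 'C(N.+3 + N, N.+2) = 'C(N.+3 + N, N.+1).
  by rewrite -bin_sub; [congr 'C(_, _); lia | lia].
by rewrite -[N.+1.-1]/N -[N.+2.-1]/N.+1 addnS e e2 mul2n addnn.
Qed.

(** * Compositional inverses *)

Import Order.TTheory.

Lemma comp_eqsr (A : comNzRingType) n (F R R' : fser A) : coefs R 0%N = 0 -> coefs R' 0%N = 0 ->
  eqs n R R' -> eqs n (comp F R) (comp F R').
Proof.
move=> R0 R0' e; apply: eqs_trans (@comp_part _ F _ n R0) _.
refine (eqs_trans _ (eqs_sym (@comp_part _ F _ n R0'))).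
apply: eqs_sum => i _; apply: eqsM => //.
by elim: (nat_of_ord i) => [//|k IHk]; rewrite !exprS; apply: eqsM.
Qed.

Section Inversion.

Variables (A : comNzRingType) (T : fser A).
Hypotheses (T0 : coefs T 0%N = 0) (T1 : coefs T 1%N = 1).

Let S : fser A := Fser (fun n => coefs T n.+2).

Lemma comp_quad R : coefs R 0%N = 0 -> comp T R = R + R * (R * comp S R).
Proof.
move=> R0; have {1}-> : T = X + X * (X * S).
  by apply: fserP => -[|[|n]]; rewrite cfD !cfXM ?add0r //= addr0.
by rewrite compD // !compM // compX.
Qed.

Lemma quad_gain n R R' : coefs R 0%N = 0 -> coefs R' 0%N = 0 -> eqs n R R' ->
  eqs n.+1 (R * (R * comp S R)) (R' * (R' * comp S R')).
Proof.
move=> R0 R0' e; apply: (@eqsM_gain _ n 1 _ _ _ _ e (eqsM e (comp_eqsr S R0 R0' e))).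
- by case.
- by case=> // _; rewrite cfM big_ord1 R0 mul0r.
Qed.

Lemma comp_inj n R R' : coefs R 0%N = 0 -> coefs R' 0%N = 0 ->
  eqs n (comp T R) (comp T R') -> eqs n R R'.
Proof.
move=> R0 R0' e; elim: {-2}n (leqnn n) => [//|m IHm] mn.
have em := IHm (ltnW mn).
have -> : R = comp T R - R * (R * comp S R) by rewrite comp_quad // addrK.
have -> : R' = comp T R' - R' * (R' * comp S R') by rewrite (@comp_quad R') // addrK.
by apply: eqsB; [apply: eqs_le e | apply: quad_gain].
Qed.

(** With T = X + X^2 S, the inverse is the fixed point of R -> X - R^2 S(R). By [quad_gain] this map
    gains one order of agreement, so the iterates from 0 converge coefficientwise and the diagonal
    is their limit. *)
Lemma comp_inverse : exists2 R : fser A, coefs R 0%N = 0 & comp T R = X.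
Proof.
pose step R := X - R * (R * comp S R).
have [r [rz rS]] : exists r : nat -> fser A, r 0%N = 0 /\ forall n, r n.+1 = step (r n).
  by exists (fun n => iter n step 0).
have r0 n : coefs (r n) 0%N = 0.
  elim: n => [|n IHn]; [by rewrite rz | rewrite rS /step cfB].
  have -> : coefs (r n * (r n * comp S (r n))) 0%N = 0 by rewrite cfM big_ord1 IHn mul0r.
  exact: subr0.
have step_gain n R R' : coefs R 0%N = 0 -> coefs R' 0%N = 0 -> eqs n R R' -> eqs n.+1 (step R) (step R').
  by move=> R0 R0' e; exact: (eqsB (eqs_refl _) (quad_gain R0 R0' e)).
have rn n : eqs n (r n) (r n.+1) by elim: n => [//|n IHn]; rewrite (rS n.+1) {1}rS; exact: (step_gain _ _ _ (r0 n) (r0 n.+1) IHn).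
have rle n k : eqs n (r n) (r (k + n)%N).
  elim: k => [//|k IHk]; apply: eqs_trans IHk _; apply: eqs_le (rn _); exact: leq_addl.
pose R : fser A := Fser (fun n => coefs (r n.+1) n).
have R0 : coefs R 0%N = 0 := r0 1%N.
have Rn n : eqs n R (r n).
  move=> m mn; rewrite [LHS](@rle m.+1 (n - m.+1)%N m) //; congr (coefs (r _) m); lia.
exists R => //; rewrite comp_quad //.
suff {1}-> : R = step R by rewrite /step subrK.
apply: eqs_eq => n; apply: eqs_trans (eqs_le (leqnSn n) (Rn n.+1)) _; rewrite rS.
exact: (eqs_le (leqnSn n) (step_gain _ _ _ (r0 n) R0 (eqs_sym (Rn n)))).
Qed.

End Inversion.

Lemma comp_natM (A : comNzRingType) k (F R : fser A) : coefs R 0%N = 0 ->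
  comp (k%:R * F) R = k%:R * comp F R.
Proof.
move=> R0; rewrite !mulr_natl; elim: k => [|k IHk]; first by rewrite !mulr0n comp0.
by rewrite !mulrS compD // IHk.
Qed.

Definition tser : fser rat := Hh 0 0.

Lemma tser0 : coefs tser 0%N = 0. Proof. by rewrite cf_Hh00. Qed.

Lemma tser1 : coefs tser 1%N = 1.
Proof. by rewrite cf_Hh00 muln0 bin0 expr1n mulr1 invr1. Qed.

(** Substituting rho = r(X^3) in [Hh] preserves the recursion and gives the prescribed value X^3 at
    (0, 0). By uniqueness the result is [Hz], and [Hh01] is compared with [Hz01]. *)
Lemma gser_tser r : coefs r 0%N = 0 -> comp tser r = X ->
  2%:R * (X ^+ 2 * (1 + 2%:R * gser)) = X - r.
Proof.
move=> r0 Tr; have p3 : (0 < 3)%N by [].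
have X0 : coefs (X ^+ 3 : fser rat) 0%N = 0 by rewrite cfXn.
pose rho := str 3 r; have rho0 : coefs rho 0%N = 0 by rewrite cf_str.
have Trho : comp tser rho = X ^+ 3.
  by rewrite /rho /str -(comp_assoc tser r0 X0) Tr (compX X0).
have solT : is_sol (fun a b => comp (Hh a b) rho).
  split=> [|a b|a b|n a b].
  - exact: Trho.
  - by rewrite Hh_sym.
  - rewrite -[X in eqs 1 _ X](comp0 rho); apply: (comp_eqs rho0) => -[|//] _.
    by rewrite Hh_small.
  - apply: eqs_trans (comp_eqs rho0 (@Hh_rec n a b)) _.
    rewrite (compD _ _ rho0) !(comp_sum _ _ rho0); apply: eqsD.
      by apply: eqs_sum => k _; rewrite (compM _ _ rho0).
    apply: eqs_sum => d _; rewrite (comp_sum _ _ rho0); apply: eqs_sum => i _.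
    by rewrite (comp_natM _ _ rho0) (compM _ _ rho0).
have H01 : 2%:R * Hz 0 1 = X ^+ 3 - rho.
  rewrite (is_sol_unique Hz_sol solT) -(comp_natM _ _ rho0) Hh01 -/tser.
  by rewrite (compD _ _ rho0) (compN _ rho0) Trho (compX rho0).
apply: (@str_inj _ 3 p3).
move: H01; rewrite Hz01 (strM p3) (@str2 _ p3) (strM p3 (X ^+ 2)) (strD p3 1) (str1 _ _).
rewrite (strM p3 2%:R) (@str2 _ p3) expr2 (strM p3 X) (@strX _ _ p3) -exprD => ->.
have strN F : str 3 (- F) = - str 3 F :> fser rat by apply: compN X0.
by rewrite (strD p3) strN (@strX _ _ p3).
Qed.

Lemma cf_tser n : coefs tser n.+1 = n.+1%:R^-1 * 'C(2 * n, n)%:R ^+ 2.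
Proof. exact: cf_Hh00. Qed.

(** * Translation to the series of the statement *)

Lemma fps_mulE F H n : fps_mul F H n = coefs (Fser F * Fser H) n.
Proof. by []. Qed.

Lemma fps_expE F k n : fps_exp F k n = coefs (Fser F ^+ k) n.
Proof.
elim: k n => [|k IHk] n; first by rewrite expr0 cf1.
by rewrite exprS cfM; apply: eq_bigr => i _; rewrite -IHk.
Qed.

Lemma XE : Fser fps_X = X :> fser rat. Proof. by []. Qed.

Lemma is_RE R : is_R R <-> R 0%N = 0 /\ comp tser (Fser R) = X.
Proof.
pose u n m := (n.+1%:R)^-1 * ('C(2 * n, n)%:R) ^+ 2 * fps_exp R n.+1 m.
have part : R 0%N = 0 -> forall m N, (m <= N)%N -> \sum_(n < N) u n m = coefs (comp tser (Fser R)) m.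
  move=> R0 m N mN; rewrite (@comp_part _ tser (Fser R) N.+1) // big_ord_recl cfD cf_constM tser0 mul0r add0r.
  rewrite cf_sum; apply: eq_bigr => n _.
  by rewrite lift0 cf_constM cf_tser /u fps_expE.
split=> -[R0 h]; split=> //.
  apply: fserP => m; have [N0 hN] := h m.
  rewrite -[RHS]/(fps_X m) -(hN (maxn N0 m)) ?leq_maxl // -/u.
  by rewrite (part R0) // leq_maxr.
move=> m; exists m => N mN; rewrite -[LHS]/(\sum_(n < N) u n m) (part R0) // h.
by [].
Qed.

Lemma Q_at0 v : Q_at 0 v = (q v 0)%:R.
Proof.
rewrite /Q_at /Q horner_sum big_ord_recl hornerZ hornerXn mulr1 big1 ?addr0 // => i _.
by rewrite hornerZ hornerXn lift0 exprS mul0r mulr0.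
Qed.

(** * First coefficients *)

Definition row (s : seq rat) (F : fser rat) := forall i, (i < 6)%N -> coefs F i = s`_i.

(** Written with [foldr] on lists, which [vm_compute] evaluates, in place of a big operator. *)
Definition row_mul (s t : seq rat) : seq rat :=
  mkseq (fun m => foldr (fun i acc => s`_i * t`_(m - i)%N + acc) 0 (iota 0 m.+1)) 6.

Lemma row_mulP s t F H : row s F -> row t H -> row (row_mul s t) (F * H).
Proof.
move=> sF tH m m6; rewrite nth_mkseq // cfM -(big_mkord xpredT (fun i => coefs F i * coefs H (m - i))).
rewrite /index_iota subn0; have : {in iota 0 m.+1, forall i, (i <= m)%N}.
  by move=> i; rewrite mem_iota.
elim: (iota 0 m.+1) => [|i r IHr] ir; first by rewrite big_nil.
rewrite big_cons /= -IHr => [|j jr]; last by apply: ir; rewrite inE jr orbT.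
have im : (i <= m)%N by apply: ir; rewrite mem_head.
by rewrite sF ?tH //; lia.
Qed.

Definition row_add (s t : seq rat) : seq rat := mkseq (fun m => s`_m + t`_m) 6.

Lemma row_addP s t F H : row s F -> row t H -> row (row_add s t) (F + H).
Proof. by move=> sF tH m m6; rewrite nth_mkseq // cfD sF ?tH. Qed.

Lemma row_const c : row [:: c] (fconst c).
Proof. by move=> [|m] _ //=; rewrite nth_nil. Qed.

Lemma row_sum n (s : nat -> seq rat) (F : nat -> fser rat) : (forall i, row (s i) (F i)) ->
  row (foldr (fun i => row_add (s i)) [::] (iota 0 n)) (\sum_(i < n) F i).
Proof.
move=> sF; rewrite -(big_mkord xpredT F) /index_iota subn0.
elim: (iota 0 n) => [|i r IHr]; first by move=> m _; rewrite big_nil nth_nil.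
by rewrite big_cons; apply: row_addP.
Qed.

Lemma row_exp s F n : row s F -> row (iter n (row_mul s) [:: 1]) (F ^+ n).
Proof.
move=> sF; elim: n => [|n IHn]; first by move=> [|m] _; rewrite expr0 cf1 //= nth_nil.
by rewrite exprS; apply: row_mulP.
Qed.

(** The values are verified, not derived: the polynomial [p] satisfies the equation modulo X^6, and
    [comp_inj] makes such a solution unique. Six coefficients are enough because [G 3] depends on
    the coefficient of t^5 in R. *)
Lemma R_coefs r : coefs r 0%N = 0 -> comp tser r = X ->
  row [:: 0; 1; -2; -4; -20; -132] r.
Proof.
move=> r0 Tr; pose s : seq rat := [:: 0; 1; -2; -4; -20; -132].
pose p : fser rat := Fser (nth 0 s).
pose T : seq rat := [:: 0; 1; 2; 12; 100; 980].
have hT i : row [:: T`_i] (fconst T`_i) by apply: row_const.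
have tT i : (i < 6)%N -> coefs tser i = T`_i.
  case: i => [|i i6]; first by rewrite tser0.
  by rewrite cf_tser; move: i i6; do 5![case; first by move=> _; apply/eqP; vm_compute].
have ps : row s p by [].
suff : eqs 6 (comp tser r) (comp tser p).
  by move=> e i i6; rewrite (comp_inj tser0 tser1 r0 _ e).
rewrite Tr; apply: eqs_sym; apply: eqs_trans (@comp_part _ tser p 6 _) _ => //.
have -> : \sum_(i < 6) fconst (coefs tser i) * p ^+ i = \sum_(i < 6) fconst T`_i * p ^+ i.
  by apply: eq_bigr => i _; rewrite tT.
move=> m m6; rewrite (@row_sum 6 _ _ (fun i => row_mulP (hT i) (row_exp i ps)) m m6).
have -> : foldr (fun i => row_add (row_mul [:: T`_i] (iter i (row_mul s) [:: 1]))) [::] (iota 0 6) =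
  [:: 0; 1; 0; 0; 0; 0] by apply/eqP; vm_compute.
by case: m m6 => [|[|[|[|[|[|]]]]]].
Qed.

Theorem theorem1 :
  (exists2 R : fps, is_R R & forall R' : fps, is_R R' -> R' =1 R) /\
  forall R : fps, is_R R ->
    [/\ forall n : nat, G n = 2^-1 * Q_at 0 n,
        forall n : nat,
          4 * fps_mul (fps_exp fps_X 2) G n
          = fps_X n - 2 * fps_exp fps_X 2 n - R n
      & [/\ G 0%N = 0, G 1%N = 1, G 2%N = 5 & G 3%N = 33]].
Proof.
split.
  have [r r0 Tr] := comp_inverse tser0 tser1.
  exists (coefs r) => [|R' /is_RE[R0' TR'] n].
    by apply/is_RE; split=> //; rewrite -Tr; congr comp; apply: fserP.
  by apply: (@comp_inj _ _ tser0 tser1 n.+1 (Fser R') r) => //; rewrite TR' Tr.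
move=> R /is_RE[R0 TR].
have main n : 4 * fps_mul (fps_exp fps_X 2) G n = fps_X n - 2 * fps_exp fps_X 2 n - R n.
  have e := gser_tser (r := Fser R) R0 TR.
  have -> : fps_mul (fps_exp fps_X 2) G n = coefs (X ^+ 2 * gser) n.
    by rewrite fps_mulE; congr (coefs (_ * _) n); apply: fserP => m; exact: fps_expE.
  rewrite fps_expE XE; have := congr1 (fun F => coefs F n) e.
  have -> : 2%:R * (X ^+ 2 * (1 + 2%:R * gser)) = 2%:R * X ^+ 2 + 4%:R * (X ^+ 2 * gser) :> fser rat by ring.
  rewrite (cfD (2%:R * X ^+ 2)) (cfB X) !mulr_natl !cfMn => h; rewrite -[fps_X n]/(coefs X n) -[R n]/(coefs (Fser R) n).
  by rewrite -[RHS]addrAC -h [X in X - _]addrC addrK.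
(* Coefficient n + 2 of [main]; the term 2 t^2 is felt only at n = 0, where it cancels the
   coefficient -2 of t^2 in R. *)
have val n : G n = - (R n.+2 - (n == 0%N)%:R * -2) / 4.
  have := main n.+2; rewrite fps_mulE.
  have -> : Fser (fps_exp fps_X 2) = X ^+ 2 by apply: fserP => m; exact: fps_expE.
  have -> : coefs (X ^+ 2 * Fser G) n.+2 = G n by rewrite exprS expr1 -mulrA !cfXM.
  rewrite fps_expE XE cfXn !eqSS -[fps_X _]/(0 : rat) => e.
  have -> : G n = (4 * G n) / 4 by rewrite mulrAC mulfV ?mul1r.
  by rewrite e; congr (_ / _); ring.
have rw i : (i < 6)%N -> R i = _ := R_coefs (r := Fser R) R0 TR (i := i).
split=> // [n|].
  by rewrite Q_at0 q_g mulKf.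
by rewrite !val !rw //; split; apply/eqP; vm_compute.
Qed.
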